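(* Let $(\varphi_\lambda)_{\lambda\in[0,1]}$ be a differentiable parametrized family of flows on a connected differentiable $n$-manifold $M$ and let $K_0$ be a connected isolated non-saddle set of $\varphi_0$. Suppose that $K_0$ continues to a family $(K_\lambda)_{\lambda\in[0,\delta]}$, $\delta>0$, of non-empty isolated invariant compacta ($K_\lambda$ invariant for $\varphi_\lambda$). Then the following are equivalent: (1) $K_\lambda$ is non-saddle (for $\varphi_\lambda$) for all sufficiently small $\lambda>0$; (2) there exists a connected differentiable isolating block manifold $N$ of $K_0$ (for $\varphi_0$) such that, for all sufficiently small $\lambda>0$, $N$ is an isolating neighborhood of $K_\lambda$ for $\varphi_\lambda$ and each component of $N\setminus K_\lambda$ contains exactly one component of $\partial N$.
   Context: A differentiable parametrized family of flows on a smooth manifold $M$ is a family of flows $\varphi_\lambda:M\times\mathbb{R}\to M$, $\lambda\in I=[0,1]$, such that the map $M\times\mathbb{R}\times I\to M$, $(x,t,\lambda)\mapsto\varphi_\lambda(x,t)$, is differentiable. For a flow $\varphi$ on $M$ write $xt=\varphi(x,t)$. A compact invariant set $K$ is isolated if it has a compact neighborhood $N$ (an isolating neighborhood; one says $N$ isolates $K$) such that $K$ is the maximal invariant set in $N$. Isolated invariant sets are assumed to be non-empty proper subsets of the phase space. An isolating block is an isolating neighborhood $N$ for which there are compact sets $N^i,N^o\subset\partial N$ (entrance and exit sets) with: (1) $\partial N=N^i\cup N^o$; (2) for every $x\in N^i$ there is $\varepsilon>0$ with $x[-\varepsilon,0)\subset M\setminus N$, and for every $x\in N^o$ there is $\delta>0$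 with $x(0,\delta]\subset M\setminus N$; (3) for every $x\in\partial N\setminus N^i$ there is $\varepsilon>0$ with $x[-\varepsilon,0)\subset\mathring N$, and for every $x\in\partial N\setminus N^o$ there is $\delta>0$ with $x(0,\delta]\subset\mathring N$. A differentiable isolating block manifold is an isolating block $N$ which is a smooth manifold with boundary containing $N^i$ and $N^o$ as submanifolds of its boundary, with $\partial N^i=\partial N^o=N^i\cap N^o$. An invariant compactum $K$ is saddle if there is a neighborhood $U$ of $K$ such that every neighborhood $V$ of $K$ contains a point $x$ with $x[0,\infty)\not\subset U$ and $x(-\infty,0]\not\subset U$; otherwise $K$ is non-saddle. For a closed non-degenerate subinterval $J\subset[0,1]$, a family $(K_\lambda)_{\lambda\in J}$, with $K_\lambda$ an isolated invariant set for $\varphi_\lambda$, is a continuation (of each of its members) if for each $\lambda_0\in J$ and each isolating neighborhood $N_{\lambda_0}$ of $K_{\lambda_0}$ (for $\varphi_{\lambda_0}$) there is $\eta>0$ such that $N_{\lambda_0}$ is an isolating neighborhood of $K_\lambda$ (for $\varphi_\lambda$) for every $\lambda\in(\lambda_0-\eta,\lambda_0+\eta)\cap J$. ''$K_0$ continues to $(K_\lambda)_{\lambda\in[0,\delta]}$'' means that this family is a continuation whose member at $\lambda=0$ is $K_0$. *)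

(* Defs.v *)
From mathcomp Require Import all_boot all_order all_algebra.
From mathcomp Require Import all_classical all_reals all_analysis.

Set Implicit Arguments.
Unset Strict Implicit.
Unset Printing Implicit Defensive.

Import Order.TTheory GRing.Theory Num.Theory.
Import numFieldNormedType.Exports.

Local Open Scope classical_set_scope.
Local Open Scope ring_scope.

(* "Differentiable" and "smooth" both mean C^oo throughout; manifolds are      *)
(* Hausdorff and second countable, and have no boundary unless one is          *)
(* mentioned.                                                                  *)

(* C^k on the open set U: all iterated directional derivatives of order <= k   *)
(* exist and are continuous on U.  The domain V is always finite dimensional   *)
(* below, where this is the usual notion.                                      *)
Fixpoint Ck (R : realType) (V W : normedModType R) (k : nat) (U : set V)
    (f : V -> W) : Prop :=
  (forall x, U x -> {for x, continuous f}) /\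
  match k with
  | 0%N => True
  | k'.+1 => forall v : V,
      (forall x, U x -> derivable f x v) /\ Ck k' U ('D_v f)
  end.

(* Smoothness on an arbitrary set A: local extendability to C^oo maps on open  *)
(* sets.                                                                       *)
Definition smooth_on (R : realType) (V W : normedModType R) (A : set V)
    (f : V -> W) : Prop :=
  forall x, A x -> exists (U : set V) (F : V -> W),
    [/\ open U, U x, (forall k, Ck k U F) & forall y, U y -> A y -> F y = f y].

(* chart_map and chart_inv are total functions, meaningful only on chart_dom   *)
(* and on its image respectively.                                              *)
Record chart (R : realType) (n : nat) (M : topologicalType) := Chart {
  chart_dom : set M;
  chart_map :> M -> 'rV[R]_n;
  chart_inv : 'rV[R]_n -> M;
  chart_dom_open : open chart_dom;
  chart_im_open : open (chart_map @` chart_dom);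
  chart_mapK : forall x, chart_dom x -> chart_inv (chart_map x) = x;
  chart_map_continuous :
    forall x, chart_dom x -> {for x, continuous chart_map};
  chart_inv_continuous :
    forall x, chart_dom x -> {for chart_map x, continuous chart_inv}
}.

Definition chart_im (R : realType) (n : nat) (M : topologicalType)
    (c : chart R n M) : set 'rV[R]_n := c @` chart_dom c.

Definition chart_compatible (R : realType) (n : nat) (M : topologicalType)
    (c d : chart R n M) : Prop :=
  smooth_on (c @` (chart_dom c `&` chart_dom d)) (d \o chart_inv c) /\
  smooth_on (d @` (chart_dom c `&` chart_dom d)) (c \o chart_inv d).

Record smooth_manifold (R : realType) (n : nat) := SmoothManifold {
  mfd_space :> topologicalType;
  mfd_hausdorff : hausdorff_space mfd_space;
  mfd_second_countable : @second_countable mfd_space;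
  mfd_atlas : set (chart R n mfd_space);
  mfd_atlas_cover : forall x : mfd_space,
    exists2 c, mfd_atlas c & chart_dom c x;
  mfd_atlas_compatible : forall c d,
    mfd_atlas c -> mfd_atlas d -> chart_compatible c d
}.

Section Submanifolds.
Variables (R : realType) (n : nat) (M : smooth_manifold R n).
Implicit Types (S : set M) (p : M) (k : nat) (c : chart R n M).

Definition maximal_atlas : set (chart R n M) :=
  [set c | forall d, mfd_atlas d -> chart_compatible c d].

(* R^k x {0} in R^n *)
Definition model_space k : set 'rV[R]_n :=
  [set u | forall i : 'I_n, (k <= i)%N -> u 0 i = 0].

(* [0, +oo[ x R^(k-1) x {0} in R^n *)
Definition model_half_space k : set 'rV[R]_n :=
  [set u | model_space k u /\ forall i : 'I_n, i = 0%N :> nat -> 0 <= u 0 i].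

Definition straightens c S (L : set 'rV[R]_n) : Prop :=
  forall q, chart_dom c q -> (S q <-> L (c q)).

Definition mfd_interior_point k S p : Prop :=
  S p /\ exists c, [/\ maximal_atlas c, chart_dom c p
                     & straightens c S (model_space k)].

Definition mfd_boundary_point k S p : Prop :=
  S p /\ (0 < k)%N /\ exists c,
    [/\ maximal_atlas c, chart_dom c p, straightens c S (model_half_space k)
      & forall i : 'I_n, i = 0%N :> nat -> c p 0 i = 0].

(* S is an embedded smooth k-submanifold of M, possibly with boundary; S need  *)
(* not be closed in M.                                                         *)
Definition submanifold k S : Prop :=
  forall p, S p -> mfd_interior_point k S p \/ mfd_boundary_point k S p.

Definition mfd_boundary k S : set M := [set p | mfd_boundary_point k S p].

End Submanifolds.

Definition frontier (T : topologicalType) (A : set T) : set T :=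
  closure A `\` interior A.

Definition is_component (T : topologicalType) (A C : set T) : Prop :=
  exists2 x, A x & C = connected_component A x.

Section Flows.
Variables (R : realType) (M : topologicalType).
Implicit Types (phi : M -> R -> M) (K N : set M).

Definition is_flow phi : Prop :=
  [/\ continuous (fun z : M * R => phi z.1 z.2),
      forall x, phi x 0 = x
    & forall x s t, phi (phi x s) t = phi x (s + t)].

Definition invariant phi K : Prop := forall x t, K x -> K (phi x t).

Definition isolates phi N K : Prop :=
  [/\ compact N, K `<=` interior N, compact K, invariant phi K
    & forall L, invariant phi L -> L `<=` N -> L `<=` K].

Definition isolated_invariant phi K : Prop :=
  [/\ K !=set0, K != setT & exists N, isolates phi N K].

Definition block_sets phi N (Ni No : set M) : Prop :=
  [/\ [/\ compact Ni, compact No & frontier N = Ni `|` No],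
      (forall x, Ni x -> exists2 e : R, 0 < e &
         forall t, - e <= t < 0 -> ~ N (phi x t)),
      (forall x, No x -> exists2 e : R, 0 < e &
         forall t, 0 < t <= e -> ~ N (phi x t)),
      (forall x, frontier N x -> ~ Ni x -> exists2 e : R, 0 < e &
         forall t, - e <= t < 0 -> interior N (phi x t))
    & (forall x, frontier N x -> ~ No x -> exists2 e : R, 0 < e &
         forall t, 0 < t <= e -> interior N (phi x t))].

Definition saddle phi K : Prop :=
  exists U : set M, K `<=` interior U /\
    forall V : set M, K `<=` interior V ->
      exists x, [/\ V x, ~ (forall t, 0 <= t -> U (phi x t))
                  & ~ (forall t, t <= 0 -> U (phi x t))].

Definition non_saddle phi K : Prop := ~ saddle phi K.

(* The values of K outside the parameter set J are irrelevant. *)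
Definition continuation (phi : R -> M -> R -> M) (J : set R)
    (K : R -> set M) : Prop :=
  (forall l, J l -> isolated_invariant (phi l) (K l)) /\
  forall l0 N, J l0 -> isolates (phi l0) N (K l0) ->
    exists2 eta : R, 0 < eta &
      forall l, l0 - eta < l < l0 + eta -> J l -> isolates (phi l) N (K l).

End Flows.

(* phi l is meaningful only for l in [0, 1]. *)
Definition smooth_flow_family (R : realType) (n : nat)
    (M : smooth_manifold R n) (phi : R -> M -> R -> M) : Prop :=
  [/\ forall l, 0 <= l <= 1 -> is_flow (phi l),
      {within [set z : M * R * R | 0 <= z.2 <= 1],
         continuous (fun z : M * R * R => phi z.2 z.1.1 z.1.2)}
    & forall c d : chart R n M, mfd_atlas c -> mfd_atlas d ->
        smooth_on
          [set z : 'rV[R]_n * R * R |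
            [/\ chart_im c z.1.1, 0 <= z.2 <= 1
              & chart_dom d (phi z.2 (chart_inv c z.1.1) z.1.2)]]
          (fun z : 'rV[R]_n * R * R =>
             d (phi z.2 (chart_inv c z.1.1) z.1.2))].

(* N is a domain (codimension 0 submanifold with boundary) of M, so that its   *)
(* manifold boundary is its frontier; Ni and No have codimension 0 in it.      *)
Definition isolating_block_manifold (R : realType) (n : nat)
    (M : smooth_manifold R n) (phi : M -> R -> M) (N K : set M) : Prop :=
  isolates phi N K /\ submanifold n N /\
  exists Ni No : set M,
    [/\ block_sets phi N Ni No,
        submanifold n.-1 Ni, submanifold n.-1 No,
        mfd_boundary n.-1 Ni = Ni `&` No
      & mfd_boundary n.-1 No = Ni `&` No].

(* Main.v *)
(** Near a non-saddle isolated set every orbit stays close either in forward or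
    in backward time. A smooth [h >= 0] that vanishes near [K] and is positive away
    from it gives the Lyapunov function [H x = int_0^T e^t h(xt) dt]: along the flow
    its derivative is [e^T h(xT) - h(x) - H(x)], which is negative where [H > 0] as
    soon as [T] is so large that [h(xT) = 0] on the attracted part. The sublevel
    sets of [H] and of its analogue for the reversed flow therefore glue to a block
    [N] with smooth boundary, and since the crossing of the boundary is transverse,
    [N] is also a block for the flows of small parameter.

    In a connected block of a non-saddle set every point has its forward or its
    backward orbit in [N]. For (1) => (2) this is applied to [K_l]: a component of
    [N \ K_l] is the union of the forward (or backward) orbits of its frontier
    points, so these form a connected set. For (2) => (1) it is applied to [K_0], so
    that the entrance and exit sets are disjoint; if a component [C] of [N \ K_l] has
    all its frontier points in the entrance set, then an orbit in [C] can leave [N]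
    only through the entrance set, from where it returns to [C] one time unit later,
    so it stays in a slightly larger isolating neighborhood, whence [K_l] is
    non-saddle. *)

Require Import Defs.
From mathcomp Require Import all_boot all_order all_algebra.
From mathcomp Require Import all_classical all_reals all_analysis.
From mathcomp Require Import ring lra perm.

Set Implicit Arguments.
Unset Strict Implicit.
Unset Printing Implicit Defensive.

Import Order.TTheory GRing.Theory Num.Theory.
Import numFieldNormedType.Exports.

Local Open Scope classical_set_scope.
Local Open Scope ring_scope.

(** * Calculus of C^k maps *)

(** The two implications differ in what is known about the block. In (2) => (1) the block [N] is
    given: the flow need not be transverse to its frontier, so [N] may fail to be a block of
    [phi l], and an orbit of [phi l] may leave [N] even through the entrance set. What survives the
    perturbation is compact information at time 1: [phi 0] maps the entrance set into the interior
    of [N]. Hence the returns after one time unit, the larger neighborhood [N'], and an explicit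
    path showing that the return ends in the same component. In (1) => (2) the block is built from
    [phi 0] alone, out of transverse level sets; it then has the same entrance and exit sets for all
    small parameters, and only at that point is (1) used. Transversality is free: on the level [c]
    the Lyapunov function of a trapped orbit decreases at rate at least [c], so every positive level
    will do. The entrance and exit sets are disjoint there, so the boundary condition on them says
    that a regular level set has no boundary point in any compatible chart; this needs an argument
    of its own. *)

Section Ck_general.
Variables (R : realType) (V W : normedModType R).
Implicit Types (k : nat) (U : set V) (f g : V -> W).

Lemma Ck_continuous k U f x : Ck k U f -> U x -> {for x, continuous f}.
Proof. by case: k => [|k] [cf _] Ux; exact: cf. Qed.

Lemma Ck_derivable k U f x v : Ck k.+1 U f -> U x -> derivable f x v.
Proof. by move=> [_ /(_ v)[df _]] Ux; exact: df. Qed.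

Lemma Ck_derive k U f v : Ck k.+1 U f -> Ck k U ('D_v f).
Proof. by move=> [_ /(_ v)[]]. Qed.

Lemma Ck_pred k U f : Ck k.+1 U f -> Ck k U f.
Proof.
elim: k f => [|k ih] f [cf df]; first by split.
by split=> // v; have [dfv /ih] := df v.
Qed.

Lemma Ck_subset k U U' f : U' `<=` U -> Ck k U f -> Ck k U' f.
Proof.
move=> UU'; elim: k f => [|k ih] f [cf df]; first by split=> // x /UU' /cf.
split=> [x /UU' /cf //|v]; have [dfv /ih] := df v.
by split=> // x /UU' /dfv.
Qed.

Lemma eq_Ck k U f g : open U -> (forall x, U x -> f x = g x) ->
  Ck k U f -> Ck k U g.
Proof.
move=> oU; elim: k f g => [|k ih] f g fg.
  move=> [cf _]; split=> // x Ux.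
  have nfg : \forall y \near x, f y = g y.
    by apply: filterS fg _; exact: open_nbhs_nbhs.
  suff: g @ x --> g x by []; rewrite -(fg _ Ux).
  exact: cvg_trans (near_eq_cvg nfg) (cf _ Ux).
move=> [cf df].
have nfg x : U x -> \forall y \near x, f y = g y.
  by move=> Ux; apply: filterS fg _; exact: open_nbhs_nbhs.
split=> [x Ux|v].
  suff: g @ x --> g x by []; rewrite -(fg _ Ux).
  exact: cvg_trans (near_eq_cvg (nfg _ Ux)) (cf _ Ux).
have [dfv Cfv] := df v; split=> [x Ux|].
  exact: near_eq_derivable (nfg _ Ux) (dfv _ Ux).
apply: ih Cfv => x Ux; exact: near_eq_derive (nfg _ Ux).
Qed.

Lemma Ck_cst k U (a : W) : Ck k U (cst a).
Proof.
have aux k' (b : W) : Ck k' U (cst b).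
  elim: k' b => [|k' ih] b; split=> //; try by move=> x _; exact: cvg_cst.
  move=> v; split=> [x _|]; first exact: derivable_cst.
  rewrite (_ : 'D_v (cst b) = cst 0); first exact: ih.
  by apply/funext => x; rewrite derive_cst.
exact: aux.
Qed.

Lemma Ck_add k U f g : open U -> Ck k U f -> Ck k U g ->
  Ck k U (fun x => f x + g x).
Proof.
move=> oU; elim: k f g => [|k ih] f g [cf df] [cg dg]; split=> //;
  try by move=> x Ux; apply: cvgD; [exact: cf|exact: cg].
move=> v; have [dfv Cfv] := df v; have [dgv Cgv] := dg v; split=> [x Ux|].
  by apply: derivableD; [exact: dfv|exact: dgv].
apply: eq_Ck (ih _ _ Cfv Cgv) => // x Ux.
by rewrite -deriveD//; [exact: dfv|exact: dgv].
Qed.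

Lemma Ck_sum k U m (f : 'I_m -> V -> W) : open U ->
  (forall i, Ck k U (f i)) -> Ck k U (fun x => \sum_(i < m) f i x).
Proof.
move=> oU; elim: m f => [|m ih] f Cf.
  apply: (eq_Ck oU _ (Ck_cst k U 0)) => x _.
  by rewrite big_ord0.
apply: (@eq_Ck _ _ (fun x => (\sum_(i < m) f (widen_ord (leqnSn m) i) x) +
   f ord_max x)) => //; last by apply: Ck_add => //; exact: ih.
by move=> x _; rewrite big_ord_recr.
Qed.

(** The difference quotients of [f \o i] along [v] are those of [f] along [L v], so no chain rule is
    involved. This serves domains that are products with time and parameter. *)
Lemma Ck_affine_comp (V' : normedModType R) k U f (i : V' -> V) (L : V' -> V) :
  continuous i -> (forall x v h, i (h *: v + x) = h *: L v + i x) ->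
  Ck k U f -> Ck k (i @^-1` U) (f \o i).
Proof.
move=> ci iL; elim: k f => [|k ih] f [cf df]; split=> //;
  try by move=> x Ux; apply: continuous_comp; [exact: ci|exact: cf].
move=> v; have [dfv Cfv] := df (L v).
have E x : (fun h => h^-1 *: (((f \o i) \o shift x) (h *: v) - (f \o i) x)) =
  (fun h => h^-1 *: ((f \o shift (i x)) (h *: L v) - f (i x))).
  by apply/funext => h /=; rewrite iL.
split=> [x Ux|]; first by rewrite /derivable E; exact: dfv.
rewrite (_ : 'D_v (f \o i) = 'D_(L v) f \o i); first exact: ih.
by apply/funext => x; rewrite /derive E.
Qed.

Lemma Ck_affine k U f (L : V -> W) :
  continuous f -> (forall x v h, f (h *: v + x) = h *: L v + f x) ->
  Ck k U f.
Proof.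
move=> cf fL.
have cU x : U x -> {for x, continuous f} by move=> _; exact: cf.
case: k => [|k]; split=> // v.
have E x : (fun h => h^-1 *: ((f \o shift x) (h *: v) - f x)) @ 0^' --> L v.
  have /near_eq_cvg E1 : \forall h \near 0^',
    cst (L v) h = h^-1 *: ((f \o shift x) (h *: v) - f x).
    near=> h; rewrite /= fL addrK scalerA mulVf ?scale1r//.
    by near: h; exact: nbhs_dnbhs_neq.
  by apply: cvg_trans E1 _; exact: cvg_cst.
split=> [x _|]; first by apply/cvg_ex; exists (L v); exact: E.
rewrite (_ : 'D_v f = cst (L v)); first exact: Ck_cst.
apply/funext => x; exact: cvg_lim (E x).
Unshelve. all: by end_near. Qed.

End Ck_general.

Section Ck_real.
Variables (R : realType) (V : normedModType R).
Implicit Types (k : nat) (U : set V) (f g : V -> R).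

Lemma Ck_mul k U f g : open U -> Ck k U f -> Ck k U g ->
  Ck k U (fun x => f x * g x).
Proof.
move=> oU; elim: k f g => [|k ih] f g Cf Cg.
  split=> // x Ux.
  by apply: cvgM; [exact: Ck_continuous Cf Ux|exact: Ck_continuous Cg Ux].
split=> [x Ux|v].
  by apply: cvgM; [exact: Ck_continuous Cf Ux|exact: Ck_continuous Cg Ux].
have dfv x := @Ck_derivable _ _ _ _ _ _ x v Cf.
have dgv x := @Ck_derivable _ _ _ _ _ _ x v Cg.
split=> [x Ux|].
  by apply: derivableM; [exact: dfv|exact: dgv].
have C := Ck_add oU (ih _ _ (Ck_pred Cf) (Ck_derive v Cg))
   (ih _ _ (Ck_pred Cg) (Ck_derive v Cf)).
apply: eq_Ck C => // x Ux.
by have := @deriveM _ _ f g x v (dfv _ Ux) (dgv _ Ux) => ->.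
Qed.

Lemma Ck_opp k U f : open U -> Ck k U f -> Ck k U (fun x => - f x).
Proof.
move=> oU Cf.
apply: (eq_Ck oU _ (Ck_mul oU (Ck_cst k U (-1 : R)) Cf)) => x _ /=.
by rewrite mulN1r.
Qed.

Lemma Ck_inv k U f : open U -> (forall x, U x -> f x != 0) ->
  Ck k U f -> Ck k U (fun x => (f x)^-1).
Proof.
move=> oU f0; elim: k => [|k ih] Cf.
  by split=> // x Ux; apply: cvgV; [exact: f0|exact: Ck_continuous Cf Ux].
split=> [x Ux|v].
  by apply: cvgV; [exact: f0|exact: Ck_continuous Cf Ux].
have dfv x := @Ck_derivable _ _ _ _ _ _ x v Cf.
split=> [x Ux|]; first by apply: derivableV; [exact: f0|exact: dfv].
have C := Ck_opp oU (Ck_mul oU (Ck_mul oU (ih (Ck_pred Cf)) (ih (Ck_pred Cf)))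
   (Ck_derive v Cf)).
apply: eq_Ck C => // x Ux.
rewrite deriveV//; [|exact: f0|exact: dfv].
by rewrite expr2 invfM /GRing.scale/= mulNr.
Qed.

Lemma continuous_coordP m x (h : V -> 'rV[R]_m) : {for x, continuous h} <->
  forall i, {for x, continuous (fun x => h x 0 i)}.
Proof.
split=> [ch i|ch].
  apply: (@continuous_comp _ _ _ h (fun M : 'rV[R]_m => M 0 i)) => //.
  exact: coord_continuous.
apply/cvgrPdist_le => e e0.
near=> y.
rewrite /Num.Def.normr/= mx_normrE (bigmax_le _ (ltW e0))//= => -[i j] _.
rewrite !mxE/= ord1; move: j; near: y; apply: filter_forall => j.
by have /cvgrPdist_le/(_ _ e0) := ch j.
Unshelve. all: by end_near. Qed.

Lemma Ck_coord m k U (f : V -> 'rV[R]_m) : open U ->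
  Ck k U f <-> forall i, Ck k U (fun x => f x 0 i).
Proof.
move=> oU; elim: k f => [|k ih] f.
  split=> [[cf _] i|Cf]; split=> // x Ux.
    by have /continuous_coordP := cf _ Ux.
  by apply/continuous_coordP => i; have [+ _] := Cf i; apply.
have dE x v i : derivable f x v ->
    'D_v f x 0 i = 'D_v (fun x => f x 0 i) x.
  by move=> dfx; rewrite derive_mx// mxE.
split=> [Cf i|Cf].
  split=> [x Ux|v].
    by have /continuous_coordP := Ck_continuous Cf Ux; apply.
  have dfv x (Ux : U x) : derivable f x v := Ck_derivable Cf Ux.
  split=> [x Ux|]; first by have /derivable_mxP := dfv _ Ux; apply.
  have /ih/(_ i) := Ck_derive v Cf.
  by apply: eq_Ck => // x Ux; rewrite dE//; exact: dfv.
have dfv v x : U x -> derivable f x v.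
  move=> Ux; apply/derivable_mxP => i j; rewrite (ord1 i).
  exact: Ck_derivable (Cf j) Ux.
split=> [x Ux|v].
  by apply/continuous_coordP => i; exact: Ck_continuous (Cf i) Ux.
split=> [x Ux|]; first exact: dfv.
apply/ih => i; have := Ck_derive v (Cf i).
by apply: eq_Ck => // x Ux; rewrite dE//; exact: dfv.
Qed.
End Ck_real.

(** * Mean value theorem, Hadamard's lemma and the chain rule *)

Section Chain.
Variable R : realType.

Lemma MVT_line (V : normedModType R) (f : V -> R) (x v : V) :
  (forall s : R, 0 <= s <= 1 -> derivable f (s *: v + x) v) ->
  exists2 s : R, 0 <= s <= 1 & f (v + x) - f x = 'D_v f (s *: v + x).
Proof.
move=> df; pose g (s : R) := f (s *: v + x).
have E (s : R) : (fun h : R => h^-1 *: ((g \o shift s) (h *: 1) - g s)) =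
    (fun h => h^-1 *: ((f \o shift (s *: v + x)) (h *: v) - f (s *: v + x))).
  by apply/funext => h; rewrite /g /= [h *: 1]mulr1 scalerDl addrA.
have dg (s : R) : 0 <= s <= 1 -> is_derive s 1 g ('D_v f (s *: v + x)).
  move=> s01; apply: DeriveDef; last by rewrite /derive E.
  by rewrite /derivable E; exact: df.
have [||c c01] := @MVT_segment R g (fun s => 'D_v f (s *: v + x)) 0 1 ler01.
- by move=> s; rewrite in_itv/= => /andP[s0 s1]; apply: dg; rewrite !ltW.
- apply: derivable_within_continuous => s; rewrite in_itv/= => /dg[]//.
by rewrite /g scale1r scale0r add0r subr0 mulr1; exists c => //; move: c01; rewrite in_itv.
Qed.

Lemma derivable_scale (V : normedModType R) (f : V -> R) (x v : V) (c : R) :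
  derivable f x v -> derivable f x (c *: v) /\ 'D_(c *: v) f x = c * 'D_v f x.
Proof.
move=> df.
have [->|c0] := eqVneq c 0.
  by rewrite scale0r mul0r; split; [exact: derivable0|rewrite derive0].
suff cv : (fun h => h^-1 *: ((f \o shift x) (h *: (c *: v)) - f x)) @ 0^'
    --> c * 'D_v f x.
  by split; [apply/cvg_ex; exists (c * 'D_v f x)|exact: cvg_lim cv].
have nc0 : 0 < `|c| by rewrite normr_gt0.
apply/cvgrPdist_le => e e0; have /cvgrPdist_le/(_ (e / `|c|)) := df.
rewrite divr_gt0// => /(_ isT)[r /= r0 rP].
exists (r / `|c|); first by rewrite /= divr_gt0.
move=> h /=; rewrite sub0r normrN ltr_pdivlMr// => hr h0.
have := rP (h * c); rewrite /= sub0r normrN normrM => /(_ hr).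
rewrite mulf_neq0// => /(_ isT); rewrite ler_pdivlMr// -normrM; apply: le_trans.
rewrite le_eqVlt; apply/orP; left; apply/eqP; congr (`| _ |).
rewrite scalerA mulrBl mulrC; congr (_ - _).
by rewrite /GRing.scale/= invfM -mulrA mulrCA mulrC -!mulrA mulVf ?mulr1// mulrC.
Qed.

Lemma cvg_sum_ord (T : Type) (F : set_system T) (FF : Filter F) m
    (f : 'I_m -> T -> R) (l : 'I_m -> R) : (forall i, f i @ F --> l i) ->
  (fun t => \sum_(i < m) f i t) @ F --> \sum_(i < m) l i.
Proof.
elim: m f l => [|m ih] f l fl.
  rewrite big_ord0 (_ : (fun _ => _) = cst 0); first exact: cvg_cst.
  by apply/funext => t; rewrite big_ord0.
rewrite big_ord_recr/=.
rewrite (_ : (fun _ => _) = (fun t => \sum_(i < m)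
    f (widen_ord (leqnSn m) i) t + f ord_max t)); last first.
  by apply/funext => t; rewrite big_ord_recr.
by apply: cvgD; [apply: ih => i; exact: fl|exact: fl].
Qed.

Local Notation e_ := (delta_mx 0).

(* The sum telescopes along a path from x to y changing one coordinate at a time. *)
Lemma hadamard m (f : 'rV[R]_m -> R) (U : set 'rV[R]_m) (x y : 'rV[R]_m) :
  Ck 1 U f ->
  (forall z : 'rV[R]_m, (forall k, `|z 0 k - x 0 k| <= `|y 0 k - x 0 k|) -> U z) ->
  exists xi : 'I_m -> 'rV[R]_m,
    (forall i k, `|xi i 0 k - x 0 k| <= `|y 0 k - x 0 k|) /\
    f y - f x = \sum_(i < m) (y 0 i - x 0 i) * 'D_(e_ i) f (xi i).
Proof.
move=> Cf xyU.
pose z (j : nat) : 'rV[R]_m := \row_k (if (k < j)%N then y 0 k else x 0 k).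
pose v (i : 'I_m) : 'rV[R]_m := (y 0 i - x 0 i) *: e_ i.
have zS (i : 'I_m) : z i.+1 = v i + z i.
  apply/rowP => k; rewrite !mxE /= ltnS.
  have [->|ki] := eqVneq k i; first by rewrite leqnn ltnn mulr1 subrK.
  by rewrite mulr0 add0r leq_eqVlt (negbTE (ki : (k : nat) != i)).
have zin (s : R) i k : 0 <= s <= 1 ->
    `|(s *: v i + z i) 0 k - x 0 k| <= `|y 0 k - x 0 k|.
  move=> /andP[s0 s1]; rewrite !mxE /=.
  have [->|ki] := eqVneq k i.
    by rewrite ltnn mulr1 addrK normrM ger0_norm// ler_piMl.
  by rewrite !mulr0 add0r; case: ifP => // _; rewrite subrr normr0.
have H (i : 'I_m) : exists w : 'rV[R]_m, (forall k, `|w 0 k - x 0 k| <= `|y 0 k - x 0 k|) /\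
    f (z i.+1) - f (z i) = (y 0 i - x 0 i) * 'D_(e_ i) f w.
  have [|s s01 E] := @MVT_line _ f (z i) (v i).
    by move=> s s01; apply: (Ck_derivable Cf); apply: xyU => k; exact: zin.
  exists (s *: v i + z i); split=> [k|]; first exact: zin.
  rewrite zS E.
  have [|_ ->//] := @derivable_scale _ f (s *: v i + z i) (e_ i) (y 0 i - x 0 i).
  by apply: (Ck_derivable Cf); apply: xyU => k; exact: zin.
have [xi xiP] := choice H; exists xi; split=> [i k|]; first by have [+ _] := xiP i.
have -> : y = z m by apply/rowP => k; rewrite mxE ltn_ord.
have -> : x = z 0%N by apply/rowP => k; rewrite mxE.
rewrite -(telescope_sumr (fun j => f (z j)) (leq0n m)) big_mkord.
apply: eq_bigr => i _; have [_ ->] := xiP i.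
by congr (_ * _); rewrite !mxE ltn_ord.
Qed.

Lemma ball_rV m (x y : 'rV[R]_m) r : 0 < r ->
  ball x r y <-> forall k, `|y 0 k - x 0 k| < r.
Proof.
move=> r0; split=> [[_ xy] k|xy]; first by rewrite distrC; exact: xy.
by split=> // i k; rewrite (ord1 i) /ball/= distrC; exact: xy.
Qed.

Lemma cvg_coordP (T : Type) (F : set_system T) (FF : Filter F) m
    (h : T -> 'rV[R]_m) (l : 'rV[R]_m) :
  h @ F --> l <-> forall k, (fun t => h t 0 k) @ F --> l 0 k.
Proof.
split=> [hl k|hl].
  apply: (@cvg_comp _ _ _ h (fun M : 'rV[R]_m => M 0 k) F (nbhs l)) => //.
  exact: coord_continuous.
apply/cvgrPdist_le => e e0.
near=> y.
rewrite /Num.Def.normr/= mx_normrE (bigmax_le _ (ltW e0))//= => -[i j] _.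
rewrite !mxE/= ord1; move: j; near: y; apply: filter_forall => j.
by have /cvgrPdist_le/(_ _ e0) := hl j.
Unshelve. all: by end_near. Qed.

(** The mean value points lie in the box spanned by [a] and [c t], so the partial derivatives there
    converge. This takes the place of a total derivative, both in the chain rule and in
    differentiating an inverse map. *)
Lemma hadamard_cvg (T : Type) (F : set_system T) (FF : Filter F) m
    (g : 'rV[R]_m -> R) (U : set 'rV[R]_m) (a : 'rV[R]_m) (c : T -> 'rV[R]_m) :
  open U -> U a -> Ck 1 U g -> c @ F --> a ->
  exists D : 'I_m -> T -> R, (forall i, D i @ F --> 'D_(e_ i) g a) /\
    \forall t \near F,
      g (c t) - g a = \sum_(i < m) (c t 0 i - a 0 i) * D i t.
Proof.
move=> oU Ua Cg ca.
have [r /= r0 aU] : exists2 r : R, 0 < r & ball a r `<=` U.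
  by have /nbhs_ballP[r r0 rU] := open_nbhs_nbhs (conj oU Ua); exists r.
have H y : exists xi : 'I_m -> 'rV[R]_m, ball a r y ->
    (forall i k, `|xi i 0 k - a 0 k| <= `|y 0 k - a 0 k|) /\
    g y - g a = \sum_(i < m) (y 0 i - a 0 i) * 'D_(e_ i) g (xi i).
  (* Outside the ball the points are arbitrary: [c t] eventually lies inside. *)
  have [/(ball_rV _ _ r0) yr|nb] := pselect (ball a r y); last by exists (fun _ => 0).
  have [|xi xiP] := @hadamard _ _ _ a y Cg; last by exists xi.
  move=> z zy; apply: aU; apply/ball_rV => // k; exact: le_lt_trans (zy k) (yr k).
have [xi xiP] := choice H.
have cr : \forall t \near F, ball a r (c t) by apply: ca; exact: nbhsx_ballx.
exists (fun i t => 'D_(e_ i) g (xi (c t) i)); split=> [i|]; last first.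
  by apply: filterS cr => t /xiP[].
have xia : (fun t => xi (c t) i) @ F --> a.
  apply/cvg_coordP => k; apply/cvgrPdist_le => e e0.
  have /cvg_coordP/(_ k)/cvgrPdist_le/(_ _ e0) := ca.
  apply: filterS2 cr => t ct; rewrite distrC => cte.
  by rewrite distrC (le_trans _ cte)//; have [+ _] := xiP _ ct; exact.
have ci : {for a, continuous ('D_(e_ i) g)} := Ck_continuous (Ck_derive (e_ i) Cg) Ua.
exact: (@cvg_comp _ _ _ _ ('D_(e_ i) g) _ _ _ xia ci).
Qed.

Lemma derive_comp_rV (V : normedModType R) m (f : V -> 'rV[R]_m)
    (g : 'rV[R]_m -> R) (U : set 'rV[R]_m) x v :
  open U -> Ck 1 U g -> U (f x) -> derivable f x v ->
  derivable (g \o f) x v /\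
  'D_v (g \o f) x = \sum_(i < m) 'D_v f x 0 i * 'D_(e_ i) g (f x).
Proof.
move=> oU Cg Ufx df.
suff cv : (fun h => h^-1 *: (((g \o f) \o shift x) (h *: v) - (g \o f) x)) @ 0^'
    --> \sum_(i < m) 'D_v f x 0 i * 'D_(e_ i) g (f x).
  by split; [apply/cvg_ex; eexists; exact: cv|exact: cvg_lim cv].
have cf : (fun h : R => f (h *: v + x)) @ 0^' --> f x.
  have /derivable1P/derivable1_diffP/differentiable_continuous := df.
  by move=> /continuous_withinNx; rewrite scale0r add0r.
have [D [Dc DE]] := hadamard_cvg _ oU Ufx Cg cf.
have : (fun h : R => \sum_(i < m)
    (h^-1 *: ((f \o shift x) (h *: v) - f x)) 0 i * D i h) @ 0^'
    --> \sum_(i < m) 'D_v f x 0 i * 'D_(e_ i) g (f x).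
  apply: cvg_sum_ord => i; apply: cvgM => //.
  by have /cvg_coordP := df; apply.
apply: cvg_trans; apply: near_eq_cvg; apply: filterS DE => h /= ->.
rewrite /GRing.scale/= mulr_sumr; apply: eq_bigr => i _.
by rewrite !mxE mulrA.
Qed.

Lemma Ck_comp (V : normedModType R) m k (f : V -> 'rV[R]_m)
    (g : 'rV[R]_m -> R) (U : set 'rV[R]_m) (U' : set V) :
  open U -> open U' -> (forall x, U' x -> U (f x)) ->
  Ck k U' f -> Ck k U g -> Ck k U' (g \o f).
Proof.
move=> oU oU' fU; elim: k g => [|k ih] g Cf Cg.
  split=> // x U'x; apply: continuous_comp.
    exact: Ck_continuous Cf U'x.
  by apply: Ck_continuous Cg _; exact: fU.
have C1 : Ck 1 U g.
  by split=> [x Ux|v]; [exact: Ck_continuous Cg Ux|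
    split=> [x Ux|]; [exact: Ck_derivable Cg Ux|
    split=> // x Ux; exact: Ck_continuous (Ck_derive v Cg) Ux]].
have H x v : U' x -> _ := fun U'x =>
  @derive_comp_rV _ _ f g U x v oU C1 (fU _ U'x) (Ck_derivable Cf U'x).
split=> [x U'x|v].
  apply: continuous_comp; first exact: Ck_continuous Cf U'x.
  by apply: Ck_continuous Cg _; exact: fU.
split=> [x U'x|]; first by have [] := H x v U'x.
apply: (@eq_Ck _ _ _ _ _ (fun x => \sum_(i < m) 'D_v f x 0 i * 'D_(e_ i) g (f x))) => //.
  by move=> x U'x; have [] := H x v U'x.
apply: Ck_sum => // i; apply: Ck_mul => //.
  have Cfv : Ck k U' ('D_v f) := Ck_derive v Cf.
  by have [/(_ Cfv i) + _] := Ck_coord k ('D_v f) oU'.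
exact: (ih ('D_(e_ i) g) (Ck_pred Cf) (Ck_derive (e_ i) Cg)).
Qed.

End Chain.

Lemma near_open (T : topologicalType) (x : T) (P : T -> Prop) :
  (\forall y \near x, P y) -> exists B : set T, [/\ open B, B x & B `<=` P].
Proof.
move=> xP; exists (interior P); split=> //; first exact: open_interior.
exact: interior_subset.
Qed.

Lemma continuous_slice (X Y Z : topologicalType) (f : X * Y -> Z) x y :
  {for (x, y), continuous f} -> {for y, continuous (fun t => f (x, t))}.
Proof.
move=> cf.
have c : (fun t => (x, t)) @ y --> (x, y) by exact: (cvg_pair (cvg_cst _) cvg_id).
by move=> A nA; exact: (c _ (cf _ nA)).
Qed.

(** * Smoothness at a point *)

Section SmoothAt.
Variable R : realType.

(** The neighborhood is chosen before the order [k], as in [smooth_on]. *)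
Definition smooth_at (V W : normedModType R) (f : V -> W) (x : V) : Prop :=
  exists U : set V, [/\ open U, U x & forall k, Ck k U f].

Section General.
Variables V W : normedModType R.
Implicit Types (f g : V -> W) (x : V).

Lemma smooth_at_near f g x :
  (\forall y \near x, f y = g y) -> smooth_at f x -> smooth_at g x.
Proof.
move=> /near_open[B [oB Bx fg]] [U [oU Ux Cf]].
exists (B `&` U); split=> // [|k]; first exact: openI.
apply: (@eq_Ck _ _ _ _ _ f); [exact: openI|by move=> y [/fg]|].
by apply: Ck_subset (Cf k) => y [].
Qed.

Lemma smooth_at_nbhs f x : smooth_at f x -> \forall y \near x, smooth_at f y.
Proof.
move=> [U [oU Ux Cf]]; apply: filterS (open_nbhs_nbhs (conj oU Ux)) => y Uy.
by exists U.
Qed.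

Lemma smooth_at_continuous f x : smooth_at f x -> {for x, continuous f}.
Proof. by move=> [U [oU Ux /(_ 0%N) Cf]]; exact: Ck_continuous Cf Ux. Qed.

Lemma smooth_at_derivable f x v : smooth_at f x -> derivable f x v.
Proof. by move=> [U [oU Ux /(_ 1%N) Cf]]; exact: Ck_derivable Cf Ux. Qed.

Lemma smooth_at_derive f x v : smooth_at f x -> smooth_at ('D_v f) x.
Proof. by move=> [U [oU Ux Cf]]; exists U; split=> // k; exact: Ck_derive. Qed.

Lemma smooth_at_cst (a : W) x : smooth_at (cst a) x.
Proof. by exists setT; split=> // [|k]; [exact: openT|exact: Ck_cst]. Qed.

Lemma smooth_at_affine f (L : V -> W) x :
  continuous f -> (forall x v h, f (h *: v + x) = h *: L v + f x) ->
  smooth_at f x.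
Proof.
by move=> cf fL; exists setT; split=> // [|k]; [exact: openT|exact: Ck_affine].
Qed.

Lemma smooth_at_affine_comp (V' : normedModType R) f (i : V' -> V) (L : V' -> V) y :
  continuous i -> (forall z v h, i (h *: v + z) = h *: L v + i z) ->
  smooth_at f (i y) -> smooth_at (f \o i) y.
Proof.
move=> ci iL [U [oU Ux Cf]]; exists (i @^-1` U); split=> // [|k].
  by apply: open_comp => // z _; exact: ci.
exact: Ck_affine_comp ci iL (Cf k).
Qed.

Lemma Ck_local k (U : set V) f :
  (forall x, U x -> exists U' : set V, U' x /\ Ck k U' f) -> Ck k U f.
Proof.
elim: k f => [|k ih] f H.
  split=> // x /H [U' [U'x Cf]]; exact: Ck_continuous Cf U'x.
split=> [x /H [U' [U'x Cf]]|v]; first exact: Ck_continuous Cf U'x.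
split=> [x /H [U' [U'x Cf]]|]; first exact: Ck_derivable Cf U'x.
by apply: ih => x /H [U' [U'x Cf]]; exists U'; split=> //; exact: Ck_derive.
Qed.

Lemma smooth_at_Ck k (U : set V) f : (forall x, U x -> smooth_at f x) -> Ck k U f.
Proof. by move=> H; apply: Ck_local => x /H[U' [_ U'x Cf]]; exists U'. Qed.

Lemma smooth_on_at (A : set V) f x : smooth_on A f -> nbhs x A -> smooth_at f x.
Proof.
move=> sf nA; have [U [F [oU Ux CF FE]]] := sf x (nbhs_singleton nA).
apply: (@smooth_at_near F); last by exists U.
by apply: filterS2 nA (open_nbhs_nbhs (conj oU Ux)) => y Ay Uy; exact: FE.
Qed.

Lemma at_smooth_on (A : set V) f : (forall x, A x -> smooth_at f x) -> smooth_on A f.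
Proof. by move=> H x /H[U [oU Ux Cf]]; exists U, f. Qed.

Lemma smooth_at_add f g x : smooth_at f x -> smooth_at g x ->
  smooth_at (fun y => f y + g y) x.
Proof.
move=> [U [oU Ux Cf]] [U' [oU' Ux' Cg]]; exists (U `&` U'); split=> // [|k].
  exact: openI.
by apply: Ck_add; [exact: openI|apply: Ck_subset (Cf k) => y []|
  apply: Ck_subset (Cg k) => y []].
Qed.

Lemma smooth_at_sum m (f : 'I_m -> V -> W) x :
  (forall i, smooth_at (f i) x) -> smooth_at (fun y => \sum_(i < m) f i y) x.
Proof.
elim: m f => [|m ih] f fs.
  apply: smooth_at_near (smooth_at_cst 0 x); apply: nearW => y.
  by rewrite big_ord0.
apply: (@smooth_at_near (fun y => (\sum_(i < m) f (widen_ord (leqnSn m) i) y) +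
   f ord_max y)); last by apply: smooth_at_add => //; exact: ih.
by apply: nearW => y; rewrite big_ord_recr.
Qed.

End General.

Section Real.
Variable V : normedModType R.
Implicit Types (f g : V -> R) (x : V).

Lemma smooth_at_mul f g x : smooth_at f x -> smooth_at g x ->
  smooth_at (fun y => f y * g y) x.
Proof.
move=> [U [oU Ux Cf]] [U' [oU' Ux' Cg]]; exists (U `&` U'); split=> // [|k].
  exact: openI.
by apply: Ck_mul; [exact: openI|apply: Ck_subset (Cf k) => y []|
  apply: Ck_subset (Cg k) => y []].
Qed.

Lemma smooth_at_opp f x : smooth_at f x -> smooth_at (fun y => - f y) x.
Proof.
by move=> [U [oU Ux Cf]]; exists U; split=> // k; exact: Ck_opp.
Qed.

Lemma smooth_at_coord m (f : V -> 'rV[R]_m) x :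
  smooth_at f x <-> forall i, smooth_at (fun y => f y 0 i) x.
Proof.
split=> [[U [oU Ux Cf]] i|H].
  exists U; split=> // k; have [+ _] := Ck_coord k f oU; exact.
have : \forall y \near x, forall i, smooth_at (fun y => f y 0 i) y.
  by apply: filter_forall => i; exact: smooth_at_nbhs.
move=> /near_open[B [oB Bx BU]].
exists B; split=> // k; apply/Ck_coord => // i.
by apply: smooth_at_Ck => y /BU.
Qed.

Lemma smooth_at_comp m (f : V -> 'rV[R]_m) (g : 'rV[R]_m -> R) x :
  smooth_at f x -> smooth_at g (f x) -> smooth_at (g \o f) x.
Proof.
move=> sf [U' [oU' Ux' Cg]]; have [U [oU Ux Cf]] := sf.
have : \forall y \near x, U y /\ U' (f y).
  near=> y; split; near: y; first exact: open_nbhs_nbhs.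
  by apply: (smooth_at_continuous sf); exact: open_nbhs_nbhs.
move=> /near_open[B [oB Bx BU]].
exists B; split=> // k; apply: (Ck_comp oU') => // [y /BU[]//|].
by apply: Ck_subset (Cf k) => y /BU[].
Unshelve. all: by end_near. Qed.

End Real.

Lemma smooth_at_comp_rV (V : normedModType R) m p (f : V -> 'rV[R]_m) (g : 'rV[R]_m -> 'rV[R]_p) x :
  smooth_at f x -> smooth_at g (f x) -> smooth_at (g \o f) x.
Proof.
move=> sf /smooth_at_coord sg; apply/smooth_at_coord => i.
exact: (smooth_at_comp sf (sg i)).
Qed.

Lemma smooth_at_coordinate m (i : 'I_m) (x : 'rV[R]_m) :
  smooth_at (fun u : 'rV[R]_m => u 0 i) x.
Proof.
apply: (@smooth_at_affine _ _ _ (fun v : 'rV[R]_m => v 0 i)).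
  exact: coord_continuous.
by move=> u v h; rewrite !mxE.
Qed.

(** The chain rule above concerns inner maps with values in row vectors; a real function is one with
    values in rows of length 1. *)
Lemma smooth_at_compR (V : normedModType R) (f : V -> R) (g : R -> R) x :
  smooth_at f x -> smooth_at g (f x) -> smooth_at (g \o f) x.
Proof.
move=> sf sg.
pose i (u : 'rV[R]_1) := u 0 0.
pose F y : 'rV[R]_1 := \row_(_ < 1) f y.
rewrite (_ : g \o f = (g \o i) \o F); last by apply/funext => y; rewrite /i /F/= mxE.
apply: smooth_at_comp.
  by apply/smooth_at_coord => j; apply: smooth_at_near sf; apply: nearW => y; rewrite mxE.
apply: (@smooth_at_affine_comp _ _ _ g i i); first exact: coord_continuous.
  by move=> u v h; rewrite /i !mxE.
by rewrite /i /F mxE.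
Qed.

End SmoothAt.

(** * A flat function and integrals along orbits *)

Section Flat.
Variable R : realType.

(* All derivatives of [exp (-1/s)] are combinations of the functions
   [s^-n exp (-1/s)], extended by [0] to [s <= 0]. *)
Definition flat (n : nat) (s : R) : R :=
  if 0 < s then s^-1 ^+ n * expR (- s^-1) else 0.

Lemma flat_ge0 n s : 0 <= flat n s.
Proof.
rewrite /flat; case: ifP => // s0.
by rewrite mulr_ge0 ?expR_ge0// exprn_ge0// invr_ge0 ltW.
Qed.

Lemma flat_gt0 n s : (0 < flat n s) = (0 < s).
Proof.
rewrite /flat; case: ifP => s0; last by rewrite ltxx.
by rewrite mulr_gt0 ?expR_gt0// exprn_gt0// invr_gt0.
Qed.

(** The exponential dominates the term of degree n+1 of its series, taken at [s^-1]. A bound linear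
    in [s] is what the difference quotients at 0 call for. *)
Lemma flat_le n s : `|flat n s| <= (n.+1)`!%:R * `|s|.
Proof.
rewrite ger0_norm ?flat_ge0// /flat; case: ifP => s0; last first.
  by rewrite mulr_ge0.
have s'0 : 0 < s^-1 by rewrite invr_gt0.
rewrite gtr0_norm// expRN ler_pdivrMr ?expR_gt0//.
have := @expR_ge1Dxn R s^-1 n (ltW s'0) => /(le_trans _) H.
have : s^-1 ^+ n.+1 / (n.+1)`!%:R <= expR s^-1 by apply: H; rewrite lerDr.
rewrite ler_pdivrMr ?ltr0n ?fact_gt0// => H2.
rewrite -(@ler_pM2l _ s^-1)// -exprS; apply: le_trans H2 _.
set E := expR _; suff -> : s^-1 * ((n.+1)`!%:R * s * E) = E * (n.+1)`!%:R by [].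
have sn0 : s != 0 by rewrite gt_eqF.
by rewrite mulrC mulrAC mulfK// mulrC.
Qed.

Lemma flatS n s : s * flat n.+1 s = flat n s.
Proof.
rewrite /flat; case: ifP => s0; last by rewrite mulr0.
by rewrite exprS !mulrA divff ?mul1r// gt_eqF.
Qed.

Lemma is_derive_flat (n : nat) (s : R) :
  is_derive s 1 (flat n) (flat n.+2 s - n%:R * flat n.+1 s).
Proof.
have [s0|s0|->] := ltgtP s 0.
- rewrite /flat !ltNge ltW//= mulr0 subr0.
  apply: (@near_eq_is_derive R R R (cst (0 : R))).
  near=> t; rewrite ifF//; apply/negbTE; rewrite -leNgt ltW//.
  by near: t; exact: lt_nbhsl.
- have d1 : is_derive s 1 (fun t : R => t^-1) (- s ^- 2).
    have d0 := @is_deriveV R id s 1 1 (lt0r_neq0 s0) (is_derive_id s 1).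
    by apply: (is_derive_eq d0); rewrite [_ *: 1]mulr1.
  have d2 : is_derive s 1 (fun t : R => - t^-1) (s ^- 2).
    by apply: (is_derive_eq (is_deriveN d1)); rewrite opprK.
  have d3 := @is_derive1_comp R expR (fun t : R => - t^-1) s _ _ (is_derive_expR _) d2.
  have H := is_deriveM (is_deriveX n d1) d3.
  apply: (@near_eq_is_derive R R R ((fun t : R => t^-1) ^+ n * (expR \o (fun t : R => - t^-1)))).
    near=> t; rewrite /flat ifT//; last by near: t; exact: lt_nbhsr.
    by rewrite [LHS]/GRing.mul/= exprfctE.
  apply: (is_derive_eq H); rewrite /flat s0 exprfctE /GRing.scale/=.
  case: n H => [|n] _ /=; first by rewrite !mul0r !expr0 !mul1r mulr0 addr0 subr0 expr2 mulrC invfM.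
  by rewrite !exprS invfM !expr0 !mulr1; ring.
- rewrite /flat ltxx mulr0 subr0 -/(flat n).
  suff cv : (fun h : R => h^-1 *: ((flat n \o shift 0) (h *: 1) - flat n 0)) @ 0^'
      --> (0 : R).
    by apply: DeriveDef; [apply/cvg_ex; exists 0|exact: cvg_lim cv].
  have f0 : 0 < (n.+2)`!%:R :> R by rewrite ltr0n fact_gt0.
  (* By [flatS] the difference quotient at 0 is [flat n.+1], and [flat_le] for [n.+1] dictates the
     radius. *)
  apply/cvgrPdist_le => e e0; exists (e / (n.+2)`!%:R); first by rewrite /= divr_gt0.
  move=> h /=; rewrite !sub0r !normrN addr0 [h *: 1]mulr1 => he h0.
  rewrite -[flat n 0]flatS mul0r subr0 -flatS scalerA mulVf// scale1r.
  by rewrite (le_trans (flat_le _ _))// -ler_pdivlMl// mulrC ltW.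
Unshelve. all: by end_near. Qed.

Lemma Ck_flat k n : Ck k setT (flat n).
Proof.
have df (m : nat) (s : R) : is_derive s 1 (flat m) (flat m.+2 s - m%:R * flat m.+1 s).
  exact: is_derive_flat.
elim: k n => [|k ih] n; split=> //.
- move=> s _; have [ds _] := df n s.
  exact/differentiable_continuous/derivable1_diffP.
- move=> s _; have [ds _] := df n s.
  exact/differentiable_continuous/derivable1_diffP.
move=> v.
have dv (s : R) : derivable (flat n) s v /\
    'D_v (flat n) s = v * (flat n.+2 s - n%:R * flat n.+1 s).
  have [ds <-] := df n s.
  have [] := @derivable_scale _ _ (flat n) s 1 v ds.
  by rewrite [v *: 1]mulr1.
split=> [s _|]; first by have [] := dv s.
have oT := @openT R.
apply: (eq_Ck oT) (Ck_mul oT (Ck_cst k setT v)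
   (Ck_add oT (ih n.+2) (Ck_opp oT (Ck_mul oT (Ck_cst k setT (n%:R : R)) (ih n.+1))))).
by move=> s _; have [_ ->] := dv s.
Qed.

Lemma smooth_at_flat n s : smooth_at (flat n) s.
Proof. by exists setT; split=> // [|k]; [exact: openT|exact: Ck_flat]. Qed.

End Flat.

(** * Integrals depending on a parameter *)

Section ExpIntegral.
Variable R : realType.
Notation mu := (@lebesgue_measure R).

(* The increasing weight makes the integral of [h] along an orbit segment strictly
   decrease along the flow even where [h] vanishes at both ends of the segment. *)
Definition exp_int (T : R) (f : R -> R) : R :=
  \int[mu]_(t in `[0, T]) (expR t * f t).

Let segment_integrable (a b : R) (f : R -> R) : continuous f ->
  mu.-integrable `[a, b] (EFin \o f).
Proof.
move=> cf; apply: continuous_compact_integrable; first exact: segment_compact.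
exact: continuous_subspaceT.
Qed.

Let cexp (f : R -> R) : continuous f -> continuous (fun t => expR t * f t).
Proof. by move=> cf t; apply: cvgM; [exact: continuous_expR|exact: cf]. Qed.

Lemma exp_intB (T : R) (f g : R -> R) : continuous f -> continuous g ->
  exp_int T (fun t => f t - g t) = exp_int T f - exp_int T g.
Proof.
move=> cf cg; rewrite /exp_int -RintegralB//=; [|exact/segment_integrable/cexp..].
by apply: eq_Rintegral => t _; rewrite mulrBr.
Qed.

Lemma exp_intD (T : R) (f g : R -> R) : continuous f -> continuous g ->
  exp_int T (fun t => f t + g t) = exp_int T f + exp_int T g.
Proof.
move=> cf cg; rewrite /exp_int -RintegralD//=; [|exact/segment_integrable/cexp..].
by apply: eq_Rintegral => t _; rewrite mulrDr.
Qed.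

Lemma exp_intZ (T : R) (f : R -> R) (c : R) : continuous f ->
  exp_int T (fun t => c * f t) = c * exp_int T f.
Proof.
move=> cf; rewrite /exp_int -RintegralZl//=; last exact/segment_integrable/cexp.
by apply: eq_Rintegral => t _; rewrite mulrCA.
Qed.

Lemma exp_int_ge0 (T : R) (f : R -> R) : (forall t, 0 <= f t) -> 0 <= exp_int T f.
Proof. by move=> f0; apply: Rintegral_ge0 => t _; rewrite mulr_ge0 ?expR_ge0. Qed.

Lemma exp_int_norm_le (T : R) (f : R -> R) (C : R) : 0 <= T -> continuous f ->
  (forall t, 0 <= t <= T -> `|f t| <= C) -> `|exp_int T f| <= C * (expR T * T).
Proof.
move=> T0 cf fC.
have c1 := cexp cf.
apply: le_trans (le_normr_Rintegral _ _) _ => //; first exact: segment_integrable.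
have -> : C * (expR T * T) = \int[mu]_(t in `[0, T]) (expR T * C).
  rewrite Rintegral_cst//= lebesgue_measure_itv/= lte_fin.
  case: ltP => [T0'|T0']; first by rewrite -EFinD /= subr0; ring.
  have -> : T = 0 by apply/eqP; rewrite eq_le T0 T0'.
  by rewrite /= !mulr0.
apply: le_Rintegral => //.
- by apply: segment_integrable => t; exact: (cvg_norm (c1 t)).
- by apply: segment_integrable => t; exact: cvg_cst.
move=> t /=; rewrite in_itv/= => t0T; rewrite normrM ger0_norm ?expR_ge0//.
apply: ler_pM; rewrite ?expR_ge0//; last exact: fC.
by rewrite ler_expR; case/andP: t0T.
Qed.

Lemma exp_int_gt0 (T : R) (f : R -> R) : 0 < T -> continuous f -> (forall t, 0 <= f t) ->
  0 < f 0 -> 0 < exp_int T f.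
Proof.
move=> T0 cf fge0 f0; have c1 := cexp cf.
have [s [s0 sT sf]] : exists s, [/\ 0 < s, s <= T &
    forall t, 0 <= t <= s -> f 0 / 2 <= expR t * f t].
  have : \forall t \near 0, f 0 / 2 < expR t * f t.
    apply: (cvgr_gt _ (c1 0)); rewrite expR0 mul1r.
    by rewrite ltr_pdivrMr// mulr_natr mulr2n ltrDr.
  move=> [r /= r0 rP]; exists (Num.min (r / 2) T); split.
  - by rewrite lt_min T0 divr_gt0.
  - by rewrite ge_min lexx orbT.
  move=> t /andP[t0 ts]; apply/ltW/rP; rewrite /ball_/= sub0r normrN ger0_norm//.
  apply: le_lt_trans ts _; rewrite gt_min; apply/orP; left.
  by rewrite ltr_pdivrMr// mulr_natr mulr2n ltrDr.
have H := @Rintegral_itvB R (fun t => expR t * f t) (BLeft 0) (BRight T) s.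
have -> : exp_int T f = \int[mu]_(t in `[0, s]) (expR t * f t) +
    \int[mu]_(t in `]s, T]) (expR t * f t).
  rewrite -H ?bnd_simp//= ?ltW//; last exact: segment_integrable.
  by rewrite addrC subrK.
apply: ltr_wpDr; first by apply: Rintegral_ge0 => t _; rewrite mulr_ge0 ?expR_ge0.
apply: (@lt_le_trans _ _ (\int[mu]_(t in `[0, s]) (f 0 / 2))).
  rewrite Rintegral_cst//= lebesgue_measure_itv/= lte_fin s0 -EFinD /= subr0.
  by rewrite mulr_gt0// divr_gt0.
apply: le_Rintegral => //; first by apply: segment_integrable => t; exact: cvg_cst.
exact: segment_integrable.
Qed.

Section Param.
Variables (V : normedModType R) (T : R).
Hypothesis T0 : 0 <= T.
Implicit Types (F : V * R -> R) (U : set V).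

Let slice_continuous F (u : V) : (forall t, {for (u, t), continuous F}) ->
  continuous (fun t => F (u, t)).
Proof.
by move=> cF t; exact: continuous_slice.
Qed.

(** Compactness of the time segment makes continuity in [u] uniform in [t]; this is the only
    uniformity used to pass to the limit under the integral. *)
Lemma near_uniform_segment F (u0 : V) (e : R) : 0 < e ->
  (forall t, {for (u0, t), continuous F}) ->
  \forall u \near u0, forall t, 0 <= t <= T -> `|F (u, t) - F (u0, t)| <= e.
Proof.
move=> e0 cF.
have e2 : 0 < e / 2 by rewrite divr_gt0.
have /compact_near_coveringP/(_ V (nbhs u0)
  (fun u t => `|F (u, t) - F (u0, t)| <= e) _) : compact `[0, T]%classic.
  exact: segment_compact.
move=> H; apply: filterS (H _) => [u uP t t0T|t _].
  by apply: uP; rewrite /= in_itv.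
have /cvgrPdist_le/(_ _ e2) n1 := cF (t : R).
have cs := slice_continuous cF; have /cvgrPdist_le/(_ _ e2) n2 := cs (t : R).
have [[/= A1 A2] [nA1 nA2] A] := n1.
exists (A2 `&` [set t' | `|F (u0, t) - F (u0, t')| <= e / 2], A1).
  by split=> //=; exact: filterI.
move=> [t' u] /= [[A2t' t't] A1u].
have := A (u, t') (conj A1u A2t') => /= H1.
rewrite (_ : F (u, t') - F (u0, t') = (F (u0, t) - F (u0, t')) - (F (u0, t) - F (u, t'))); last by ring.
by rewrite (splitr e) (le_trans (ler_normB _ _))// lerD.
Qed.

(** Adding 1 keeps the denominator positive when [b] is 0, as it is for [T = 0]. *)
Let eps_le (e b : R) : 0 < e -> 0 <= b -> e / (b + 1) * b <= e.
Proof.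
move=> e0 b0; rewrite mulrAC ler_pdivrMr ?ltr_wpDl//.
by rewrite ler_pM2l// lerDl.
Qed.

Lemma continuous_exp_int F u0 :
  (\forall u \near u0, forall t, {for (u, t), continuous F}) ->
  {for u0, continuous (fun u => exp_int T (fun t => F (u, t)))}.
Proof.
move=> cF; have cF0 := nbhs_singleton cF.
apply/cvgrPdist_le => e e0.
have d0 : 0 < e / (expR T * T + 1).
  by rewrite divr_gt0// ltr_wpDl// mulr_ge0// expR_ge0.
near=> u.
have cu : continuous (fun t => F (u, t)).
  by apply: slice_continuous; near: u; exact: cF.
rewrite -exp_intB//; last exact: slice_continuous.
apply: (@le_trans _ _ (e / (expR T * T + 1) * (expR T * T))).
  apply: exp_int_norm_le => //.
    by move=> t; apply: cvgB; [exact: slice_continuous|exact: cu].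
  move=> t t0T; rewrite distrC; move: t t0T; near: u.
  exact: near_uniform_segment.
by apply: eps_le => //; rewrite mulr_ge0 ?expR_ge0.
Unshelve. all: by end_near. Qed.

(** For each fixed [t] the mean value theorem turns the difference quotient into a value of the
    partial derivative at a nearby point, and [near_uniform_segment] bounds the error uniformly in
    [t]. *)
Lemma is_derive_exp_int F (U : set V) (u0 v : V) :
  open U -> U u0 -> Ck 1 [set z | U z.1] F ->
  is_derive u0 v (fun u => exp_int T (fun t => F (u, t)))
    (exp_int T (fun t => 'D_((v, 0) : V * R) F (u0, t))).
Proof.
move=> oU Uu0 CF; pose w : V * R := (v, 0); pose DF := 'D_w F.
have cF u t : U u -> {for (u, t), continuous F}.
  by move=> Uu; apply: (Ck_continuous CF).
have cDF u t : U u -> {for (u, t), continuous DF}.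
  by move=> Uu; apply: (Ck_continuous (Ck_derive w CF)).
set G := fun u => _; set L := exp_int _ _.
suff cv : (fun h : R => h^-1 *: ((G \o shift u0) (h *: v) - G u0)) @ 0^' --> L.
  by apply: DeriveDef; [apply/cvg_ex; exists L|exact: cvg_lim cv].
apply/cvgrPdist_le => e e0.
set d := e / (expR T * T + 1).
have d0 : 0 < d by rewrite divr_gt0// ltr_wpDl// mulr_ge0// expR_ge0.
have : \forall u \near u0, U u /\
    forall t, 0 <= t <= T -> `|DF (u, t) - DF (u0, t)| <= d.
  near=> u; split; near: u; first exact: open_nbhs_nbhs.
  by apply: near_uniform_segment => // t; exact: cDF.
move=> /nbhs_ballP[r /= r0 rP].
have : \forall h \near (0 : R)^', `|h| * `|v| < r.
  exists (r / (`|v| + 1)); first by rewrite /= divr_gt0// ltr_wpDl.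
  move=> h /=; rewrite sub0r normrN ltr_pdivlMr ?ltr_wpDl// => hr _.
  by apply: le_lt_trans hr; rewrite ler_wpM2l// lerDl.
apply: filter_app; near=> h => hr.
have h0 : h != 0 by near: h; exact: nbhs_dnbhs_neq.
have inr (s : R) : 0 <= s <= 1 -> ball u0 r (s *: (h *: v) + u0).
  move=> /andP[s0 s1]; rewrite -ball_normE /ball_/= opprD addrC -addrA addNr addr0.
  rewrite normrN !normrZ (ger0_norm s0); apply: le_lt_trans hr.
  by rewrite ler_piMl// mulr_ge0.
have Uh : U (h *: v + u0).
  by have := inr 1; rewrite ler01 lexx scale1r => /(_ isT)/rP[].
have c1 : continuous (fun t => F (h *: v + u0, t)).
  by apply: slice_continuous => t; exact: cF.
have c2 : continuous (fun t => F (u0, t)) by apply: slice_continuous => t; exact: cF.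
have c3 : continuous (fun t => DF (u0, t)) by apply: slice_continuous => t; exact: cDF.
have c12 : continuous (fun t => F (h *: v + u0, t) - F (u0, t)).
  by move=> t; apply: cvgB; [exact: c1|exact: c2].
have c4 : continuous (fun t => h^-1 * (F (h *: v + u0, t) - F (u0, t))).
  by move=> t; apply: cvgM; [exact: cvg_cst|exact: c12].
rewrite /G /= -exp_intB// [_ *: _]/GRing.scale/= -exp_intZ// -exp_intB//.
apply: (@le_trans _ _ (d * (expR T * T))); last first.
  by apply: eps_le => //; rewrite mulr_ge0 ?expR_ge0.
apply: exp_int_norm_le => // [t|t t0T].
  by apply: cvgB; [exact: c3|exact: c4].
have wE (a : R) : a *: w + (u0, t) = (a *: v + u0, t).
  by apply/pair_equal_spec; split=> //=; rewrite scaler0 add0r.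
have dF (s : R) : 0 <= s <= 1 -> derivable F (s *: (h *: w) + (u0, t)) w.
  move=> s01; apply: (Ck_derivable CF); rewrite scalerA wE/= -scalerA.
  by have [] := rP _ (inr _ s01).
have dFh (s : R) s01 := derivable_scale h (dF s s01).
have [s s01|s s01] := @MVT_line _ _ F (u0, t) (h *: w); first by have [] := dFh s s01.
rewrite wE => ->; have [_ ->] := dFh s s01.
rewrite mulrA mulVf// mul1r distrC scalerA wE -scalerA.
by have [_] := rP _ (inr _ s01); exact.
Unshelve. all: by end_near. Qed.

Lemma Ck_exp_int k F (U : set V) : open U -> Ck k [set z | U z.1] F ->
  Ck k U (fun u => exp_int T (fun t => F (u, t))).
Proof.
move=> oU; elim: k F => [|k ih] F CF.
  split=> // u Uu; apply: continuous_exp_int.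
  apply: filterS (open_nbhs_nbhs (conj oU Uu)) => u' Uu' t.
  exact: (Ck_continuous CF).
split=> [u Uu|v].
  apply: continuous_exp_int.
  apply: filterS (open_nbhs_nbhs (conj oU Uu)) => u' Uu' t.
  exact: (Ck_continuous CF).
have C1 : Ck 1 [set z : V * R | U z.1] F.
  split=> [x Ux|w]; first exact: (Ck_continuous CF).
  split=> [x Ux|]; first exact: (Ck_derivable CF).
  by split=> // x Ux; exact: (Ck_continuous (Ck_derive w CF)).
have H u (Uu : U u) := is_derive_exp_int v oU Uu C1.
split=> [u Uu|]; first by have [] := H u Uu.
apply: eq_Ck (ih _ (Ck_derive ((v, 0) : V * R) CF)) => // u Uu.
by have [_ ->] := H u Uu.
Qed.

End Param.

(* The total derivative of [exp s * f (t + s)] in [s] integrates to its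
   boundary terms. *)
Lemma is_derive_exp_int_shift (T : R) (f : R -> R) (t : R) : 0 < T ->
  Ck 2 setT f ->
  is_derive t 1 (fun t => exp_int T (fun s => f (t + s)))
    (expR T * f (t + T) - f t - exp_int T (fun s => f (t + s))).
Proof.
move=> T0 Cf.
have Cadd : continuous (fun z : R * R => z.1 + z.2).
  by move=> z; apply: cvgD; [exact: cvg_fst|exact: cvg_snd].
have CF : Ck 1 [set z : R * R | setT z.1] (fun z : R * R => f (z.1 + z.2)).
  have := @Ck_affine_comp _ _ _ _ 1 setT f (fun z : R * R => z.1 + z.2)
    (fun z : R * R => z.1 + z.2) Cadd _ (Ck_pred Cf).
  apply=> x v h /=; rewrite /GRing.scale/=; ring.
have D := is_derive_exp_int (ltW T0) (1 : R) openT (I : setT t) CF.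
apply: (is_derive_eq D).
have shiftE s : (fun h : R => h^-1 *: (((fun s => f (t + s)) \o shift s) (h *: 1)
    - f (t + s))) = (fun h => h^-1 *: ((f \o shift (t + s)) (h *: 1) - f (t + s))).
  by apply/funext => h /=; rewrite addrCA.
have ds (s : R) : is_derive s 1 (fun s => f (t + s)) ('D_1 f (t + s)).
  apply: DeriveDef; last by rewrite /derive shiftE.
  by rewrite /derivable shiftE; exact: (Ck_derivable Cf).
have -> : (fun s => 'D_((1, 0) : R * R) (fun z : R * R => f (z.1 + z.2)) (t, s)) =
    (fun s => 'D_1 f (t + s)).
  apply/funext => s; rewrite /derive; set a := fun h => _; set b := fun h => _.
  suff -> : a = b by [].
  apply/funext => h; rewrite /a /b /= ; congr (_ *: (f _ - _)).
  by rewrite /GRing.scale/= mulr0 add0r addrA.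
have cs (g : R -> R) : continuous g -> continuous (fun s => g (t + s)).
  move=> cg s; apply: (@continuous_comp _ _ _ (fun s => t + s) g); last exact: cg.
  by apply: cvgD; [exact: cvg_cst|exact: cvg_id].
have c1 : continuous (fun s => f (t + s)).
  by apply: cs => s; exact: (Ck_continuous Cf).
have c2 : continuous (fun s => 'D_1 f (t + s)).
  by apply: (cs ('D_1 f)) => s; exact: (Ck_continuous (Ck_derive (1 : R) Cf)).
apply/eqP; rewrite eq_sym subr_eq -exp_intD//.
rewrite /exp_int /Rintegral.
pose P s := expR s * f (t + s).
have dP (s : R) : is_derive s 1 P (expR s * ('D_1 f (t + s) + f (t + s))).
  have H := is_deriveM (is_derive_expR s) (ds s).
  by apply: (is_derive_eq H); rewrite /GRing.scale/= mulrDr [f _ * _]mulrC.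
have cP : continuous P.
  move=> s; have [dPs _] := dP s.
  exact/differentiable_continuous/derivable1_diffP.
rewrite (@continuous_FTC2 _ _ P)//=.
- by rewrite /P expR0 mul1r addr0.
- apply: continuous_subspaceT => s; apply: cvgM; first exact: continuous_expR.
  by apply: cvgD; [exact: c2|exact: c1].
- split=> [s _||]; first by have [] := dP s.
    by apply: cvg_at_right_filter; exact: cP.
  by apply: cvg_at_left_filter; exact: cP.
- by move=> s _; rewrite derive1E; have [_] := dP s.
Qed.

End ExpIntegral.

(** * Straightening a regular function *)

Section Straighten.
Variables (R : realType) (n : nat) (g : 'rV[R]_n -> R) (a : 'rV[R]_n).
Variables (i j : 'I_n).
Hypothesis g_smooth : smooth_at g a.
Local Notation e_ := (delta_mx 0).
Hypothesis dg_neq0 : 'D_(e_ i) g a != 0.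

(* The i-th coordinate is replaced by g, and the coordinates i and j are exchanged:
   half-spaces constrain the first coordinate, hypersurfaces the last one. *)
Definition straighten (u : 'rV[R]_n) : 'rV[R]_n :=
  \row_k (if k == j then g u else u 0 (tperm i j k)).

(** A candidate preimage of [w]: every coordinate but the [i]-th is read off [w], and finding the
    missing [s] is a one-dimensional problem. *)
Let assemble (w : 'rV[R]_n) (s : R) : 'rV[R]_n :=
  \row_l (if l == i then s else w 0 (tperm i j l)).

Let straighten_assemble w s : g (assemble w s) = w 0 j ->
  straighten (assemble w s) = w.
Proof.
move=> gw; apply/rowP => l; rewrite !mxE; case: eqVneq => [->//|li].
by rewrite (canF_eq (tpermK i j)) tpermL (negbTE li) tpermK.
Qed.

(** Multiplying by this number, instead of by its sign, treats increasing and decreasing [g] at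
    once. *)
Let sg : R := 'D_(e_ i) g a.

(** An inverse function theorem in which a single coordinate is unknown: monotonicity of [g] along
    the [i]-th axis gives injectivity, and the intermediate value theorem gives an open image and a
    continuous inverse. *)
Lemma straighten_local : exists (B : set 'rV[R]_n) (eta : 'rV[R]_n -> 'rV[R]_n),
  [/\ open B, B a, forall u, B u -> smooth_at g u &
   [/\ forall u, B u -> eta (straighten u) = u,
       open (straighten @` B)
     & forall w, (straighten @` B) w -> smooth_at eta w]].
Proof.
have [r /= r0 rP] : exists2 r : R, 0 < r & ball a r `<=`
    [set u | smooth_at g u /\ 0 < sg * 'D_(e_ i) g u].
  have n1 : \forall u \near a, smooth_at g u by exact: smooth_at_nbhs.
  have n2 : \forall u \near a, 0 < sg * 'D_(e_ i) g u.
    have cD : {for a, continuous (fun u => sg * 'D_(e_ i) g u)}.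
      apply: smooth_at_continuous; apply: smooth_at_mul; first exact: smooth_at_cst.
      exact: smooth_at_derive.
    apply: (cvgr_gt _ cD); rewrite /sg -expr2 lt_def sqr_ge0 andbT.
    by rewrite expf_neq0.
  have n12 : nbhs a [set u | smooth_at g u /\ 0 < sg * 'D_(e_ i) g u].
    by apply: filterS2 n1 n2 => u.
  by move/nbhs_ballP: n12 => [r r0 rP]; exists r.
set B := ball a r.
have oB : open B by exact: ball_open.
have Ba : B a by exact: ballxx.
have CB k : Ck k B g by apply: smooth_at_Ck => u /rP[].
have B_i (u : 'rV[R]_n) : B u -> 'D_(e_ i) g u != 0.
  by move=> /rP[_]; apply: contraTneq => ->; rewrite mulr0 ltxx.
have mono (u u' : 'rV[R]_n) : B u -> B u' -> (forall l, l != i -> u' 0 l = u 0 l) ->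
    u 0 i < u' 0 i -> 0 < sg * (g u' - g u).
  move=> Bu Bu' uu' ui; pose c := u' 0 i - u 0 i.
  have c0 : 0 < c by rewrite subr_gt0.
  have u'E : u' = c *: e_ i + u.
    apply/rowP => l; rewrite !mxE/=; have [->|li] := eqVneq l i.
      by rewrite mulr1 subrK.
    by rewrite mulr0 add0r uu'.
  have Bs (s : R) : 0 <= s <= 1 -> B (s *: (c *: e_ i) + u).
    move=> /andP[s0 s1]; apply/ball_rV => // l.
    move: Bu Bu' => /ball_rV-/(_ r0 l) + /ball_rV-/(_ r0 l).
    rewrite !mxE/=; have [->|li] := eqVneq l i; last by rewrite !mulr0 add0r.
    rewrite mulr1 !ltr_distl => /andP[A1 A2] /andP[A3 A4]; apply/andP; split.
      by rewrite (lt_le_trans A1)// lerDr mulr_ge0// ltW.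
    by rewrite (le_lt_trans _ A4)// -lerBrDr -/c ler_piMl// ltW.
  have ds (s : R) : 0 <= s <= 1 -> derivable g (s *: (c *: e_ i) + u) (e_ i).
    by move=> /Bs /(Ck_derivable (CB 1%N)); exact.
  have dsc (s : R) s01 := derivable_scale c (ds s s01).
  have [s s01|s s01] := @MVT_line _ _ g u (c *: e_ i); first by have [] := dsc s s01.
  rewrite -u'E => ->; have [_ ->] := dsc s s01.
  by rewrite mulrCA mulr_gt0//; have [] := rP _ (Bs _ s01).
have inj (u u' : 'rV[R]_n) : B u -> B u' -> straighten u = straighten u' -> u = u'.
  move=> Bu Bu' E.
  have off l : l != i -> u' 0 l = u 0 l.
    move=> li; have /rowP/(_ (tperm i j l)) := E; rewrite !mxE.
    by rewrite (canF_eq (tpermK i j)) tpermR (negbTE li) tpermK.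
  have gE : g u = g u' by have /rowP/(_ j) := E; rewrite !mxE eqxx.
  apply/rowP => l; have [->|li] := eqVneq l i; last by rewrite off.
  have [lt|lt|//] := ltgtP (u 0 i) (u' 0 i).
    by have := mono u u' Bu Bu' off lt; rewrite gE subrr mulr0 ltxx.
  have := mono u' u Bu' Bu (fun l li => esym (off l li)) lt.
  by rewrite gE subrr mulr0 ltxx.
(* At the two ends of a short segment through [u0] along the [i]-th axis, [g] lies strictly on
   different sides of [w0 0 j]. This persists for [w] near [w0], and the intermediate value theorem
   finds the missing coordinate. *)
have solve (u0 : 'rV[R]_n) (e : R) : 0 < e -> ball u0 e `<=` B ->
    \forall w \near straighten u0, (straighten @` ball u0 e) w.
  move=> e0 eB; set w0 := straighten u0.
  have Bu0 : B u0 by apply: eB; exact: ballxx.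
  pose sp := u0 0 i + e / 2; pose sm := u0 0 i - e / 2.
  have e2 : 0 < e / 2 by rewrite divr_gt0.
  have smsp : sm <= sp.
    by rewrite /sm /sp lerD2l (le_trans _ (ltW e2))// oppr_le0 ltW.
  have inball (w : 'rV[R]_n) (s : R) : (forall l, `|w 0 l - w0 0 l| < e) -> sm <= s <= sp ->
      ball u0 e (assemble w s).
    move=> we /andP[s1 s2]; apply/ball_rV => // l; rewrite mxE.
    case: eqVneq => [->|li].
      rewrite ltr_distl; apply/andP; split.
        by rewrite (lt_le_trans _ s1)// ltrD2l ltrN2 ltr_pdivrMr// ltr_pMr// ltr1n.
      by rewrite (le_lt_trans s2)// ltrD2l ltr_pdivrMr// ltr_pMr// ltr1n.
    have := we (tperm i j l).
    by rewrite [w0 _ _]mxE (canF_eq (tpermK i j)) tpermR (negbTE li) tpermK.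
  have cas (s : R) : {for w0, continuous (fun w => assemble w s)}.
    apply/continuous_coordP => l.
    rewrite (_ : (fun _ => _) = (fun w : 'rV[R]_n => if l == i then s else w 0 (tperm i j l))).
      by case: eqP => _; [exact: cst_continuous|exact: coord_continuous].
    by apply/funext => w; rewrite mxE.
  have cPhi (s : R) : sm <= s <= sp -> {for w0, continuous (fun w => sg * (g (assemble w s) - w 0 j))}.
    move=> sms.
    have c1 : (fun w => g (assemble w s)) @ w0 --> g (assemble w0 s).
      apply: (@continuous_comp _ _ _ (fun w => assemble w s) g); first exact: cas.
      apply: (Ck_continuous (CB 0%N)); apply: eB; apply: inball => // l.
      by rewrite subrr normr0.
    have c2 : (fun w : 'rV[R]_n => w 0 j) @ w0 --> w0 0 j by exact: coord_continuous.
    exact: (cvgM (cvg_cst sg) (cvgB c1 c2)).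
  have asp (s : R) l : l != i -> assemble w0 s 0 l = u0 0 l.
    move=> li; rewrite mxE (negbTE li) mxE (canF_eq (tpermK i j)) tpermR (negbTE li).
    by rewrite tpermK.
  have w0j : w0 0 j = g u0 by rewrite mxE eqxx.
  have Bas (s : R) : sm <= s <= sp -> B (assemble w0 s).
    by move=> ss; apply: eB; apply: inball => // l; rewrite subrr normr0.
  have p1 : 0 < sg * (g (assemble w0 sp) - w0 0 j).
    rewrite w0j; apply: mono => //; [by apply: Bas; rewrite smsp lexx|exact: asp|].
    by rewrite mxE eqxx /sp ltrDl.
  have p2 : sg * (g (assemble w0 sm) - w0 0 j) < 0.
    rewrite -oppr_gt0 -mulrN opprB w0j; apply: mono => //.
    - by apply: Bas; rewrite smsp lexx.
    - by move=> l li; rewrite asp.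
    - by rewrite mxE eqxx /sm ltrBlDr ltrDl.
  near=> w.
  have we : forall l, `|w 0 l - w0 0 l| < e.
    near: w; apply: filterS (nbhsx_ballx w0 e e0) => w.
    by move=> /ball_rV-/(_ e0).
  have q1 : 0 < sg * (g (assemble w sp) - w 0 j).
    near: w; apply: (cvgr_gt _ (cPhi sp _) _ p1).
    by rewrite smsp lexx.
  have q2 : sg * (g (assemble w sm) - w 0 j) < 0.
    near: w; apply: (cvgr_lt _ (cPhi sm _) _ p2).
    by rewrite smsp lexx.
  pose f (s : R) := sg * (g (assemble w s) - w 0 j).
  have cf : {within `[sm, sp], continuous f}.
    apply: continuous_in_subspaceT => s; rewrite inE/= in_itv/= => ss.
    have c1 : {for s, continuous (assemble w)}.
      apply/continuous_coordP => l.
      rewrite (_ : (fun _ => _) = (fun s : R => if l == i then s else w 0 (tperm i j l))).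
        by case: eqP => _; [exact: cvg_id|exact: cst_continuous].
      by apply/funext => s'; rewrite mxE.
    have c2 : {for assemble w s, continuous g}.
      by apply: (Ck_continuous (CB 0%N)); apply: eB; exact: inball.
    have c3 : (fun s => g (assemble w s)) @ s --> g (assemble w s).
      exact: (continuous_comp c1 c2).
    exact: (cvgM (cvg_cst sg) (cvgB c3 (cvg_cst (w 0 j)))).
  have [|s s12 fs0] := @IVT _ f sm sp 0 smsp cf.
    by rewrite ge_min le_max (ltW q1) (ltW q2) orbT.
  exists (assemble w s); first by apply: inball => //; move: s12; rewrite in_itv.
  apply: straighten_assemble; apply/eqP; rewrite -subr_eq0.
  by move/eqP: fs0; rewrite mulf_eq0 (negbTE dg_neq0).
pose eta w := xget a [set u | B u /\ straighten u = w].
have etaP w : (straighten @` B) w -> B (eta w) /\ straighten (eta w) = w.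
  move=> [u Bu uw]; exact: (@xgetI _ _ [set u | B u /\ straighten u = w] u).
have etaK u : B u -> eta (straighten u) = u.
  move=> Bu; have [|B1 E] := etaP (straighten u); first by exists u.
  exact: inj.
have oW : open (straighten @` B).
  rewrite openE => w [u Bu <-].
  have /nbhs_ballP[e /= e0 eB] : nbhs u B by exact: open_nbhs_nbhs.
  apply: filterS (solve u e e0 eB) => w' [u' /eB Bu' <-].
  by exists u'.
set W := straighten @` B in etaP oW *.
have ceta w : W w -> {for w, continuous eta}.
  move=> Ww A nA; have [Beta wE] := etaP w Ww.
  have /nbhs_ballP[e /= e0 eAB] : nbhs (eta w) (A `&` B).
    by apply: filterI => //; exact: open_nbhs_nbhs.
  have := solve (eta w) e e0 (fun x xe => (eAB x xe).2); rewrite wE.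
  apply: filterS => w' [u' u'e <-].
  by have [Au' Bu'] := eAB _ u'e; rewrite /= etaK.
have eta_off w l : W w -> l != i -> eta w 0 l = w 0 (tperm i j l).
  move=> /etaP[_ /rowP/(_ (tperm i j l)) <-] li.
  by rewrite mxE (canF_eq (tpermK i j)) tpermR (negbTE li) tpermK.
have geta w : W w -> g (eta w) = w 0 j.
  by move=> /etaP[_ /rowP/(_ j) <-]; rewrite mxE eqxx.
(* The velocities of the known coordinates of [eta], with 0 in place of the unknown one. Hadamard's
   lemma applied to [g \o eta], which is the coordinate [j], is a linear equation for the increment
   of the unknown coordinate. *)
pose cf (v : 'rV[R]_n) l : R := if l == i then 0 else v 0 (tperm i j l).
have dtheta w v : W w -> is_derive w v (fun w => eta w 0 i)
    ((v 0 j - \sum_(l < n) cf v l * 'D_(e_ l) g (eta w)) / 'D_(e_ i) g (eta w)).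
  move=> Ww; set L := _ / _; have [Beta _] := etaP w Ww.
  suff cv : (fun h => h^-1 *: (((fun w => eta w 0 i) \o shift w) (h *: v) - eta w 0 i)) @ 0^' --> L.
    by apply: DeriveDef; [apply/cvg_ex; exists L|exact: cvg_lim cv].
  have cl : (fun h : R => h *: v + w) @ 0^' --> w.
    have c0 : {for 0, continuous (fun h : R => h *: v + w)}.
      exact: (cvgD (@scalel_continuous _ _ v 0) (cvg_cst w)).
    by move/continuous_withinNx: c0; rewrite scale0r add0r.
  have nW : \forall h \near (0 : R)^', W (h *: v + w).
    have nW0 : nbhs w W by exact: open_nbhs_nbhs.
    exact: (cl _ nW0).
  have ce : (fun h : R => eta (h *: v + w)) @ 0^' --> eta w.
    by move=> A nA; exact: (cl _ (ceta w Ww _ nA)).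
  have [D [Dc DE]] := hadamard_cvg _ oB Beta (CB 1%N) ce.
  have Dn0 : \forall h \near (0 : R)^', D i h != 0.
    by apply: (cvgr_neq0 _ (Dc i)); exact: B_i.
  have : (fun h : R => (v 0 j - \sum_(l < n) cf v l * D l h) / D i h) @ 0^' --> L.
    apply: cvgM; last by apply: cvgV; [exact: B_i|exact: Dc].
    apply: cvgB; first exact: cvg_cst.
    by apply: cvg_sum_ord => l; apply: cvgM; [exact: cvg_cst|exact: Dc].
  apply: cvg_trans; apply: near_eq_cvg; near=> h.
  have h0 : h != 0 by near: h; exact: nbhs_dnbhs_neq.
  have Dih : D i h != 0 by near: h; exact: Dn0.
  have Wh : W (h *: v + w) by near: h; exact: nW.
  have DEh : g (eta (h *: v + w)) - g (eta w) =
      \sum_(l < n) (eta (h *: v + w) 0 l - eta w 0 l) * D l h by near: h; exact: DE.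
  move: DEh; rewrite !geta// [in LHS]mxE [in LHS]mxE addrK (bigD1 i)//= => E.
  rewrite (bigD1 i)//= {1}/cf eqxx mul0r add0r.
  have -> : \sum_(l < n | l != i) cf v l * D l h =
      h^-1 * \sum_(l < n | l != i) (eta (h *: v + w) 0 l - eta w 0 l) * D l h.
    rewrite mulr_sumr; apply: eq_bigr => l li.
    rewrite !eta_off// /cf (negbTE li) !mxE addrK mulrA mulrA mulVf// mul1r//.
  rewrite /GRing.scale/=; apply: (mulIf Dih); rewrite mulfVK//.
  apply: (mulfI h0); rewrite mulrBr E [X in _ - X]mulrA mulfV// mul1r addrK.
  by rewrite !mulrA mulfV// mul1r.
(* Bootstrapping: the derivative of the [i]-th coordinate of [eta] is an expression in [eta] itself
   and the derivatives of [g], so each order of smoothness yields the next. *)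
have Ceta k : Ck k W eta.
  elim: k => [|k ih]; first by split=> // w; exact: ceta.
  apply/Ck_coord => // l; have [->|li] := eqVneq l i; last first.
    apply: (@eq_Ck _ _ _ _ _ (fun w : 'rV[R]_n => w 0 (tperm i j l))) => //.
      by move=> w Ww; rewrite eta_off.
    apply: (@Ck_affine _ _ _ _ _ _ (fun v : 'rV[R]_n => v 0 (tperm i j l))).
      exact: coord_continuous.
    by move=> u v h; rewrite !mxE.
  split=> [w Ww|v].
    by have /continuous_coordP := ceta w Ww; exact.
  split=> [w Ww|]; first by have [] := dtheta w v Ww.
  have CD m : Ck k W (fun w => 'D_(e_ m) g (eta w)).
    apply: (@Ck_comp _ _ _ _ eta ('D_(e_ m) g) B) => //.
      by move=> w /etaP[].
    exact: Ck_derive (CB k.+1).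
  apply: (@eq_Ck _ _ _ _ _ (fun w => (v 0 j - \sum_(l < n) cf v l * 'D_(e_ l) g (eta w)) /
    'D_(e_ i) g (eta w))) => //.
    by move=> w Ww; have [_ ->] := dtheta w v Ww.
  apply: Ck_mul => //; last first.
    by apply: Ck_inv => // w /etaP[/B_i].
  apply: Ck_add => //; first exact: Ck_cst.
  apply: Ck_opp => //; apply: Ck_sum => // m.
  by apply: Ck_mul => //; exact: Ck_cst.
exists B, eta; split=> // [u /rP[]//|]; split=> // w Ww.
by exists W.
Unshelve. all: by end_near. Qed.
End Straighten.

(** * Flows and isolating blocks *)

Section Flow.
Variables (R : realType) (M : topologicalType).
Hypothesis hM : hausdorff_space M.
Implicit Types (psi : M -> R -> M) (K N U : set M).

(** Reversal exchanges forward with backward orbits and entrance with exit sets, so that most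
    statements are proved for one direction only. *)
Definition rflow psi : M -> R -> M := fun x t => psi x (- t).

Definition fwd psi U : set M := [set x | forall t, 0 <= t -> U (psi x t)].

Lemma rflowK psi : rflow (rflow psi) = psi.
Proof. by apply/funext => x; apply/funext => t; rewrite /rflow opprK. Qed.

Lemma rev_flow psi : is_flow psi -> is_flow (rflow psi).
Proof.
move=> [c0 f0 fD]; split=> [z|x|x s t]; rewrite /rflow ?oppr0//; last first.
  by rewrite fD opprD.
have c1 : (fun z : M * R => (z.1, - z.2)) @ z --> (z.1, - z.2).
  have cN : (fun z : M * R => - z.2) @ z --> - z.2 by exact: (cvgN cvg_snd).
  exact: (cvg_pair cvg_fst cN).
move=> A nA; exact: (c1 _ (c0 (z.1, - z.2) _ nA)).
Qed.

Lemma rev_invariant psi K : Defs.invariant psi K -> Defs.invariant (rflow psi) K.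
Proof. by move=> iK x t; exact: iK. Qed.

Lemma rev_isolates psi N K : isolates psi N K -> isolates (rflow psi) N K.
Proof.
move=> [cN KN cK iK mK]; split=> //; first exact: rev_invariant.
by move=> L /rev_invariant; rewrite rflowK; exact: mK.
Qed.

Lemma rev_non_saddle psi K : non_saddle psi K -> non_saddle (rflow psi) K.
Proof.
apply: contra_not => -[U [KU H]]; exists U; split=> // V KV.
have [x [Vx n1 n2]] := H V KV; exists x; split=> // fx.
  by apply: n2 => t t0; apply: fx; rewrite oppr_ge0.
by apply: n1 => t t0; apply: fx; rewrite oppr_le0.
Qed.

Lemma rev_block psi N Ni No : block_sets psi N Ni No -> block_sets (rflow psi) N No Ni.
Proof.
move=> [[cNi cNo E] hi ho ii io]; split.
- by split=> //; rewrite setUC.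
- move=> x /ho[e e0 H]; exists e => // t /andP[t1 t2]; apply: H.
  by rewrite oppr_gt0 t2/= lerNl.
- move=> x /hi[e e0 H]; exists e => // t /andP[t1 t2]; apply: H.
  by rewrite oppr_lt0 t1 lerN2 t2.
- move=> x fx /(io _ fx)[e e0 H]; exists e => // t /andP[t1 t2]; apply: H.
  by rewrite oppr_gt0 t2/= lerNl.
- move=> x fx /(ii _ fx)[e e0 H]; exists e => // t /andP[t1 t2]; apply: H.
  by rewrite oppr_lt0 t1 lerN2 t2.
Qed.

Section OneFlow.
Variable psi : M -> R -> M.
Hypothesis fl : is_flow psi.

Let psi0 x : psi x 0 = x. Proof. by have [_ + _] := fl; exact. Qed.
Let psiD x s t : psi (psi x s) t = psi x (s + t).
Proof. by have [_ _] := fl; exact. Qed.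

Lemma flow_continuous_pair z : (fun z : M * R => psi z.1 z.2) @ z --> psi z.1 z.2.
Proof. by have [+ _ _] := fl; exact. Qed.

Lemma flow_continuous_time x : continuous (psi x).
Proof.
move=> t A nA.
have c1 : (fun s : R => (x, s)) @ t --> (x, t) by exact: (cvg_pair (cvg_cst _) cvg_id).
exact: (c1 _ (flow_continuous_pair (z := (x, t)) nA)).
Qed.

Lemma flow_continuous_space t : continuous (psi ^~ t).
Proof.
move=> x A nA.
have c1 : (fun y : M => (y, t)) @ x --> (x, t) by exact: (cvg_pair cvg_id (cvg_cst _)).
exact: (c1 _ (flow_continuous_pair (z := (x, t)) nA)).
Qed.

Lemma flow_tube x a b (O : set M) : open O ->
  (forall t, a <= t <= b -> O (psi x t)) ->
  \forall y \near x, forall t, a <= t <= b -> O (psi y t).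
Proof.
move=> oO H.
have /compact_near_coveringP/(_ M (nbhs x) (fun y t => O (psi y t)) _) :=
  @segment_compact R a b.
move=> cov; apply: filterS (cov _) => [y yP t tab|t].
  by apply: yP; rewrite /= in_itv.
rewrite /= in_itv/= => /H Oxt.
have := @flow_continuous_pair (x, t) O (open_nbhs_nbhs (conj oO Oxt)).
move=> [[A B] /= [nA nB] AB]; exists (B, A) => //= -[s y] /= [Bs Ay].
exact: (AB (y, s)).
Qed.

(** Each point of [U] outside [O] leaves [U] at some time, and by compactness these times can be
    taken above a common [- T]. A point reached after more than [T] along a trapped orbit is in [U]
    from time [- T] on, hence lies in [O]. The bound does not depend on [x]. *)
Lemma attract U K (O : set M) : isolates psi U K -> open O -> K `<=` O ->
  exists2 T : R, 0 <= T & forall x t, fwd psi U x -> T <= t -> O (psi x t).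
Proof.
move=> [cU _ _ _ mK] oO KO.
have clU := compact_closed hM cU.
have cUO : compact (U `\` O).
  by apply: compact_closedI => //; exact: open_closedC.
have /compact_near_coveringP/(_ R (pinfty_nbhs R)
  (fun T y => exists2 s, - T <= s & ~ U (psi y s)) _) := cUO.
move=> cov; have : \forall T \near +oo, U `\` O `<=`
    (fun y => exists2 s, - T <= s & ~ U (psi y s)).
  apply: cov => y [Uy nOy].
  have [s ns] : exists s, ~ U (psi y s).
    apply/existsNP => Us; apply: nOy; apply: KO.
    apply: (mK [set z | forall s, U (psi z s)]) => //.
    - by move=> z t Uz s; rewrite psiD.
    - by move=> z /(_ 0); rewrite psi0.
  exists ([set y | ~ U (psi y s)], [set T | - s <= T]) => /=.
    split.
      by apply: (@flow_continuous_space s y (~` U)); apply: open_nbhs_nbhs; split=> //; exact: closed_openC.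
    by exists (- s); split; [rewrite num_real|move=> T /ltW].
  by move=> [z T] /= [nz sT]; exists s => //; rewrite lerNl.
move=> [T [_ TP]].
(* The filter at infinity gives a threshold of unknown sign, to be exceeded strictly. *)
exists (Num.max 0 T + 1); first by rewrite addr_ge0// le_max lexx.
move=> x t fx tT; apply: contrapT => nO.
have T't : T < t.
  by apply: lt_le_trans tT; rewrite (@le_lt_trans _ _ (Num.max 0 T))// ?le_max ?lexx ?orbT// ltrDl.
have t0 : 0 <= t by apply: le_trans tT; rewrite addr_ge0// le_max lexx.
have [|s ts ns] := TP t T't (psi x t); first by split=> //; exact: fx.
by apply: ns; rewrite psiD; apply: fx; rewrite addrC -lerBlDr sub0r.
Qed.

Lemma closed_fwd U : closed U -> closed (fwd psi U).
Proof.
move=> cU; rewrite (_ : fwd psi U = \bigcap_(t in [set t : R | 0 <= t]) ((psi ^~ t) @^-1` U)).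
  apply: closed_bigI => t _; apply: closed_comp => // x _.
  exact: flow_continuous_space.
by apply/seteqP; split=> [x fx t t0|x fx t t0]; exact: fx.
Qed.

Lemma invariant_isolated U K x : isolates psi U K ->
  fwd psi U x -> fwd (rflow psi) U x -> K x.
Proof.
move=> [_ _ _ _ mK] fx bx.
apply: (mK [set z | forall s, U (psi z s)]) => //.
- by move=> z t Uz s; rewrite psiD.
- by move=> z /(_ 0); rewrite psi0.
move=> s; have [s0|s0] := leP 0 s; first exact: fx.
by have := bx (- s); rewrite /rflow opprK; apply; rewrite oppr_ge0 ltW.
Qed.

Lemma invariant_back K x t : Defs.invariant psi K -> K (psi x t) -> K x.
Proof. by move=> iK /(iK _ (- t)); rewrite psiD subrr psi0. Qed.

(** A general closed [N] may be re-entered immediately, so all that holds after [e] is that times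
    outside [N] accumulate there. *)
Lemma exit_time N x t : closed N -> N x -> 0 <= t -> ~ N (psi x t) ->
  exists e, [/\ 0 <= e, e < t, forall s, 0 <= s <= e -> N (psi x s)
    & forall d, 0 < d -> exists2 s, e < s < e + d & ~ N (psi x s)].
Proof.
move=> cN Nx t0 nNt.
pose S := [set s | 0 <= s <= t /\ forall r, 0 <= r <= s -> N (psi x r)].
have S0 : S 0.
  split=> [|r]; first by rewrite lexx.
  by rewrite -eq_le => /eqP<-; rewrite psi0.
have hS : has_sup S by split; [exists 0|exists t => s [/andP[]]].
pose e := sup S.
have e0 : 0 <= e by exact: (ub_le_sup hS.2 S0).
have et : e <= t by apply: ge_sup; [exists 0|move=> s [/andP[]]].
have Nlt r : 0 <= r < e -> N (psi x r).
  move=> /andP[r0 re]; have [s [_ Ss] rs] := sup_gt hS.1 re.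
  by apply: Ss; rewrite r0 ltW.
have Ne : N (psi x e).
  apply: contrapT => nNe.
  have : \forall s \near e, ~ N (psi x s).
    apply: (@flow_continuous_time x e (~` N)).
    by apply: open_nbhs_nbhs; split=> //; exact: closed_openC.
  move=> [d /= d0 dP].
  have [e00|e00] := eqVneq e 0; first by apply: nNe; rewrite e00 psi0.
  have ep : 0 < e by rewrite lt_def e00.
  have := dP (Num.max 0 (e - d / 2)).
  have mlt : Num.max 0 (e - d / 2) < e by rewrite gt_max ep ltrBlDr ltrDl divr_gt0.
  apply.
    rewrite /ball_ /= gtr0_norm ?subr_gt0// ltrBlDr -ltrBlDl lt_max; apply/orP; right.
    by rewrite ltrD2l ltrN2 ltr_pdivrMr// ltr_pMr// ltr1n.
  by apply: Nlt; rewrite le_max lexx mlt.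
have Nle s : 0 <= s <= e -> N (psi x s).
  move=> /andP[s0]; rewrite le_eqVlt => /orP[/eqP->//|se].
  by apply: Nlt; rewrite s0.
have lt_et : e < t.
  by rewrite lt_neqAle et andbT; apply/eqP => E; apply: nNt; rewrite -E.
exists e; split=> // d d0; apply: contrapT => H.
pose s := Num.min (e + d / 2) t.
have es : e < s by rewrite lt_min lt_et andbT ltrDl divr_gt0.
have sd : s < e + d.
  by rewrite gt_min; apply/orP; left; rewrite ltrD2l ltr_pdivrMr// ltr_pMr// ltr1n.
suff Ss : S s by have := ub_le_sup hS.2 Ss; rewrite leNgt es.
split=> [|r /andP[r0 rs]].
  by rewrite (le_trans e0 (ltW es)) ge_min lexx orbT.
have [re|er] := leP r e; first by apply: Nle; rewrite r0.
apply: contrapT => nr; apply: H; exists r => //.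
by rewrite er (le_lt_trans rs sd).
Qed.

Lemma exit_frontier N x e : N (psi x e) ->
  (forall d, 0 < d -> exists2 s, e < s < e + d & ~ N (psi x s)) ->
  frontier N (psi x e).
Proof.
move=> Ne H; split; first exact: subset_closure.
move=> iN.
have := @flow_continuous_time x e N iN; move=> [d /= d0 dP].
have [s /andP[es sd]] := H d d0; apply; apply: dP => /=.
by rewrite distrC gtr0_norm ?subr_gt0// ltrBlDl.
Qed.

End OneFlow.

Section Criterion.
Variable psi : M -> R -> M.
Hypothesis fl : is_flow psi.

(** One isolating neighborhood controls all neighborhoods [W]: by [attract] an orbit trapped in [U]
    is in [W] after a fixed time, and until then it stays in [W] if it starts close to the invariant
    set [K]. *)
Lemma non_saddle_criterion U K : isolates psi U K ->
  (exists2 V : set M, K `<=` interior V &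
    forall x, V x -> fwd psi U x \/ fwd (rflow psi) U x) -> non_saddle psi K.
Proof.
move=> iso [V KV VP] [W [KW H]].
have oW := @open_interior _ W.
have [T1 T10 T1P] := attract fl iso oW KW.
have [T2 T20 T2P] := attract (rev_flow fl) (rev_isolates iso) oW KW.
have [_ _ _ iK _] := iso.
(* Close enough to [K] that the orbit stays in [W] until the attraction takes over, in both time
   directions. *)
pose V' := V `&` [set x | forall t, - T2 <= t <= T1 -> interior W (psi x t)].
have [x [[Vx Wx] n1 n2]] : exists x, [/\ V' x, ~ (forall t, 0 <= t -> W (psi x t))
    & ~ (forall t, t <= 0 -> W (psi x t))].
  apply: H => x Kx; apply: filterI; first exact: KV.
  by apply: flow_tube => // t _; apply: KW; exact: iK.
have [fx|fx] := VP _ Vx.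
  apply: n1 => t t0; have [tT|/ltW tT] := leP t T1; apply: interior_subset.
    by apply: Wx; rewrite tT andbT (le_trans _ t0)// oppr_le0.
  exact: T1P.
apply: n2 => t t0; have [tT|tT] := leP (- T2) t; apply: interior_subset.
  by apply: Wx; rewrite tT (le_trans t0).
have := T2P x (- t) fx; rewrite /rflow opprK; apply.
by rewrite lerNr ltW.
Qed.

Lemma non_saddle_nbhs U K : non_saddle psi K -> K `<=` interior U ->
  exists V : set M, [/\ open V, K `<=` V &
    forall x, V x -> fwd psi U x \/ fwd (rflow psi) U x].
Proof.
move=> nsK KU; apply: contrapT => H; apply: nsK; exists U; split=> // V KV.
apply: contrapT => H2; apply: H; exists (interior V); split=> //.
  exact: open_interior.
move=> x /interior_subset Vx; apply: contrapT => /not_orP[n1 n2].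
apply: H2; exists x; split=> // fx; apply: n2 => t t0; apply: fx.
by rewrite oppr_le0.
Qed.

End Criterion.
End Flow.

(** * Trapped orbits in an isolating block *)

Section Block.
Variables (R : realType) (M : topologicalType).
Hypothesis hM : hausdorff_space M.
Implicit Types (psi : M -> R -> M) (K N : set M).

Lemma frontier_sub (N : set M) : closed N -> frontier N `<=` N.
Proof. by move=> cN x [cx _]; rewrite (closure_id N).1. Qed.

Lemma fwd_shift psi N x t : is_flow psi -> fwd psi N x -> 0 <= t ->
  fwd psi N (psi x t).
Proof.
by move=> [_ _ fD] fx t0 s s0; rewrite fD; apply: fx; rewrite addr_ge0.
Qed.

Lemma block_fwd_not_No psi N Ni No x : block_sets psi N Ni No ->
  fwd psi N x -> ~ No x.
Proof.
move=> [_ _ ho _ _] fx /ho[e e0]; move=> /(_ e); rewrite e0 lexx => /(_ isT).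
by apply; apply: fx; exact: ltW.
Qed.

(** At a frontier point the orbit has just been outside [N] or is about to be; at positive times a
    forward trapped orbit allows neither. *)
Lemma block_fwd_interior psi N Ni No x t : is_flow psi -> closed N ->
  block_sets psi N Ni No -> fwd psi N x -> 0 < t -> interior N (psi x t).
Proof.
move=> fl cN blk fx t0; apply: contrapT => ni.
have [_ _ fD] := fl; have [[_ _ fE] hi ho _ _] := blk.
have : frontier N (psi x t).
  by split=> //; apply: subset_closure; apply: fx; exact: ltW.
rewrite fE => -[/hi[e e0 H]|].
  have m0 : 0 < Num.min e t by rewrite lt_min e0.
  apply: (H (- Num.min e t)).
    by rewrite oppr_lt0 m0 lerN2 ge_min lexx.
  by rewrite fD; apply: fx; rewrite subr_ge0 ge_min lexx orbT.
by apply: (block_fwd_not_No blk); apply: fwd_shift => //; exact: ltW.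
Qed.

Lemma block_exit psi N Ni No x t : is_flow psi -> closed N ->
  block_sets psi N Ni No -> N x -> 0 <= t -> ~ N (psi x t) ->
  exists e, [/\ 0 <= e, e < t, forall s, 0 <= s <= e -> N (psi x s)
    & No (psi x e)].
Proof.
move=> fl cN blk Nx t0 nt; have [_ _ fD] := fl.
have [e [e0 et Ne H]] := exit_time fl cN Nx t0 nt; exists e; split=> //.
have Nxe : N (psi x e) by apply: Ne; rewrite e0 lexx.
have fe := exit_frontier fl Nxe H.
apply: contrapT => nNo; have [_ _ _ _ /(_ _ fe nNo)[d d0 dP]] := blk.
have [s /andP[es sd] ns] := H d d0; apply: ns.
have := dP (s - e); rewrite fD subrKC => H2; apply: interior_subset; apply: H2.
by rewrite subr_gt0 es lerBlDr addrC ltW.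
Qed.

(** Points near [x] follow its orbit up to time [T] without meeting the compact exit set, and arrive
    in [V], where every orbit is trapped in some direction. Backward trapping is a closed condition
    that fails at [psi x T], since [x] is not in [K]; forward trapping remains. *)
Lemma block_fwd_near psi N K Ni No x : is_flow psi -> isolates psi N K ->
  block_sets psi N Ni No -> non_saddle psi K -> fwd psi N x -> ~ K x ->
  \forall y \near x, N y -> fwd psi N y.
Proof.
move=> fl iso blk nsK fx nKx; have [_ _ fD] := fl.
have [cN KN _ iK _] := iso; have clN := compact_closed hM cN.
have [V [oV KV VP]] := non_saddle_nbhs nsK KN.
have [T T0 TP] := attract hM fl iso oV KV.
have VT : V (psi x T) by exact: TP.
have nb : ~ fwd (rflow psi) N (psi x T).
  move=> bx; apply: nKx; apply: (invariant_back fl iK (t := T)).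
  by apply: (invariant_isolated fl iso) bx; exact: fwd_shift.
have clb : closed (fwd (rflow psi) N) by apply: closed_fwd => //; exact: rev_flow.
have [[_ cNo _] _ _ _ _] := blk; have clNo := compact_closed hM cNo.
have n1 : \forall y \near x, (V `&` ~` fwd (rflow psi) N) (psi y T).
  apply: (@flow_continuous_space _ _ _ fl T x); apply: open_nbhs_nbhs; split=> //.
  by apply: openI => //; exact: closed_openC.
have n2 : \forall y \near x, forall t, 0 <= t <= T -> (~` No) (psi y t).
  apply: flow_tube => //; first exact: closed_openC.
  by move=> t /andP[t0 _]; apply: (block_fwd_not_No blk); exact: fwd_shift.
apply: filterS2 n1 n2 => y [VyT nby] nNo Ny t t0.
have NT s : 0 <= s <= T -> N (psi y s).
  move=> /andP[s0 sT]; apply: contrapT => ns.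
  have [e [e0 es _ Noe]] := block_exit fl clN blk Ny s0 ns.
  by apply: nNo Noe; rewrite e0 (le_trans (ltW es)).
have [tT|/ltW tT] := leP t T; first by apply: NT; rewrite t0.
have [fy|//] := VP _ VyT.
by have := fy (t - T); rewrite fD subrKC; apply; rewrite subr_ge0.
Qed.

(** Being trapped is a closed condition. It is open in [N] by [block_fwd_near] off [K] and by
    non-saddleness on [K], so connectedness of [N] decides. *)
Lemma block_fwd_or_bwd psi N K Ni No : is_flow psi -> isolates psi N K ->
  block_sets psi N Ni No -> non_saddle psi K -> connected N -> K !=set0 ->
  forall x, N x -> fwd psi N x \/ fwd (rflow psi) N x.
Proof.
move=> fl iso blk nsK Nconn [k Kk].
have [cN KN _ iK _] := iso; have clN := compact_closed hM cN.
have fl' := rev_flow fl; have iso' := rev_isolates iso.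
have blk' := rev_block blk; have nsK' := rev_non_saddle nsK.
pose P := fwd psi N `|` fwd (rflow psi) N.
suff : N `&` P = N by move=> E x; rewrite -[X in X x]E => -[_].
apply: Nconn.
- exists k; split; first exact: (interior_subset (KN _ Kk)).
  by left => t t0; exact: (interior_subset (KN _ (iK _ _ Kk))).
- exists (interior [set y | N y -> P y]); first exact: open_interior.
  apply/seteqP; split=> x [Nx Px]; split=> //; last first.
    exact: (interior_subset Px Nx).
  have [Kx|nKx] := pselect (K x).
    have [V [oV KV VP]] := non_saddle_nbhs nsK KN.
    apply: filterS (open_nbhs_nbhs (conj oV (KV _ Kx))) => y Vy _.
    exact: VP.
  case: Px => [fx|bx].
    apply: filterS (block_fwd_near fl iso blk nsK fx nKx) => y H Ny; left; exact: H.
  apply: filterS (block_fwd_near fl' iso' blk' nsK' bx nKx) => y H Ny; right; exact: H.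
- exists P => //; apply: closedU; apply: closed_fwd => //.
Qed.

(** An entrance point is not trapped backward and an exit point is not trapped forward, so a common
    point would contradict [block_fwd_or_bwd]. *)
Lemma block_disjoint psi N K Ni No : is_flow psi -> isolates psi N K ->
  block_sets psi N Ni No -> non_saddle psi K -> connected N -> K !=set0 ->
  Ni `&` No = set0.
Proof.
move=> fl iso blk nsK Nconn K0; rewrite -subset0 => x [Nix Nox].
have [cN _ _ _ _] := iso; have clN := compact_closed hM cN.
have Nx : N x.
  by apply: frontier_sub => //; have [[_ _ ->] _ _ _ _] := blk; left.
have [fx|fx] := block_fwd_or_bwd fl iso blk nsK Nconn K0 Nx.
  exact: block_fwd_not_No blk fx Nox.
exact: block_fwd_not_No (rev_block blk) fx Nix.
Qed.

(* Every orbit in [C] is the forward orbit of a frontier point, so a splitting of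
   the frontier part of [C] into disjoint compact sets saturates to a splitting
   of [C] itself. *)
Lemma component_frontier_connected psi N K Ni No (C : set M) :
  is_flow psi -> isolates psi N K -> block_sets psi N Ni No ->
  C `<=` fwd psi N `\` K -> connected C ->
  (forall B : set M, connected B -> B `<=` N `\` K -> B `&` C !=set0 -> B `<=` C) ->
  C !=set0 -> (C `&` frontier N) !=set0 /\ connected (C `&` frontier N).
Proof.
move=> fl iso blk CN Cconn Cmax C0; have [_ f0 fD] := fl.
have [cN KN _ iK _] := iso; have clN := compact_closed hM cN.
have fl' := rev_flow fl.
have clF : closed (frontier N).
  by apply: closedI; [exact: closed_closure|exact/open_closedC/open_interior].
have cF : compact (frontier N).
  by apply: subclosed_compact clF cN _; exact: frontier_sub.
have nb x : C x -> exists2 s, 0 <= s & ~ N (psi x (- s)).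
  move=> Cx; have [fx nKx] := CN _ Cx.
  have /existsNP[s /not_implyP[s0 ns]] : ~ fwd (rflow psi) N x.
    by move=> /(invariant_isolated fl iso fx).
  by exists s.
have orig x : C x -> exists z t, [/\ C z, frontier N z, 0 <= t & x = psi z t].
  move=> Cx; have [fx nKx] := CN _ Cx; have [s s0 ns] := nb _ Cx.
  have Nx : N x by have := fx 0; rewrite f0; exact.
  have [e [e0 _ Ne H]] := exit_time fl' clN Nx s0 ns.
  have fe := exit_frontier fl' (Ne e _) H; rewrite /rflow in fe Ne.
  exists (psi x (- e)), e; split=> //; last by rewrite fD addNr f0.
    apply: (Cmax ((fun s => psi x (- s)) @` `[0, e])).
    - apply: connected_continuous_connected; first exact: segment_connected.
      apply: continuous_subspaceT => t.
      exact: (flow_continuous_time fl').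
    - move=> _ [t t0e <-]; rewrite /= in_itv/= in t0e; split; first exact: Ne.
      by move=> /(invariant_back fl iK).
    - by exists x; split=> //; exists 0; rewrite ?oppr0//= in_itv/= lexx.
    - by exists e; rewrite //= in_itv/= lexx e0.
  by apply: fe; rewrite e0 lexx.
(* A forward trapped orbit is interior to [N] at positive times, so it meets the frontier at its
   starting point only. *)
have uniq z z' t t' : frontier N z -> frontier N z' -> fwd psi N z -> fwd psi N z' ->
    0 <= t -> t <= t' -> psi z t = psi z' t' -> z = z'.
  move=> fz _ _ fz' t0; rewrite le_eqVlt => /orP[/eqP<-|tt'] E.
    by rewrite -(f0 z) -(subrr t) -fD E fD subrr f0.
  have zE : z = psi z' (t' - t) by rewrite -fD -E fD subrr f0.
  case: fz => _ []; rewrite zE.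
  by apply: (block_fwd_interior fl clN blk) => //; rewrite subr_gt0.
have Cf x : C x -> fwd psi N x by move=> /CN[].
pose S D : set M := [set x | C x /\ exists z t, [/\ C z, frontier N z, D z, 0 <= t & x = psi z t]].
(* Saturation preserves closedness in [C]: if [x] is outside [N] at time [- s], so are nearby
   points, which therefore started on the frontier less than [s] ago. Near [x] the saturation thus
   lies in the compact set [J]. *)
have Scl (D : set M) : closed D -> forall x, C x -> closure (S D) x -> S D x.
  move=> clD x Cx clx.
  have [s s0 ns] := nb _ Cx.
  pose A := frontier N `&` (D `&` fwd psi N).
  have cA : compact A.
    by apply: compact_closedI => //; apply: closedI => //; exact: closed_fwd.
  pose J := (fun z : M * R => psi z.1 z.2) @` (A `*` `[0, s]).
  have clJ : closed J.
    apply: compact_closed => //; apply: continuous_compact.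
      apply: continuous_subspaceT => z; exact: flow_continuous_pair.
    by apply: compact_setX => //; exact: segment_compact.
  have : closure J x.
    move=> O nO.
    have n1 : \forall y \near x, (~` N) (psi y (- s)).
      apply: (@flow_continuous_space _ _ _ fl (- s) x); apply: open_nbhs_nbhs.
      by split=> //; exact: closed_openC.
    have [y [[Cy [z [t [Cz fz Dz t0 yE]]]] [Oy ny]]] := clx _ (filterI nO n1).
    exists y; split=> //; exists (z, t) => //; split=> /=.
      by split=> //; split=> //; exact: Cf.
    rewrite in_itv/= t0/=; have [//|st] := leP t s.
    by case: ny; rewrite yE fD; apply: (Cf _ Cz); rewrite subr_ge0 ltW.
  rewrite -(closure_id J).1// => -[[z' t'] [/= [fz' [Dz' fwz']] +] xE].
  rewrite in_itv/= => /andP[t'0 _].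
  have [z [t [Cz fz t0 xE2]]] := orig _ Cx.
  have zz' : z = z'.
    have [tt'|/ltW tt'] := leP t t'.
      by apply: (uniq z z' t t') => //; [exact: Cf|rewrite -xE2 xE].
    by apply/esym/(uniq z' z t' t) => //; [exact: Cf|rewrite -xE2 xE].
  by split=> //; exists z, t; split=> //; rewrite zz'.
split.
  by have [x /orig[z [t [Cz fz _ _]]]] := C0; exists z.
(* [P] and [D] cut out the same part [B] of the frontier. By [uniq] the saturations of [D] and of
   the complement of [P] are complementary in [C]; both are relatively closed, so connectedness of
   [C] makes the first one all of [C]. *)
move=> B [b Bb] [P oP BP] [D clD BD].
have SDP : S D = C.
  apply: Cconn.
  - have [Cb fb] : (C `&` frontier N) b by move: Bb; rewrite BP => -[].
    exists b; split=> //; exists b, 0; rewrite f0; split=> //.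
    by move: Bb; rewrite BD => -[].
  - exists (~` closure (S (~` P))); first exact/closed_openC/closed_closure.
    apply/seteqP; split=> x.
      move=> [Cx [z [t [Cz fz Dz t0 xE]]]]; split=> // /(Scl _ (open_closedC oP) _ Cx).
      move=> [_ [z' [t' [Cz' fz' Pz' t'0 xE']]]]; apply: Pz'.
      have zz' : z = z'.
        have [tt'|/ltW tt'] := leP t t'.
          by apply: (uniq z z' t t') => //; [exact: Cf|exact: Cf|rewrite -xE xE'].
        by apply/esym/(uniq z' z t' t) => //; [exact: Cf|exact: Cf|rewrite -xE xE'].
      by have : B z by [rewrite BD]; rewrite BP -zz' => -[].
    move=> [Cx nx]; have [z [t [Cz fz t0 xE]]] := orig _ Cx.
    split=> //; exists z, t; split=> //.
    have : B z; last by rewrite BD => -[].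
    rewrite BP; split=> //; apply: contrapT => nPz; apply: nx.
    by apply: subset_closure; split=> //; exists z, t.
  - exists (closure (S D)); first exact: closed_closure.
    apply/seteqP; split=> x; first by move=> Sx; split; [case: Sx|exact: subset_closure].
    by move=> [Cx /(Scl _ clD _ Cx)].
apply/seteqP; split=> x; first by rewrite BD => -[].
move=> [Cx fx]; have : S D x by rewrite SDP.
move=> [_ [z [t [Cz fz Dz t0 xE]]]].
have -> : x = z.
  by apply: (uniq x z 0 t) => //; [exact: Cf|exact: Cf|rewrite f0].
by rewrite BD.
Qed.

End Block.

(** * Components of a block minus its invariant set *)

Section Topological.
Variables (R : realType) (M : topologicalType).
Hypothesis hM : hausdorff_space M.
Implicit Types (psi : M -> R -> M) (K N : set M).

Lemma component_max (A C B : set M) : is_component A C -> connected B ->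
  B `<=` A -> B `&` C !=set0 -> B `<=` C.
Proof.
move=> [x Ax ->] Bc BA [y [By Cy]].
rewrite (same_connected_component Cy).
exact: connected_component_max.
Qed.

Lemma is_component_sub (A C : set M) : is_component A C -> C `<=` A.
Proof. by move=> [x _ ->]; exact: connected_component_sub. Qed.

Lemma is_component_connected (A C : set M) : is_component A C -> connected C.
Proof. by move=> [x _ ->]; exact: component_connected. Qed.

Lemma is_component_neq0 (A C : set M) : is_component A C -> C !=set0.
Proof. by move=> [x Ax ->]; exists x; exact: connected_component_refl. Qed.

Lemma is_component_eq (A C D : set M) : is_component A C -> is_component A D ->
  C `&` D !=set0 -> C = D.
Proof.
move=> cC cD [x [Cx Dx]]; apply/seteqP; split.
  apply: (component_max cD); [exact: is_component_connected cC|
    exact: is_component_sub cC|by exists x].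
apply: (component_max cC); [exact: is_component_connected cD|
  exact: is_component_sub cD|by exists x].
Qed.

Lemma connected_closed_cover (C A B : set M) : connected C -> closed A -> closed B ->
  C `<=` A `|` B -> C `&` (A `&` B) = set0 -> C `<=` A \/ C `<=` B.
Proof.
move=> Cc cA cB CAB dis.
have [[x [Cx Ax]]|H] := pselect (C `&` A !=set0); last first.
  by right=> x Cx; have [Ax|//] := CAB _ Cx; case: H; exists x.
left; suff E : C `&` A = C by move=> y; rewrite -[X in X y]E => -[].
apply: Cc; [by exists x| |by exists A].
exists (~` B); first exact: closed_openC.
apply/seteqP; split=> y [Cy H]; split=> //.
  by move=> By; suff : set0 y by []; rewrite -dis.
by have [] := CAB _ Cy.
Qed.

Lemma frontier_isolated psi N K : isolates psi N K -> frontier N `<=` N `\` K.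
Proof.
move=> [cN KN _ _ _] x fx; split.
  exact: (frontier_sub (compact_closed hM cN)).
by move=> /KN; case: fx.
Qed.

(** Off [K] the forward and the backward trapped points form disjoint relatively closed sets, so a
    component lies in one of them. Its frontier part is then connected and non-empty, which leaves
    room for exactly one component of the frontier. *)
Lemma block_component psi N K Ni No : is_flow psi -> isolates psi N K ->
  block_sets psi N Ni No -> non_saddle psi K -> connected N -> K !=set0 ->
  forall C, is_component (N `\` K) C ->
    exists! D, is_component (frontier N) D /\ D `<=` C.
Proof.
move=> fl iso blk nsK Nc K0 C cC.
have [cN KN _ iK _] := iso; have clN := compact_closed hM cN.
have CNK := is_component_sub cC.
have FNK := frontier_isolated iso.
have [[y [Cy Fy]] Ec] : (C `&` frontier N) !=set0 /\ connected (C `&` frontier N).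
  have [|||||Cf|Cf] := @connected_closed_cover C (fwd psi N) (fwd (rflow psi) N).
  - exact: is_component_connected cC.
  - exact: closed_fwd.
  - by apply: closed_fwd => //; exact: rev_flow.
  - by move=> x /CNK[Nx _]; exact: (block_fwd_or_bwd hM fl iso blk nsK Nc K0).
  - rewrite -subset0 => x [/CNK[_ nKx] [fx bx]]; apply: nKx.
    exact: (invariant_isolated fl iso).
  - apply: (component_frontier_connected hM fl iso blk).
    + by move=> x Cx; split; [exact: Cf|have [] := CNK _ Cx].
    + exact: is_component_connected cC.
    + by move=> B; exact: component_max cC.
    + exact: is_component_neq0 cC.
  - apply: (component_frontier_connected hM (rev_flow fl) (rev_isolates iso) (rev_block blk)).
    + by move=> x Cx; split; [exact: Cf|have [] := CNK _ Cx].
    + exact: is_component_connected cC.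
    + by move=> B; exact: component_max cC.
    + exact: is_component_neq0 cC.
pose D := connected_component (frontier N) y.
have cD : is_component (frontier N) D by exists y.
have Dy : D y by exact: connected_component_refl.
have DC : D `<=` C.
  apply: (component_max cC); first exact: is_component_connected cD.
    by move=> x /(is_component_sub cD)/FNK.
  by exists y.
exists D; split=> // D' [cD' D'C].
apply: (is_component_eq cD cD').
have [z D'z] := is_component_neq0 cD'; exists z; split=> //.
apply: (component_max cD Ec); [by move=> u []|by exists y|].
by split; [exact: D'C|exact: (is_component_sub cD')].
Qed.

(** Local compactness in the form used for compact sets. As a hypothesis it keeps the dynamical part
    purely topological; [manifold_compact_neighborhoods] supplies it. *)
Definition compact_neighborhoods :=
  forall A O : set M, compact A -> open O -> A `<=` O ->
    exists B, [/\ compact B, A `<=` interior B & B `<=` O].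

Hypothesis lc : compact_neighborhoods.

(* The covering argument uses the filter of the families of sets containing every
   subset of some neighborhood of [N]. *)
Lemma enlarge_isolating psi N K : is_flow psi -> isolates psi N K ->
  exists N', isolates psi N' K /\ N `<=` interior N'.
Proof.
move=> fl iso; have [cN KN cK iK mK] := iso; have [_ f0 fD] := fl.
have clN := compact_closed hM cN.
have [N2 [cN2 NN2 _]] := lc cN openT (@subsetT _ _).
have cQ : compact (N2 `\` interior N).
  by apply: compact_closedI => //; apply: open_closedC; exact: open_interior.
pose F : set_system (set M) := [set P | exists O, [/\ open O, N `<=` O &
  forall B : set M, B `<=` O -> P B]].
have FF : Filter F.
  split.
  - by exists setT; split=> //; exact: openT.
  - move=> P Q [A1 [oA1 NA1 P1]] [A2 [oA2 NA2 P2]].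
    exists (A1 `&` A2); split; [exact: openI|by move=> x Nx; split; [exact: NA1|exact: NA2]|].
    by move=> B BO; split; [apply: P1|apply: P2] => x /BO[].
  - by move=> P Q PQ [P1 [oP1 NP1 H]]; exists P1; split=> // B /H /PQ.
have /compact_near_coveringP/(_ (set M) F
  (fun B y => exists t, ~ B (psi y t)) FF) := cQ.
(* A point of [N2] off the interior of [N] is not in [K], so its orbit leaves [N], and even a small
   compact neighborhood of [N]; compactness yields one neighborhood for all such points. *)
move=> cov; have : \forall B \near F, N2 `\` interior N `<=`
    (fun y => exists t, ~ B (psi y t)).
  apply: cov => y [N2y niy].
  have [t nt] : exists t, ~ N (psi y t).
    apply/existsNP => Ns; apply: niy; apply: KN.
    apply: (mK [set z | forall s, N (psi z s)]) => //.
    - by move=> z t Nz s; rewrite fD.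
    - by move=> z /(_ 0); rewrite f0.
  have [B [cB NB Bt]] : exists B, [/\ compact B, N `<=` interior B & B `<=` ~` [set psi y t]].
    apply: lc => //; last by move=> x Nx /= xE; apply: nt; rewrite -xE.
    apply: closed_openC; apply: compact_closed => //; exact: compact_set1.
  exists ([set y | ~ B (psi y t)], [set B' | B' `<=` interior B]) => /=.
    split; last by exists (interior B); split=> //; exact: open_interior.
    apply: (@flow_continuous_space _ _ _ fl t y (~` B)); apply: open_nbhs_nbhs.
    split; first by apply: closed_openC; exact: compact_closed.
    by move=> /Bt /=; apply.
  by move=> [z B'] /= [nz B'B]; exists t => /B'B /interior_subset.
move=> [P [oP NP PP]].
have [N' [cN' NN' N'P]] : exists N', [/\ compact N', N `<=` interior N' & N' `<=` P `&` interior N2].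
  apply: lc => //; first by apply: openI => //; exact: open_interior.
  by move=> x Nx; split; [exact: NP|exact: NN2].
exists N'; split=> //; split=> //.
  by move=> x Kx; apply: NN'; exact: (interior_subset (KN _ Kx)).
move=> L iL LN'; apply: mK => // x Lx; apply: contrapT => nNx.
have [||t nt] := PP N' _ x; first by move=> z /N'P[].
  split; first by have [_ /interior_subset] := N'P _ (LN' _ Lx).
  by move=> /interior_subset.
by apply: nt; apply: LN'; exact: iL.
Qed.

(** Starting in [C], the orbit either stays in [N] for one time unit or leaves through [Ni] and is
    back in [C] one unit later. Each round takes at least one unit and ends in [C], so the rounds
    exhaust all times. *)
Lemma component_trapped psi N K Ni N' (C : set M) : is_flow psi -> closed N ->
  Defs.invariant psi K -> N `<=` N' ->
  is_component (N `\` K) C -> C `&` frontier N `<=` Ni ->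
  (forall z, C z -> Ni z -> (forall s, 0 <= s <= 1 -> N' (psi z s)) /\ C (psi z 1)) ->
  forall x, C x -> fwd psi N' x.
Proof.
move=> fl clN iK NN' cC CNi ret x Cx; have [_ f0 fD] := fl.
have CNK := is_component_sub cC.
have seg y e : C y -> 0 <= e -> (forall s, 0 <= s <= e -> N (psi y s)) -> C (psi y e).
  move=> Cy e0 Ne; have [_ nKy] := CNK _ Cy.
  apply: (component_max cC (B := psi y @` `[0, e])).
  - apply: connected_continuous_connected; first exact: segment_connected.
    apply: continuous_subspaceT; exact: flow_continuous_time.
  - move=> _ [t t0e <-]; rewrite /= in_itv/= in t0e; split; first exact: Ne.
    by move=> /(invariant_back fl iK).
  - exists y; split=> //; exists 0; last exact: f0.
    by rewrite /= in_itv/= lexx.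
  - by exists e => //; rewrite /= in_itv/= lexx e0.
have P m : exists s, [/\ m%:R <= s, forall t, 0 <= t <= s -> N' (psi x t) & C (psi x s)].
  elim: m => [|m [s [ms Ns Cs]]].
    exists 0; split=> //; last by rewrite f0.
    by move=> t; rewrite -eq_le => /eqP<-; rewrite f0; apply: NN'; have [] := CNK _ Cx.
  have s0 : 0 <= s by apply: le_trans ms.
  have [Nall|/existsNP[r /not_implyP[/andP[r0 r1] nr]]] :=
      pselect (forall r, 0 <= r <= 1 -> N (psi (psi x s) r)).
    exists (s + 1); split; first by rewrite -natr1 lerD2r.
      move=> t /andP[t0 ts1]; have [ts|/ltW st] := leP t s; first by apply: Ns; rewrite t0.
      apply: NN'; have := Nall (t - s); rewrite fD subrKC; apply.
      by rewrite subr_ge0 st lerBlDl.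
    by rewrite -fD; exact: seg.
  have Nxs : N (psi x s) by have [] := CNK _ Cs.
  have [e [e0 er Ne H]] := exit_time fl clN Nxs r0 nr.
  have Nxe : N (psi (psi x s) e) by apply: Ne; rewrite e0 lexx.
  have fe := exit_frontier fl Nxe H.
  have Ce := seg _ _ Cs e0 Ne.
  have [N'e C1] := ret _ Ce (CNi _ (conj Ce fe)).
  exists (s + e + 1); split.
  - by rewrite -natr1 lerD2r (le_trans ms)// lerDl.
  - move=> t /andP[t0 ts1]; have [ts|/ltW st] := leP t s; first by apply: Ns; rewrite t0.
    have [te|/ltW et] := leP t (s + e).
      apply: NN'; have := Ne (t - s); rewrite fD subrKC; apply.
      by rewrite subr_ge0 st lerBlDl.
    have := N'e (t - (s + e)); rewrite !fD addrA subrKC; apply.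
    by rewrite subr_ge0 et lerBlDl.
  - by rewrite -!fD.
move=> t t0; have [s [ts Ns _]] := P (Num.truncn t).+1.
apply: Ns; rewrite t0 (le_trans _ ts)// ltW//.
by have /andP[] := truncn_itv t0.
Qed.

End Topological.

(** * Non-saddleness for small parameters *)

Section Family.
Variables (R : realType) (M : topologicalType).
Hypothesis hM : hausdorff_space M.
Hypothesis lc : @compact_neighborhoods M.
Implicit Types (phi : R -> M -> R -> M) (N : set M) (K : R -> set M).

Definition flow_family phi : Prop :=
  (forall l, 0 <= l <= 1 -> is_flow (phi l)) /\
  {within [set z : M * R * R | 0 <= z.2 <= 1],
     continuous (fun z : M * R * R => phi z.2 z.1.1 z.1.2)}.

Lemma rev_family phi : flow_family phi -> flow_family (fun l => rflow (phi l)).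
Proof.
move=> [fl /subspace_continuousP J]; split=> [l l01|]; first exact/rev_flow/fl.
apply/subspace_continuousP => z Az.
have c2 : (fun z : M * R * R => - z.1.2) @ z --> - z.1.2.
  by apply: cvgN; apply: (cvg_comp _ _ cvg_fst cvg_snd).
have c1 : (fun z : M * R * R => (z.1.1, - z.1.2, z.2)) @ z --> (z.1.1, - z.1.2, z.2).
  apply: (cvg_pair (cvg_pair _ c2) cvg_snd).
  exact: (cvg_comp _ _ cvg_fst cvg_fst).
move=> A nA; have H := J (z.1.1, - z.1.2, z.2) Az A nA.
exact: (c1 _ H).
Qed.

Lemma family_near phi l0 x t (B : set M) : flow_family phi -> 0 <= l0 <= 1 ->
  open B -> B (phi l0 x t) ->
  \forall z \near (x, t, l0), 0 <= z.2 <= 1 -> B (phi z.2 z.1.1 z.1.2).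
Proof.
move=> [_ /subspace_continuousP J] l01 oB Bx.
exact: (J (x, t, l0) l01 B (open_nbhs_nbhs (conj oB Bx))).
Qed.

Lemma family_uniform phi (Q : set (M * R)) (B : set M) : flow_family phi ->
  compact Q -> open B -> (forall z, Q z -> B (phi 0 z.1 z.2)) ->
  \forall l \near (0 : R), 0 <= l <= 1 -> forall z, Q z -> B (phi l z.1 z.2).
Proof.
move=> fam cQ oB QB.
have /compact_near_coveringP/(_ R (nbhs (0 : R))
  (fun l z => 0 <= l <= 1 -> B (phi l z.1 z.2)) _) := cQ.
move=> cov; apply: filterS (cov _) => [l lP l01 z Qz|[x t] Qz]; first exact: lP.
have z01 : 0 <= (0 : R) <= 1 by rewrite lexx ler01.
exact: (family_near fam z01 oB (QB _ Qz)).
Qed.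

Lemma near_right_of_near0 (P : R -> Prop) :
  (\forall l \near (0 : R), 0 <= l <= 1 -> P l) -> \forall l \near 0^'+, P l.
Proof.
move=> H; near=> l; have : 0 <= l <= 1 -> P l by near: l; exact: cvg_within.
have l0 : 0 < l by near: l; exact: nbhs_right_gt.
have l1 : l <= 1 by near: l; exact: nbhs_right_le.
by apply; rewrite l1 ltW.
Unshelve. all: by end_near. Qed.

(** At time 1 the compact set [Ni] is inside the interior of [N] for [phi 0], hence for [phi l] with
    small [l]. To see that the return is to the same component, follow the orbit of [phi 0] up to
    time 1, then hold the time and let the parameter run from 0 to [l]. *)
Lemma side_trapped phi K N N' Ni No : flow_family phi ->
  isolates (phi 0) N (K 0) -> block_sets (phi 0) N Ni No ->
  (forall x, Ni x -> fwd (phi 0) N x) ->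
  isolates (phi 0) N' (K 0) -> N `<=` interior N' ->
  (forall N1, isolates (phi 0) N1 (K 0) ->
     \forall l \near 0^'+, isolates (phi l) N1 (K l)) ->
  \forall l \near 0^'+, forall C, is_component (N `\` K l) C ->
    C `&` frontier N `<=` Ni -> forall x, C x -> fwd (phi l) N' x.
Proof.
move=> fam iso blk Nifwd iso' NN' cont.
have z01 : 0 <= (0 : R) <= 1 by rewrite lexx ler01.
have fl0 := fam.1 _ z01.
have [cN KN cK iK mK] := iso; have clN := compact_closed hM cN.
have [[cNi _ FE] hi _ _ _] := blk.
pose Q1 := Ni `*` `[0, 1 : R]%classic.
have cQ1 : compact Q1 by apply: compact_setX => //; exact: segment_compact.
pose Q := (fun z : M * R => phi 0 z.1 z.2) @` Q1.
have cQ : compact Q.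
  apply: continuous_compact => //; apply: continuous_subspaceT => z.
  exact: flow_continuous_pair.
have clQ := compact_closed hM cQ.
have NiK z : Ni z -> ~ K 0 z.
  move=> Niz /KN iz; have : frontier N z by rewrite FE; left.
  by case.
(* [Q] is swept out by the entrance set up to time 1 and misses [K 0]. By continuation [K l] lies in
   [N1], so it stays away from the first leg of the path. *)
have [N1 [cN1 KN1 N1Q]] : exists B, [/\ compact B, K 0 `<=` interior B
    & B `<=` interior N `&` ~` Q].
  apply: lc => //; first by apply: openI; [exact: open_interior|exact: closed_openC].
  move=> x Kx; split; first exact: KN.
  by move=> [[z t] [/= /NiK nKz _] xE]; apply: nKz; apply: (invariant_back fl0 iK (t := t)); rewrite xE.
have iso1 : isolates (phi 0) N1 (K 0).
  split=> // L iL LN1; apply: mK => // x /LN1/N1Q[/interior_subset].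
  by [].
have clN1 := compact_closed hM cN1.
have n1 : \forall l \near 0^'+, forall z, Q1 z -> interior N' (phi l z.1 z.2).
  apply: near_right_of_near0; apply: family_uniform => //; first exact: open_interior.
  move=> [z t] [/= Niz]; rewrite in_itv/= => /andP[t0 _].
  by apply: NN'; exact: Nifwd.
pose Q2 := Ni `*` [set 1 : R].
have cQ2 : compact Q2 by apply: compact_setX => //; exact: compact_set1.
have n2 : \forall l \near (0 : R), 0 <= l <= 1 -> forall z, Q2 z ->
    (interior N `&` ~` N1) (phi l z.1 z.2).
  apply: family_uniform => //; first by apply: openI; [exact: open_interior|exact: closed_openC].
  move=> [z t] [/= Niz ->]; split.
    by apply: (block_fwd_interior fl0 clN blk) => //; exact: Nifwd.
  move=> /N1Q[_]; apply; exists (z, 1) => //; split=> //=.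
  by rewrite in_itv/= lexx ler01.
(* All parameters between 0 and [l] are needed, as the second leg of the path runs through them. *)
have n3 : \forall l \near 0^'+, forall mu, 0 <= mu <= l -> forall z, Ni z ->
    (interior N `&` ~` N1) (phi mu z 1).
  move: n2 => [r /= r0 rP]; near=> l => mu /andP[mu0 mul] z Niz.
  have lr : l < r by near: l; exact: nbhs_right_lt.
  have l1 : l <= 1 by near: l; apply: nbhs_right_le.
  apply: (rP mu _ _ (z, 1)); last by split.
    by rewrite /= sub0r normrN ger0_norm// (le_lt_trans mul).
  by rewrite mu0 (le_trans mul).
near=> l => C cC CNi.
have l0 : 0 < l by near: l; exact: nbhs_right_gt.
have l1 : l <= 1 by near: l; apply: nbhs_right_le.
have l01 : 0 <= l <= 1 by rewrite ltW.
have isol : isolates (phi l) N (K l) by near: l; exact: cont.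
have isol1 : isolates (phi l) N1 (K l) by near: l; exact: cont.
have [_ _ _ iKl _] := isol; have [_ KlN1 _ _ _] := isol1.
have fll := fam.1 _ l01.
apply: (component_trapped fll clN iKl _ cC CNi).
  by move=> x /NN'/interior_subset.
move=> z Cz Niz; split=> [s s01|].
  apply: interior_subset.
  have H : forall z, Q1 z -> interior N' (phi l z.1 z.2) by near: l; exact: n1.
  by apply: (H (z, s)); split=> //=; rewrite in_itv.
have H3 : forall mu, 0 <= mu <= l -> forall z, Ni z ->
    (interior N `&` ~` N1) (phi mu z 1) by near: l; exact: n3.
(* The two legs share the point [phi 0 z 1]; their union is connected, lies in [N] and avoids
   [K l]. *)
apply: (component_max cC (B := (phi 0 z @` `[0, 1]) `|` ((fun mu => phi mu z 1) @` `[0, l]))).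
- apply: connectedU.
  + exists (phi 0 z 1); split; first by exists 1; rewrite //= in_itv/= lexx ler01.
    by exists 0; rewrite //= in_itv/= lexx ltW.
  + apply: connected_continuous_connected; first exact: segment_connected.
    apply: continuous_subspaceT; exact: flow_continuous_time.
  + apply: connected_continuous_connected; first exact: segment_connected.
    apply/subspace_continuousP => mu; rewrite /= in_itv/= => /andP[mu0 mul].
    move=> A; rewrite nbhsE => -[B [oB Bmu] BA].
    have mu01 : 0 <= mu <= 1 by rewrite mu0 (le_trans mul).
    have := family_near fam mu01 oB Bmu.
    have c1 : (fun mu => (z, 1 : R, mu)) @ mu --> (z, 1 : R, mu).
      exact: (cvg_pair (cvg_cst _) cvg_id).
    move=> /c1 H0.
    have H1 : nbhs mu (fun m : R => 0 <= m <= 1 -> B (phi m z 1)) by exact: H0.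
    suff : nbhs mu (fun m => `[0, l]%classic m -> A (phi m z 1)) by [].
    apply: filterS H1 => m H; rewrite /= in_itv/= => /andP[m0 ml].
    by apply/BA/H; rewrite m0 (le_trans ml).
- move=> _ [[s +] <-|[mu +] <-]; rewrite /= in_itv/=.
    move=> /andP[s0 s1]; split; first exact: Nifwd.
    move=> /KlN1/interior_subset/N1Q[_]; apply; exists (z, s) => //; split=> //=.
    by rewrite in_itv/= s0.
  move=> ml; have [/interior_subset Nm nN1] := H3 mu ml z Niz; split=> //.
  by move=> /KlN1/interior_subset.
- exists z; split=> //; left; exists 0; first by rewrite /= in_itv/= lexx ler01.
  by have [_ -> _] := fl0.
- by right; exists l; rewrite //= in_itv/= lexx ltW.
Unshelve. all: by end_near. Qed.

Lemma isolates_of_rev (psi : M -> R -> M) N (L : set M) :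
  isolates (rflow psi) N L -> isolates psi N L.
Proof. by move=> /rev_isolates; rewrite rflowK. Qed.

Lemma non_saddle_of_components phi K N Ni No : flow_family phi ->
  isolates (phi 0) N (K 0) -> block_sets (phi 0) N Ni No ->
  connected N -> K 0 !=set0 -> non_saddle (phi 0) (K 0) ->
  (forall N1, isolates (phi 0) N1 (K 0) ->
     \forall l \near 0^'+, isolates (phi l) N1 (K l)) ->
  (\forall l \near 0^'+, forall C, is_component (N `\` K l) C ->
            exists! D, is_component (frontier N) D /\ D `<=` C) ->
  \forall l \near 0^'+, non_saddle (phi l) (K l).
Proof.
move=> fam iso blk Nc K0 nsK cont comp.
have z01 : 0 <= (0 : R) <= 1 by rewrite lexx ler01.
have fl0 := fam.1 _ z01.
have [cN _ _ _ _] := iso; have clN := compact_closed hM cN.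
have [N' [iso' NN']] := enlarge_isolating hM lc fl0 iso.
have [[cNi cNo FE] hi ho _ _] := blk.
have fb := block_fwd_or_bwd hM fl0 iso blk nsK Nc K0.
have FN := frontier_sub clN.
have Nifwd x : Ni x -> fwd (phi 0) N x.
  move=> Nix; have [|//|bx] := fb x; first by apply: FN; rewrite FE; left.
  by case: (block_fwd_not_No (rev_block blk) bx).
have Nobwd x : No x -> fwd (rflow (phi 0)) N x.
  move=> Nox; have [|fx|//] := fb x; first by apply: FN; rewrite FE; right.
  by case: (block_fwd_not_No blk fx).
have dis := block_disjoint hM fl0 iso blk nsK Nc K0.
have n1 := side_trapped fam iso blk Nifwd iso' NN' cont.
have n2 := side_trapped (rev_family fam) (rev_isolates iso) (rev_block blk) Nobwd
  (rev_isolates iso') NN' _.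
have {}n2 := n2 (fun N1 H => filterS (fun l => @rev_isolates _ _ _ _ _) (cont N1 (isolates_of_rev H))).
near=> l.
have l0 : 0 < l by near: l; exact: nbhs_right_gt.
have l1 : l <= 1 by near: l; apply: nbhs_right_le.
have fll : is_flow (phi l) by apply: fam.1; rewrite l1 ltW.
have isol : isolates (phi l) N (K l) by near: l; exact: cont.
have isol' : isolates (phi l) N' (K l) by near: l; exact: cont.
have [_ KlN _ iKl _] := isol.
(* Orbits start in [N] but are trapped only in [N'], so the criterion is applied with [N'] as
   isolating neighborhood. *)
apply: (non_saddle_criterion hM fll isol'); exists N => // x Nx.
have [Kx|nKx] := pselect (K l x).
  by left => t t0; exact: (interior_subset (NN' _ (interior_subset (KlN _ (iKl _ _ Kx))))).
pose C := connected_component (N `\` K l) x.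
have cC : is_component (N `\` K l) C by exists x.
have Cx : C x by exact: connected_component_refl.
have compl : forall C, is_component (N `\` K l) C ->
    exists! D, is_component (frontier N) D /\ D `<=` C by near: l; exact: comp.
have [D [[cD DC] Duniq]] := compl C cC.
(* Every frontier point of [C] has its whole frontier component in [C], and uniqueness identifies
   that component with [D]. *)
have CFD : C `&` frontier N `<=` D.
  move=> y [Cy Fy]; rewrite (Duniq (connected_component (frontier N) y)).
    exact: connected_component_refl.
  split; first by exists y.
  apply: (component_max cC); first exact: component_connected.
    by move=> z /connected_component_sub; exact: (frontier_isolated hM isol).
  by exists y; split=> //; exact: connected_component_refl.
have DF := is_component_sub cD.
have [DNi|DNo] : D `<=` Ni \/ D `<=` No.
  apply: connected_closed_cover.
  - exact: is_component_connected cD.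
  - exact: compact_closed.
  - exact: compact_closed.
  - by move=> y /DF; rewrite FE.
  - by rewrite dis setI0.
left; have H : forall C, is_component (N `\` K l) C ->
    C `&` frontier N `<=` Ni -> forall x, C x -> fwd (phi l) N' x by near: l; exact: n1.
  by apply: (H C cC) => // y /CFD/DNi.
right; have H : forall C, is_component (N `\` K l) C ->
    C `&` frontier N `<=` No -> forall x, C x -> fwd (rflow (phi l)) N' x by near: l; exact: n2.
by apply: (H C cC) => // y /CFD/DNo.
Unshelve. all: by end_near. Qed.

End Family.

(** * Charts and smooth functions *)

Section Charts.
Variables (R : realType) (n : nat) (M : smooth_manifold R n).
Implicit Types (c d : chart R n M) (x y p : M).

Lemma chart_open_image c (A : set M) : open A -> A `<=` chart_dom c -> open (c @` A).
Proof.
move=> oA Ac; rewrite openE => _ [x Ax <-].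
have n1 : \forall u \near c x, A (chart_inv c u).
  apply: (chart_inv_continuous (Ac _ Ax)); rewrite chart_mapK; last exact: Ac.
  exact: open_nbhs_nbhs.
have n2 : \forall u \near c x, (c @` chart_dom c) u.
  by apply: open_nbhs_nbhs; split; [exact: chart_im_open|exists x => //; exact: Ac].
apply: filterS2 n1 n2 => u Au [y dy yu]; exists (chart_inv c u) => //.
by rewrite -yu chart_mapK.
Qed.

Lemma near_chart_inv c x : chart_dom c x ->
  \forall u \near c x, chart_dom c (chart_inv c u) /\ c (chart_inv c u) = u.
Proof.
move=> dx; have : \forall u \near c x, (c @` chart_dom c) u.
  by apply: open_nbhs_nbhs; split; [exact: chart_im_open|exists x].
by apply: filterS => u [y dy <-]; rewrite chart_mapK.
Qed.

Lemma near_chart_inv_set c x (A : set M) : chart_dom c x -> nbhs x A ->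
  \forall u \near c x, A (chart_inv c u).
Proof.
by move=> dx nA; apply: (chart_inv_continuous dx); rewrite chart_mapK.
Qed.

Lemma chart_dom_nbhs c x : chart_dom c x -> nbhs x (chart_dom c).
Proof. by move=> dx; apply: open_nbhs_nbhs; split=> //; exact: chart_dom_open. Qed.

Lemma atlas_maximal c : mfd_atlas c -> maximal_atlas c.
Proof. by move=> ac d ad; exact: mfd_atlas_compatible. Qed.

Lemma transition_smooth c d x : maximal_atlas c -> mfd_atlas d ->
  chart_dom c x -> chart_dom d x ->
  smooth_at (d \o chart_inv c) (c x) /\ smooth_at (c \o chart_inv d) (d x).
Proof.
move=> mc ad cx dx; have [s1 s2] := mc d ad.
have o : open (chart_dom c `&` chart_dom d) by apply: openI; exact: chart_dom_open.
split.
  apply: (smooth_on_at s1); apply: open_nbhs_nbhs; split; last by exists x.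
  by apply: chart_open_image => // y [].
apply: (smooth_on_at s2); apply: open_nbhs_nbhs; split; last by exists x.
by apply: chart_open_image => // y [].
Qed.

Definition msmooth (h : M -> R) : Prop := forall x c, mfd_atlas c -> chart_dom c x ->
  smooth_at (h \o chart_inv c) (c x).

Lemma msmooth_maximal h c x : msmooth h -> maximal_atlas c -> chart_dom c x ->
  smooth_at (h \o chart_inv c) (c x).
Proof.
move=> sh mc cx; have [d ad dx] := mfd_atlas_cover x.
have [s1 s2] := transition_smooth mc ad cx dx.
apply: (@smooth_at_near _ _ _ ((h \o chart_inv d) \o (d \o chart_inv c))).
  apply: filterS (near_chart_inv_set cx (chart_dom_nbhs dx)) => u du /=.
  by rewrite chart_mapK.
by apply: smooth_at_comp => //=; rewrite chart_mapK//; exact: sh.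
Qed.

Lemma msmooth_continuous h : msmooth h -> continuous h.
Proof.
move=> sh x; have [c ac cx] := mfd_atlas_cover x.
have c1 := smooth_at_continuous (sh x c ac cx).
have cc := chart_map_continuous cx.
move=> A nA; have : nbhs (c x) ((h \o chart_inv c) @^-1` A).
  by apply: c1; rewrite /= chart_mapK.
move=> /cc; apply: filterS2 (chart_dom_nbhs cx) => y dy /=.
by rewrite chart_mapK.
Qed.

(** Vanishing of the differential at [p], read in one chart; [critical_chart] transports it to the
    charts of the atlas. *)
Definition critical (h : M -> R) c p : Prop :=
  forall i, 'D_(delta_mx 0 i) (h \o chart_inv c) (c p) = 0.

Lemma critical_chart h c d p : msmooth h -> maximal_atlas c -> mfd_atlas d ->
  chart_dom c p -> chart_dom d p -> critical h c p -> critical h d p.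
Proof.
move=> sh mc ad cp dp crit i.
have [s1 s2] := transition_smooth mc ad cp dp.
have sc := msmooth_maximal sh mc cp.
have [U [oU Ux CU]] := sc.
have E : \forall u \near d p, ((h \o chart_inv c) \o (c \o chart_inv d)) u = (h \o chart_inv d) u.
  apply: filterS (near_chart_inv_set dp (chart_dom_nbhs cp)) => u du /=.
  by rewrite chart_mapK.
rewrite -(near_eq_derive _ E).
have [||_ ->] := @derive_comp_rV _ _ _ (c \o chart_inv d) (h \o chart_inv c) U (d p)
  (delta_mx 0 i) oU (CU 1%N).
- by rewrite /= chart_mapK.
- exact: smooth_at_derivable.
by rewrite big1// => k _; rewrite /= chart_mapK// crit mulr0.
Qed.

(** Closed balls of the sup norm written by coordinates, so that they are visibly products of
    compact segments. *)
Definition cube (a : 'rV[R]_n) (r : R) : set 'rV[R]_n :=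
  [set u | forall k, `|u 0 k - a 0 k| <= r].

Lemma cube_compact a r : compact (cube a r).
Proof.
have := @rV_compact R n (fun k => `[a 0 k - r, a 0 k + r]%classic)
  (fun k => @segment_compact R _ _).
congr (compact _); apply/seteqP; split=> u H k; have := H k;
  by rewrite /= in_itv/= ler_distl.
Qed.

Lemma chart_cube c x (A : set M) : chart_dom c x -> nbhs x A ->
  exists2 r : R, 0 < r & [/\ compact (chart_inv c @` cube (c x) r),
    chart_inv c @` cube (c x) r `<=` chart_dom c `&` A
  & forall y, chart_dom c y -> cube (c x) r (c y) -> (chart_inv c @` cube (c x) r) y].
Proof.
move=> cx nA.
have : \forall u \near c x, (chart_dom c (chart_inv c u) /\ c (chart_inv c u) = u) /\
    A (chart_inv c u).
  by apply: filterS2 (near_chart_inv cx) (near_chart_inv_set cx nA).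
move=> /nbhs_ballP[r /= r0 rP].
have r20 : 0 < r / 2 by rewrite divr_gt0.
have cb : cube (c x) (r / 2) `<=` ball (c x) r.
  move=> u cu; apply/ball_rV => // k; apply: le_lt_trans (cu k) _.
  by rewrite ltr_pdivrMr// ltr_pMr// ltr1n.
exists (r / 2) => //; split.
- apply: continuous_compact; last exact: cube_compact.
  apply: continuous_in_subspaceT => u; rewrite inE => /cb/rP[[du uE] _].
  by rewrite -uE; exact: chart_inv_continuous.
- by move=> _ [u /cb/rP[[du _] Au] <-].
- by move=> y dy cy; exists (c y); rewrite // chart_mapK.
Qed.

Lemma chart_cube_nbhs c x r : 0 < r -> chart_dom c x ->
  \forall y \near x, chart_dom c y /\ cube (c x) r (c y).
Proof.
move=> r0 cx.
have n1 : \forall y \near x, ball (c x) r (c y).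
  by apply: (chart_map_continuous cx); exact: nbhsx_ballx.
apply: filterS2 n1 (chart_dom_nbhs cx) => y /ball_rV-/(_ r0) yr dy.
by split=> // k; exact/ltW.
Qed.

(** A finite union of compact chart cubes. The finite choice is made by the covering form of
    compactness, with the filter of families containing all sufficiently large compact subsets of
    [B]. *)
Lemma manifold_compact_neighborhoods : @compact_neighborhoods M.
Proof.
move=> A B cA oB AB.
pose F : set_system (set M) := [set P | exists B0, [/\ compact B0, B0 `<=` B &
  forall C : set M, compact C -> C `<=` B -> B0 `<=` C -> P C]].
have FF : Filter F.
  split.
  - by exists set0; split=> //; exact: compact0.
  - move=> P Q [B1 [cB1 B1B P1]] [B2 [cB2 B2B P2]].
    exists (B1 `|` B2); split; [exact: compactU|by move=> y [/B1B|/B2B]|].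
    by move=> C cC CB BC; split; [apply: P1|apply: P2] => // y By; apply: BC; [left|right].
  - by move=> P Q PQ [B1 [cB1 B1B P1]]; exists B1; split=> // C cC CB BC; apply/PQ/P1.
have /compact_near_coveringP/(_ (set M) F (fun C y => interior C y) FF) := cA.
move=> cov; have : \forall C \near F, A `<=` (fun y => interior C y).
  apply: cov => x Ax; have [c ac cx] := mfd_atlas_cover x.
  have [r r0 [cr rB rP]] := chart_cube cx (open_nbhs_nbhs (conj oB (AB _ Ax))).
  set Q := chart_inv c @` _ in cr rB rP.
  have nQ : nbhs x Q.
    by apply: filterS (chart_cube_nbhs r0 cx) => y [dy cy]; exact: rP.
  exists (interior Q, [set C | Q `<=` C]) => /=.
    split; first by apply: open_nbhs_nbhs; split=> //; exact: open_interior.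
    by exists Q; split=> // y /rB[].
  by move=> [y C] /= [Qy QC]; apply: filterS Qy => z /QC.
move=> [B0 [cB0 B0B H]]; exists B0; split=> //.
exact: H.
Qed.

(** [rho] is positive only on a Euclidean ball inside the cube, so [flat 0 \o rho] vanishes off the
    compact set [Q]. As [Q] is closed in the Hausdorff space [M], extension by 0 beyond the chart is
    smooth. *)
Lemma smooth_bump x (A : set M) : nbhs x A -> exists h : M -> R,
  [/\ msmooth h, forall y, 0 <= h y, 0 < h x & forall y, ~ A y -> h y = 0].
Proof.
move=> nA; have [c ac cx] := mfd_atlas_cover x.
have [r r0 [cr rA rP]] := chart_cube cx nA.
set Q := chart_inv c @` _ in cr rA rP.
pose rho (u : 'rV[R]_n) : R := r ^+ 2 - \sum_(k < n) (u 0 k - c x 0 k) * (u 0 k - c x 0 k).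
have rho_smooth u : smooth_at rho u.
  apply: smooth_at_add; first exact: smooth_at_cst.
  apply: smooth_at_opp; apply: smooth_at_sum => k.
  by apply: smooth_at_mul; apply: smooth_at_add; first exact: smooth_at_coordinate;
     try exact: smooth_at_cst; exact: smooth_at_coordinate.
have rho_cube u : 0 < rho u -> cube (c x) r u.
  rewrite subr_gt0 => H k; rewrite -(@ler_pXn2r _ 2)// ?nnegrE ?ltW// real_normK ?num_real//.
  apply: le_lt_trans H; rewrite (bigD1 k)//= expr2 lerDl.
  by apply: sumr_ge0 => l _; rewrite -expr2 sqr_ge0.
pose h y := if pselect (chart_dom c y) then flat 0 (rho (c y)) else 0.
have hQ y : ~ Q y -> h y = 0.
  rewrite /h; case: pselect => // dy nQ; apply/eqP; rewrite eq_le flat_ge0 andbT leNgt.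
  by apply/negP; rewrite flat_gt0 => /rho_cube /(rP _ dy).
exists h; split.
- move=> y d ad dy; have [cy|ncy] := pselect (chart_dom c y).
    apply: (@smooth_at_near _ _ _ ((flat 0 \o rho) \o (c \o chart_inv d))).
      apply: filterS (near_chart_inv_set dy (chart_dom_nbhs cy)) => u du /=.
      by rewrite /h; case: pselect.
    apply: smooth_at_comp; first by have [] := transition_smooth (atlas_maximal ac) ad cy dy.
    by apply: smooth_at_compR => //; exact: smooth_at_flat.
  apply: (@smooth_at_near _ _ _ (cst (0 : R))); last exact: smooth_at_cst.
  have nQy : nbhs y (~` Q).
    apply: open_nbhs_nbhs; split; last by move=> /rA[cy _]; exact: ncy.
    by apply: closed_openC; apply: compact_closed => //; exact: mfd_hausdorff.
  by apply: filterS (near_chart_inv_set dy nQy) => u /= /hQ ->.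
- by move=> y; rewrite /h; case: pselect => // dy; exact: flat_ge0.
- rewrite /h; case: pselect => [cx'|/(_ cx)//]; rewrite flat_gt0 /rho big1 ?subr0 ?exprn_gt0//.
  by move=> k _; rewrite subrr mul0r.
- by move=> y nAy; apply: hQ => /rA[_ Ay]; exact: nAy.
Qed.

End Charts.

(** * Charts adapted to a regular function and to the flow *)

Section StraightCharts.
Variables (R : realType) (n : nat) (M : smooth_manifold R n).
Implicit Types (c d : chart R n M) (x y p : M).

(** The chart is [d] followed by [straighten], on the part of its domain that lies in [W] and is
    mapped into the region where the local inverse [eta] is available. *)
Lemma straight_chart (g : M -> R) d p (j : 'I_n) (W : set M) :
  msmooth g -> mfd_atlas d -> chart_dom d p -> ~ critical g d p -> nbhs p W ->
  exists c, [/\ maximal_atlas c, chart_dom c p, chart_dom c `<=` W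
    & forall q, chart_dom c q -> c q 0 j = g q].
Proof.
move=> sg ad dp ncr nW.
have [i dgi] : exists i, 'D_(delta_mx 0 i) (g \o chart_inv d) (d p) != 0.
  apply: contrapT => H; apply: ncr => i; apply/eqP; apply: contrapT => /negP ni.
  by apply: H; exists i.
have [B [eta [oB Bp sB [etaK oI s_eta]]]] := straighten_local j (sg p d ad dp) dgi.
set psi := straighten (g \o chart_inv d) i j in etaK oI s_eta.
pose A := chart_dom d `&` (interior W `&` chart_dom d `&` d @^-1` B).
have oA : open A.
  rewrite openE => q [dq [[Wq _] Bq]].
  have n1 : nbhs q (d @^-1` B).
    have nB : nbhs (d q) B by exact: open_nbhs_nbhs.
    exact: (chart_map_continuous dq nB).
  have n2 : nbhs q (interior W).
    by apply: open_nbhs_nbhs; split=> //; exact: open_interior.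
  have n3 := chart_dom_nbhs dq.
  exact: (filterI n3 (filterI (filterI n2 n3) n1)).
have psi_smooth u : B u -> smooth_at psi u.
  move=> Bu; apply/smooth_at_coord => k.
  rewrite (_ : (fun y : 'rV[R]_n => psi y 0 k) = (fun u : 'rV[R]_n =>
      if k == j then (g \o chart_inv d) u else u 0 (tperm i j k))); last first.
    by apply/funext => v; rewrite mxE.
  by case: eqP => _; [exact: sB|exact: smooth_at_coordinate].
have im q : A q -> (psi @` B) (psi (d q)).
  by move=> [_ [_ Bq]]; exists (d q).
have oim : open ((psi \o d) @` A).
  rewrite openE => _ [q Aq <-] /=; have [dq [[Wq _] Bq]] := Aq.
  have n1 : \forall w \near psi (d q), (psi @` B) w.
    by apply: open_nbhs_nbhs; split=> //; exact: im.
  have oDA : open (d @` A) by apply: chart_open_image => // y [].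
  have n2 : \forall w \near psi (d q), (d @` A) (eta w).
    have ce := smooth_at_continuous (s_eta _ (im _ Aq)).
    by apply: ce; rewrite etaK//; apply: open_nbhs_nbhs; split=> //; exists q.
  apply: filterS2 n1 n2 => w [u Bu <-]; rewrite etaK// => -[y Ay yu].
  by exists y => //=; rewrite yu.
have mapK q : A q -> (chart_inv d \o eta) ((psi \o d) q) = q.
  by move=> [dq [_ Bq]] /=; rewrite etaK// chart_mapK.
have mapc q : A q -> {for q, continuous (psi \o d)}.
  move=> [dq [_ Bq]]; apply: (continuous_comp (chart_map_continuous dq)).
  exact: (smooth_at_continuous (psi_smooth _ Bq)).
have invc q : A q -> {for (psi \o d) q, continuous (chart_inv d \o eta)}.
  move=> Aq; have [dq [_ Bq]] := Aq.
  apply: (continuous_comp (smooth_at_continuous (s_eta _ (im _ Aq)))).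
  by rewrite etaK//; exact: chart_inv_continuous.
pose c := Chart oA oim mapK mapc invc.
have cp : chart_dom c p.
  by split=> //; split=> //; split=> //; exact: nW.
exists c; split=> //; last 2 first.
- by move=> q [_ [[/interior_subset Wq _] _]].
- by move=> q [dq _]; rewrite /= mxE eqxx /= chart_mapK.
move=> e ae; split; apply: at_smooth_on => _ [q [Aq eq] <-].
  have [dq [_ Bq]] := Aq.
  have [s1 s2] := transition_smooth (atlas_maximal ad) ae dq eq.
  apply: (@smooth_at_comp_rV _ _ _ _ eta (e \o chart_inv d)).
    exact: s_eta (im _ Aq).
  by rewrite /= etaK.
have [dq [_ Bq]] := Aq.
have [s1 s2] := transition_smooth (atlas_maximal ae) ad eq dq.
apply: (@smooth_at_comp_rV _ _ _ _ (d \o chart_inv e) psi) => //=.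
by rewrite chart_mapK//; exact: psi_smooth.
Qed.

(* If [S] were a half-space in a chart, straightening [g] near [p] would produce
   zeros of [g] outside of that half-space. *)
Lemma level_no_boundary (g : M -> R) d p (S : set M) :
  msmooth g -> mfd_atlas d -> chart_dom d p -> ~ critical g d p ->
  (\forall q \near p, S q <-> g q = 0) -> S p -> ~ mfd_boundary_point n.-1 S p.
Proof.
move=> sg ad dp ncr Sg Sp [_ [n0 [c [mc cp cS c0]]]].
have ncr' : ~ critical g c p.
  by move=> /(critical_chart sg mc ad cp dp).
have n1 : (0 < n)%N by case: n n0 {c mc cp cS c0 ncr'} => //.
have nn : (n.-1 < n)%N by rewrite prednK.
pose i0 := Ordinal n1; pose il := Ordinal nn.
have i0l : i0 != il by rewrite -val_eqE /= neq_ltn n0.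
have il_eq (i : 'I_n) : (n.-1 <= i)%N -> i = il.
  move=> ni; apply: val_inj => /=; apply/eqP; rewrite eqn_leq ni andbT.
  by rewrite -ltnS prednK.
set b := c p in c0; set q := g \o chart_inv c.
have bl : b 0 il = 0.
  by have [/(_ Sp)[+ _] _] := cS _ cp; apply => /=.
have nE : \forall u \near b, model_half_space n.-1 u <-> q u = 0.
  apply: filterS2 (near_chart_inv cp) (near_chart_inv_set cp Sg) => u [du uE] Su.
  by rewrite /q /= -Su (cS _ du) uE.
have qb : q b = 0.
  by have [+ _] := nbhs_singleton nE; apply; have [+ _] := cS _ cp; exact.
have sq : smooth_at q b by exact: msmooth_maximal.
have line (v : 'rV[R]_n) : (fun h : R => h *: v + b) @ (0 : R)^'+ --> b.
  have c1 : {for 0, continuous (fun h : R => h *: v + b)}.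
    exact: (cvgD (@scalel_continuous _ _ v 0) (cvg_cst b)).
  move/continuous_withinNx: c1; rewrite scale0r add0r => c1.
  exact: cvg_dnbhs_at_right c1.
(* For [h > 0] the point [h *: delta_mx 0 j + b] stays in the half-space, where [q] vanishes. So the
   one-sided derivative is 0, and only the last partial derivative can survive. *)
have partial (j : 'I_n) : j != il -> 'D_(delta_mx 0 j) q b = 0.
  move=> jl; pose v : 'rV[R]_n := delta_mx 0 j.
  have /cvg_dnbhs_at_right cv : derivable q b v := smooth_at_derivable sq.
  suff c0' : (fun h : R => h^-1 *: ((q \o shift b) (h *: delta_mx 0 j) - q b)) @ (0 : R)^'+
      --> (0 : R) by exact: (cvg_unique _ cv c0').
  apply: (@cvg_trans _ ((fun _ : R => 0 : R) @ (0 : R)^'+)); last exact: cvg_cst.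
  apply: near_eq_cvg; near=> h.
  have h0 : 0 < h by near: h; exact: nbhs_right_gt.
  have Eh : model_half_space n.-1 (h *: delta_mx 0 j + b) <-> q (h *: delta_mx 0 j + b) = 0.
    by near: h; exact: (line (delta_mx 0 j) _ nE).
  rewrite /= Eh.1 ?qb ?subr0 ?scaler0//; split=> i ni.
    by rewrite (il_eq _ ni) !mxE /= eq_sym (negbTE jl) mulr0 add0r.
  by rewrite !mxE /= c0// addr0 mulr_ge0// ltW.
have dl : 'D_(delta_mx 0 il) q b != 0.
  apply/eqP => dl0; apply: ncr' => j; have [->//|] := eqVneq j il.
  exact: partial.
have [B [eta [oB Bb _ [etaK oI s_eta]]]] := straighten_local il sq dl.
set psi := straighten q il il in etaK oI s_eta.
have psiE u l : psi u 0 l = if l == il then q u else u 0 l.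
  by rewrite mxE tperm1 perm1.
have psib : psi b = b.
  by apply/rowP => l; rewrite psiE; case: eqP => // ->; rewrite qb bl.
have Ib : (psi @` B) b by exists b.
have n2 : \forall w \near b, (psi @` B) w.
  exact: (open_nbhs_nbhs (conj oI Ib)).
have n3 : \forall w \near b, model_half_space n.-1 (eta w) <-> q (eta w) = 0.
  have etab : eta b = b by rewrite -{1}psib etaK.
  have ce : eta @ b --> eta b := smooth_at_continuous (s_eta _ Ib).
  by rewrite etab in ce; exact: (ce _ nE).
(* Move out of the half-space by [h] along the first axis in the straightened coordinates. The last
   coordinate stays 0, so the preimage [u] is a zero of [q], yet its first coordinate is [- h]. *)
near (0 : R)^'+ => h.
have h0 : 0 < h by near: h; exact: nbhs_right_gt.
have [u Bu uw] : (psi @` B) (h *: - delta_mx 0 i0 + b).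
  by near: h; exact: (line (- delta_mx 0 i0) _ n2).
have : model_half_space n.-1 (eta (h *: - delta_mx 0 i0 + b)) <->
    q (eta (h *: - delta_mx 0 i0 + b)) = 0.
  by near: h; exact: (line (- delta_mx 0 i0) _ n3).
rewrite -uw etaK// => H.
have qu : q u = 0.
  have := psiE u il; rewrite eqxx uw => <-.
  by rewrite !mxE /= eq_sym (negbTE i0l) oppr0 mulr0 add0r.
have [_ /(_ i0 erefl)] := H.2 qu.
have := psiE u i0; rewrite (negbTE i0l) uw => <-.
by rewrite !mxE /= c0// addr0 mulrN mulr1 oppr_ge0 leNgt h0.
Unshelve. all: by end_near. Qed.

(** The parameter 0 is an endpoint of its interval, so differentiation is done on a smooth extension
    [G] to a full neighborhood, which agrees with the flow where the flow is meaningful. *)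
Lemma flow_in_charts (phi : R -> M -> R -> M) c d x t0 : smooth_flow_family phi ->
  mfd_atlas c -> mfd_atlas d -> chart_dom c x -> chart_dom d (phi 0 x t0) ->
  exists G : 'rV[R]_n * R * R -> 'rV[R]_n, smooth_at G (c x, t0, 0) /\
    \forall z \near (c x, t0, 0 : R), 0 <= z.2 <= 1 ->
      chart_dom d (phi z.2 (chart_inv c z.1.1) z.1.2) /\
      G z = d (phi z.2 (chart_inv c z.1.1) z.1.2).
Proof.
move=> [fl J sm] ac ad cx dx.
have fam : flow_family phi by split.
have z01 : 0 <= (0 : R) <= 1 by rewrite lexx ler01.
set A := [set z : 'rV[R]_n * R * R |
            [/\ chart_im c z.1.1, 0 <= z.2 <= 1
              & chart_dom d (phi z.2 (chart_inv c z.1.1) z.1.2)]].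
have Az : A (c x, t0, 0).
  by split=> //=; [exists x|rewrite chart_mapK].
have [U [F [oU Ux CF FE]]] := sm c d ac ad _ Az.
exists F; split; first by exists U.
have c11 : (fun z : 'rV[R]_n * R * R => z.1.1) @ (c x, t0, 0 : R) --> c x.
  by apply: (cvg_comp _ _ cvg_fst cvg_fst).
have n1 : \forall z \near (c x, t0, 0 : R), (c @` chart_dom c) z.1.1.
  apply: c11; apply: open_nbhs_nbhs; split; first exact: chart_im_open.
  by exists x.
have n2 : \forall z \near (c x, t0, 0 : R), 0 <= z.2 <= 1 ->
   chart_dom d (phi z.2 (chart_inv c z.1.1) z.1.2).
  have H := family_near fam z01 (chart_dom_open d) dx.
  have c12 : (fun z : 'rV[R]_n * R * R => z.1.2) @ (c x, t0, 0 : R) --> t0.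
    by apply: (cvg_comp _ _ cvg_fst cvg_snd).
  have ci : (fun z : 'rV[R]_n * R * R => chart_inv c z.1.1) @ (c x, t0, 0 : R) --> x.
    by move=> B nB; exact: (c11 _ (near_chart_inv_set cx nB)).
  have c2 : (fun z : 'rV[R]_n * R * R => z.2) @ (c x, t0, 0 : R) --> (0 : R).
    exact: cvg_snd.
  have cc : (fun z : 'rV[R]_n * R * R => (chart_inv c z.1.1, z.1.2, z.2)) @
      (c x, t0, 0 : R) --> (x, t0, 0 : R) by exact: (cvg_pair (cvg_pair ci c12) c2).
  exact: (cc _ H).
have n3 := open_nbhs_nbhs (conj oU Ux).
near=> z => z01'.
have Uz : U z by near: z; exact: n3.
have dz : chart_dom d (phi z.2 (chart_inv c z.1.1) z.1.2).
  by move: z01'; near: z; exact: n2.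
split=> //; apply: FE => //; split=> //.
by near: z; exact: n1.
Unshelve. all: by end_near. Qed.

End StraightCharts.

(** * Transverse hypersurfaces *)

Section FlowSmooth.
Variables (R : realType) (n : nat) (M : smooth_manifold R n).
Variable phi : R -> M -> R -> M.
Hypothesis phi_smooth : smooth_flow_family phi.
Implicit Types (c d : chart R n M) (x y p : M) (h g : M -> R).

Let z01 : 0 <= (0 : R) <= 1. Proof. by rewrite lexx ler01. Qed.

Lemma smooth_flow_family_is : flow_family phi.
Proof. by have [fl J _] := phi_smooth; split. Qed.

Let fl0 : is_flow (phi 0).
Proof. by have [fl _ _] := phi_smooth; exact: fl. Qed.
Let f00 x : phi 0 x 0 = x. Proof. by have [_ + _] := fl0; exact. Qed.
Let f0D x s t : phi 0 (phi 0 x s) t = phi 0 x (s + t).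
Proof. by have [_ _] := fl0; exact. Qed.

Lemma msmooth_flow h c x t0 : msmooth h -> mfd_atlas c -> chart_dom c x ->
  exists F : 'rV[R]_n * R * R -> R, smooth_at F (c x, t0, 0) /\
    \forall z \near (c x, t0, 0 : R), 0 <= z.2 <= 1 ->
      F z = h (phi z.2 (chart_inv c z.1.1) z.1.2).
Proof.
move=> sh ac cx; have [d ad dx] := mfd_atlas_cover (phi 0 x t0).
have [G [sG GE]] := flow_in_charts phi_smooth ac ad cx dx.
exists ((h \o chart_inv d) \o G); split.
  apply: smooth_at_comp => //.
  have [_ ->] := nbhs_singleton GE z01; rewrite /= chart_mapK//.
  exact: sh.
apply: filterS GE => z H /H [dz /= ->].
by rewrite chart_mapK.
Qed.

Lemma msmooth_flow0 h c x t0 : msmooth h -> mfd_atlas c -> chart_dom c x ->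
  smooth_at (fun z : 'rV[R]_n * R => h (phi 0 (chart_inv c z.1) z.2)) (c x, t0).
Proof.
move=> sh ac cx; have [F [sF FE]] := msmooth_flow t0 sh ac cx.
pose i (z : 'rV[R]_n * R) : 'rV[R]_n * R * R := (z, 0).
have ci : continuous i.
  by move=> z; exact: (cvg_pair cvg_id (cvg_cst _)).
apply: (@smooth_at_near _ _ _ (F \o i)).
  have H : \forall z \near (c x, t0), 0 <= (0 : R) <= 1 ->
      F (z, 0) = h (phi 0 (chart_inv c z.1) z.2) := ci (c x, t0) _ FE.
  by apply: filterS H => z /(_ z01).
apply: (@smooth_at_affine_comp _ _ _ _ F i (fun v => (v, 0))) => //.
move=> z v a; apply/pair_equal_spec; split=> //=.
by rewrite scaler0 addr0.
Qed.

Lemma orbit_smooth h x k : msmooth h -> Ck k setT (fun t => h (phi 0 x t)).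
Proof.
move=> sh; have [c ac cx] := mfd_atlas_cover x.
apply: smooth_at_Ck => t _.
pose i (t : R) : 'rV[R]_n * R := (c x, t).
have := @smooth_at_affine_comp _ _ _ _ (fun z : 'rV[R]_n * R => h (phi 0 (chart_inv c z.1) z.2))
  i (fun v => (0, v)) t _ _ (msmooth_flow0 t sh ac cx).
rewrite /comp /= chart_mapK//; apply.
- by move=> s; exact: (cvg_pair (cvg_cst _) cvg_id).
- by move=> s v a; apply/pair_equal_spec; split=> //=; rewrite scaler0 add0r.
Qed.

Definition lyapunov (T : R) h x : R := exp_int T (fun t => h (phi 0 x t)).

Lemma lyapunov_smooth T h : 0 <= T -> msmooth h -> msmooth (lyapunov T h).
Proof.
move=> T0 sh x c ac cx; exists (c @` chart_dom c); split; [exact: chart_im_open|by exists x|move=> k].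
apply: (Ck_exp_int T0 (F := fun z => h (phi 0 (chart_inv c z.1) z.2))).
  exact: chart_im_open.
apply: smooth_at_Ck => -[u t] [y dy /= <-].
exact: msmooth_flow0.
Qed.

Lemma is_derive_lyapunov T h x (t : R) : 0 < T -> msmooth h ->
  is_derive t 1 (fun t => lyapunov T h (phi 0 x t))
    (expR T * h (phi 0 x (t + T)) - h (phi 0 x t) - lyapunov T h (phi 0 x t)).
Proof.
move=> T0 sh.
have E s : lyapunov T h (phi 0 x s) = exp_int T (fun r => h (phi 0 x (s + r))).
  by congr (exp_int T _); apply/funext => r; rewrite f0D.
rewrite E (_ : (fun t => _) = (fun s => exp_int T (fun r => h (phi 0 x (s + r))))).
  exact: is_derive_exp_int_shift T0 (orbit_smooth x 2 sh).
by apply/funext => s; rewrite E.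
Qed.

Lemma noncritical g d p : msmooth g -> mfd_atlas d -> chart_dom d p ->
  'D_1 (fun t => g (phi 0 p t)) 0 != 0 -> ~ critical g d p.
Proof.
move=> sg ad dp; apply: contra_neq_not => crit.
have dp0 : chart_dom d (phi 0 p 0) by rewrite f00.
have [G [sG GE]] := flow_in_charts phi_smooth ad ad dp dp0.
pose i (t : R) : 'rV[R]_n * R * R := (d p, t, 0).
have ci : continuous i.
  by move=> s; exact: (cvg_pair (cvg_pair (cvg_cst _) cvg_id) (cvg_cst _)).
have sGi : smooth_at (G \o i) (0 : R).
  apply: (@smooth_at_affine_comp _ _ _ _ G i (fun v => (0, v, 0))) => //.
  move=> s v a; apply/pair_equal_spec; split=> /=; last by rewrite scaler0 addr0.
  by apply/pair_equal_spec; split=> //=; rewrite scaler0 add0r.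
have E : \forall t \near (0 : R), ((g \o chart_inv d) \o (G \o i)) t = g (phi 0 p t).
  have H : \forall t \near (0 : R), 0 <= (0 : R) <= 1 ->
      chart_dom d (phi 0 (chart_inv d (d p)) t) /\
      G (i t) = d (phi 0 (chart_inv d (d p)) t) := ci 0 _ GE.
  apply: filterS H => t /(_ z01) [dt /= ->].
  by rewrite chart_mapK//= chart_mapK.
have Gi0 : (G \o i) 0 = d p.
  by have [_ /= ->] := nbhs_singleton GE z01; rewrite chart_mapK// f00.
have [U [oU Ux CU]] := sg p d ad dp.
rewrite -(near_eq_derive _ E).
have [||_ ->] := @derive_comp_rV _ _ _ (G \o i) (g \o chart_inv d) U 0 1 oU (CU 1%N).
- by rewrite Gi0.
- exact: smooth_at_derivable.
by rewrite big1// => k _; rewrite Gi0 crit mulr0.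
Qed.

(** The derivative in time is continuous in point, time and parameter jointly, hence positive on a
    whole ball around the base point; its radius is a time [r] common to all nearby points and
    parameters. *)
Lemma increasing_near g p : msmooth g -> 0 < 'D_1 (fun t => g (phi 0 p t)) 0 ->
  exists2 r : R, 0 < r & \forall z \near ((p, 0) : M * R), 0 <= z.2 <= 1 ->
    forall t, 0 < t < r -> g (phi z.2 z.1 (- t)) < g z.1 < g (phi z.2 z.1 t).
Proof.
move=> sg dg; have [c ac cp] := mfd_atlas_cover p.
have [F [sF FE]] := msmooth_flow 0 sg ac cp.
pose w : 'rV[R]_n * R * R := (0, 1, 0).
set z0 : 'rV[R]_n * R * R := (c p, 0, 0) in sF FE.
have DF0 : 'D_w F z0 = 'D_1 (fun t => g (phi 0 p t)) 0.
  pose i (t : R) : 'rV[R]_n * R * R := (c p, t, 0).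
  have ci : continuous i.
    by move=> s; exact: (cvg_pair (cvg_pair (cvg_cst _) cvg_id) (cvg_cst _)).
  have H : \forall t \near (0 : R), 0 <= (0 : R) <= 1 ->
      F (i t) = g (phi 0 (chart_inv c (c p)) t) := ci 0 _ FE.
  have E : \forall t \near (0 : R), (F \o i) t = g (phi 0 p t).
    by apply: filterS H => t /(_ z01) /= ->; rewrite chart_mapK.
  rewrite -(near_eq_derive _ E) /derive.
  have -> // : (fun h : R => h^-1 *: ((F \o shift z0) (h *: w) - F z0)) =
      (fun e => e^-1 *: (((F \o i) \o shift 0) (e *: 1) - (F \o i) 0)).
  apply/funext => e /=; congr (_ *: (F _ - _)).
  apply/pair_equal_spec; split=> /=; last by rewrite scaler0 addr0.
  by apply/pair_equal_spec; split=> //=; rewrite scaler0 add0r.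
have n1 : \forall z \near z0, smooth_at F z /\ 0 < 'D_w F z /\
    (0 <= z.2 <= 1 -> F z = g (phi z.2 (chart_inv c z.1.1) z.1.2)).
  have nD : \forall z \near z0, 0 < 'D_w F z.
    have cD := smooth_at_continuous (smooth_at_derive w sF).
    by apply: (cvgr_gt _ cD); rewrite DF0.
  by apply: filterS3 (smooth_at_nbhs sF) nD FE => z.
move: n1 => /nbhs_ballP[r /= r0 rP]; exists r => //.
have n2 : \forall z \near ((p, 0) : M * R), chart_dom c z.1 /\
    ball (c p) r (c z.1) /\ `|z.2| < r.
  have nq : \forall q \near p, chart_dom c q /\ ball (c p) r (c q).
    have nb : nbhs (c p) (ball (c p) r) by exact: nbhsx_ballx.
    by apply: filterS2 (chart_dom_nbhs cp) (chart_map_continuous cp nb) => q.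
  have nl : \forall l \near (0 : R), `|l| < r.
    by exists r => //= l; rewrite /ball_/= sub0r normrN.
  by exists ([set q | chart_dom c q /\ ball (c p) r (c q)], [set l | `|l| < r]) => //= -[q l] /= [[]].
apply: filterS n2 => -[q l] /= [cq [bq lr]] l01 t /andP[t0 tr].
have in_ball (s : R) : `|s| < r -> ball z0 r (c q, s, l).
  have bR (e : R) : `|e| < r -> ball (0 : R) r e.
    by move=> er; rewrite -ball_normE /ball_/= sub0r normrN.
  by move=> sr; split; [split|] => //=; exact: bR.
have FEs (s : R) : `|s| < r -> F (c q, s, l) = g (phi l q s).
  by move=> /in_ball/rP[_ [_ /(_ l01) ->]] /=; rewrite chart_mapK.
have fl : is_flow (phi l) by have [H _ _] := phi_smooth; exact: H.
have [_ fl0' _] := fl.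
(* Both halves of the claim are cases of one inequality, for [s = - t] and for [s = 0]. *)
have lt (s : R) : - t <= s <= 0 -> g (phi l q s) < g (phi l q (s + t)).
  move=> /andP[s1 s2].
  have inr (u : R) : 0 <= u <= 1 -> `|u * t + s| < r.
    move=> /andP[u0 u1]; rewrite ltr_norml; apply/andP; split.
      rewrite (lt_le_trans (y := - t)) ?ltrN2// (le_trans s1)// lerDr.
      by rewrite mulr_ge0// ltW.
    rewrite (le_lt_trans _ tr)// -[leRHS]addr0 lerD// ler_piMl// ltW//.
  have E (u : R) : u *: (t *: w) + (c q, s, l) = (c q, u * t + s, l).
    rewrite scalerA; apply/pair_equal_spec; split=> /=; last by rewrite scaler0 add0r.
    by apply/pair_equal_spec; split=> /=; rewrite ?scaler0 ?add0r// [_ *: 1]mulr1.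
  have sFu (u : R) : 0 <= u <= 1 -> smooth_at F (u *: (t *: w) + (c q, s, l)) /\
      0 < 'D_w F (u *: (t *: w) + (c q, s, l)).
    by move=> /inr/in_ball/rP; rewrite E => -[sz [dz _]].
  have dF (u : R) : 0 <= u <= 1 -> derivable F (u *: (t *: w) + (c q, s, l)) w.
    by move=> /sFu[sz _]; exact: smooth_at_derivable.
  have [u /dF d1|u u01] := @MVT_line _ _ F (c q, s, l) (t *: w).
    by have [] := derivable_scale t d1.
  have [_ ->] := derivable_scale t (dF _ u01).
  have E1 : t *: w + (c q, s, l) = (c q, t + s, l) by rewrite -[t *: w]scale1r E mul1r.
  have r1 : `|t + s| < r by have := inr 1; rewrite mul1r; apply; rewrite ler01 lexx.
  have r2 : `|s| < r by have := inr 0; rewrite mul0r add0r; apply; rewrite ler01 lexx.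
  rewrite E1 !FEs// => D; rewrite -subr_gt0 [s + t]addrC D.
  by rewrite mulr_gt0//; have [] := sFu _ u01.
apply/andP; split.
  have := lt (- t); rewrite addNr fl0'; apply.
  by rewrite lexx oppr_le0 ltW.
have := lt 0; rewrite add0r fl0'; apply.
by rewrite oppr_le0 lexx ltW.
Qed.

End FlowSmooth.

(** * Transverse entrance sets and their persistence *)

Section Entering.
Variables (R : realType) (n : nat) (M : smooth_manifold R n).
Implicit Types (phi : R -> M -> R -> M) (c d : chart R n M) (p q : M).

Lemma rev_smooth_family phi : smooth_flow_family phi ->
  smooth_flow_family (fun l => rflow (phi l)).
Proof.
move=> sm; have [fl J S] := sm.
have [fl' J'] := rev_family (smooth_flow_family_is sm).
split=> // c d ac ad z Az.
pose i (z : 'rV[R]_n * R * R) : 'rV[R]_n * R * R := (z.1.1, - z.1.2, z.2).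
have ci : continuous i.
  move=> u.
  have c11 : (fun z : 'rV[R]_n * R * R => z.1.1) @ u --> u.1.1.
    by apply: (cvg_comp _ _ cvg_fst cvg_fst).
  have c12 : (fun z : 'rV[R]_n * R * R => - z.1.2) @ u --> - u.1.2.
    by apply: cvgN; apply: (cvg_comp _ _ cvg_fst cvg_snd).
  exact: (cvg_pair (cvg_pair c11 c12) cvg_snd).
have iL (u v : 'rV[R]_n * R * R) (a : R) : i (a *: v + u) = a *: i v + i u.
  apply/pair_equal_spec; split=> //=.
  by apply/pair_equal_spec; split=> //=; rewrite opprD scalerN.
have [U [F [oU Ux CF FE]]] := S c d ac ad (i z) Az.
exists (i @^-1` U), (F \o i); split=> //.
- by apply: open_comp => // u _; exact: ci.
- by move=> k; exact: (Ck_affine_comp ci iL (CF k)).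
- by move=> y Uy Ay; exact: FE.
Qed.

(* Transversality is required for the parameter 0 only: being an open condition, it
   persists for small parameters. *)
Definition entering phi (N S : set M) p : Prop := exists (g : M -> R) (W : set M),
  [/\ msmooth g, nbhs p W,
    forall q, W q -> (N q <-> 0 <= g q) /\ (S q <-> g q = 0)
  & 0 < 'D_1 (fun t => g (phi 0 p t)) 0].

(** The neighborhoods in [q] and in [l] are independent of each other, which is the form that
    compactness of the entrance set takes up in [block_family]. Only the time [e] may vary with the
    point. *)
Lemma entering_near phi (N S : set M) p : smooth_flow_family phi ->
  entering phi N S p ->
  \forall q \near p & l \near (0 : R), 0 <= l <= 1 -> S q ->
    exists2 e : R, 0 < e & forall t, 0 < t <= e ->
      ~ N (phi l q (- t)) /\ interior N (phi l q t).
Proof.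
move=> sm [g [W [sg nW WNS dg]]].
have fam := smooth_flow_family_is sm.
have z01 : 0 <= (0 : R) <= 1 by rewrite lexx ler01.
have [_ f00 _] := fam.1 _ z01.
have [r r0 inc] := increasing_near sm sg dg.
have Wp : interior W (phi 0 p 0) by rewrite f00; exact: nW.
have [[P B] /= [[[A1 A2] /= [nA1 nA2] A12] nB] PB] :=
  family_near fam z01 (@open_interior _ W) Wp.
move: nA2 => [dl /= dl0 dlP].
have [[P' B'] /= [nP' nB'] incB] := inc.
exists (A1 `&` W `&` P', B `&` B') => /=.
  by split; apply: filterI => //; apply: filterI.
move=> [q l] /= [[[A1q Wq] P'q] [Bl B'l]] l01 Sq.
have gq : g q = 0 by have [_ [+ _]] := WNS _ Wq; exact.
(* [r] bounds the times at which [g] is known to increase, [dl] those at which the orbit stays in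
   [W]. Both bounds are strict while [t <= e] is not, hence the half. *)
have e0 : 0 < Num.min r dl / 2 by rewrite divr_gt0// lt_min r0.
have er : Num.min r dl / 2 < r.
  by rewrite ltr_pdivrMr// (@le_lt_trans _ _ r) ?ge_min ?lexx// ltr_pMr// ltr1n.
have edl : Num.min r dl / 2 < dl.
  by rewrite ltr_pdivrMr// (@le_lt_trans _ _ dl) ?ge_min ?lexx ?orbT// ltr_pMr// ltr1n.
exists (Num.min r dl / 2) => // t /andP[t0 te].
have inW (s : R) : `|s| < dl -> interior W (phi l q s).
  move=> sd; apply: (PB (q, s, l)) => //; split=> //=; apply: A12; split=> //=.
  by apply: dlP; rewrite /ball_/= sub0r normrN.
have tdl : `|t| < dl by rewrite gtr0_norm// (le_lt_trans te).
have := incB (q, l) (conj P'q B'l) l01 t; rewrite /= gq t0 (le_lt_trans te)// => /(_ isT)/andP[g1 g2].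
split.
  have /interior_subset/WNS[[+ _] _] : interior W (phi l q (- t)) by apply: inW; rewrite normrN.
  by move=> H /H; rewrite leNgt g1.
have cg := msmooth_continuous sg.
have n1 : \forall y \near phi l q t, 0 < g y by exact: (cvgr_gt _ (cg _)).
have n2 : nbhs (phi l q t) W by exact: inW.
by apply: filterS2 n1 n2 => y gy /WNS[[_ +] _]; apply; exact: ltW.
Qed.

(** Compactness of [Ni] and [No] turns the local bounds on the parameter into a single one; the sets
    themselves do not move with [l]. *)
Lemma block_family phi (N Ni No : set M) : smooth_flow_family phi ->
  compact Ni -> compact No -> frontier N = Ni `|` No ->
  (forall p, Ni p -> entering phi N Ni p) ->
  (forall p, No p -> entering (fun l => rflow (phi l)) N No p) ->
  \forall l \near (0 : R), 0 <= l <= 1 -> block_sets (phi l) N Ni No.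
Proof.
move=> sm cNi cNo FE eNi eNo.
have sm' := rev_smooth_family sm.
have /compact_near_coveringP/(_ R (nbhs (0 : R)) (fun l q => 0 <= l <= 1 -> Ni q ->
    exists2 e : R, 0 < e & forall t, 0 < t <= e ->
      ~ N (phi l q (- t)) /\ interior N (phi l q t)) _) := cNi.
have /compact_near_coveringP/(_ R (nbhs (0 : R)) (fun l q => 0 <= l <= 1 -> No q ->
    exists2 e : R, 0 < e & forall t, 0 < t <= e ->
      ~ N (rflow (phi l) q (- t)) /\ interior N (rflow (phi l) q t)) _) := cNo.
move=> cov2 cov1.
apply: filterS2 (cov1 _) (cov2 _) => [l H1 H2 l01|q Niq|q Noq].
- have {}H1 q : Ni q -> exists2 e : R, 0 < e & forall t, 0 < t <= e ->
      ~ N (phi l q (- t)) /\ interior N (phi l q t) by move=> Niq; exact: H1.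
  have {}H2 q : No q -> exists2 e : R, 0 < e & forall t, 0 < t <= e ->
      ~ N (phi l q t) /\ interior N (phi l q (- t)).
    by move=> Noq; have [e e0 H] := H2 _ Noq l01 Noq; exists e => // t /H; rewrite /rflow opprK.
  have flip (e t : R) : - e <= t < 0 -> 0 < - t <= e by rewrite oppr_gt0 lerNl andbC.
  split.
  + by split.
  + by move=> q /H1[e e0 H]; exists e => // t /flip/H[]; rewrite opprK.
  + by move=> q /H2[e e0 H]; exists e => // t /H[].
  + move=> q; rewrite FE => -[//|/H2[e e0 H] _]; exists e => // t /flip/H[_].
    by rewrite opprK.
  + by move=> q; rewrite FE => -[/H1[e e0 H] _|//]; exists e => // t /H[].
- exact: (entering_near sm (eNi _ Niq)).
- exact: (entering_near sm' (eNo _ Noq)).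
Qed.

Lemma restrict_chart d p (W : set M) : mfd_atlas d -> chart_dom d p -> nbhs p W ->
  exists c, [/\ maximal_atlas c, chart_dom c p & chart_dom c `<=` W].
Proof.
move=> ad dp nW.
pose A := chart_dom d `&` interior W.
have oA : open A by apply: openI; [exact: chart_dom_open|exact: open_interior].
have oim : open (d @` A) by apply: chart_open_image => // y [].
have mapK q : A q -> chart_inv d (d q) = q by move=> [dq _]; exact: chart_mapK.
have mapc q : A q -> {for q, continuous d} by move=> [dq _]; exact: chart_map_continuous.
have invc q : A q -> {for d q, continuous (chart_inv d)}.
  by move=> [dq _]; exact: chart_inv_continuous.
pose c := Chart oA oim mapK mapc invc.
exists c; split; [|by split|by move=> q [_ /interior_subset]].
move=> e ae; split; apply: at_smooth_on => _ [q [[dq _] eq] <-] /=.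
  by have [] := transition_smooth (atlas_maximal ad) ae dq eq.
by have [] := transition_smooth (atlas_maximal ae) ad eq dq.
Qed.

Lemma interior_point_of_interior (N : set M) p : interior N p -> mfd_interior_point n N p.
Proof.
move=> iN; split; first exact: interior_subset.
have [d ad dp] := mfd_atlas_cover p.
have [c [mc cp cN]] := restrict_chart ad dp iN.
exists c; split=> // q /cN Nq; split=> // _ i ni.
by have := ltn_ord i; rewrite ltnNge ni.
Qed.

(** The function [g] describes both sets: taken as first coordinate it makes [N] a half-space, taken
    as last coordinate it makes [S] a hyperplane. *)
Lemma entering_submanifold phi (N S : set M) p : smooth_flow_family phi ->
  entering phi N S p -> S p ->
  [/\ mfd_boundary_point n N p, mfd_interior_point n.-1 S p
    & ~ mfd_boundary_point n.-1 S p].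
Proof.
move=> sm [g [W [sg nW WNS dg]]] Sp.
have [d ad dp] := mfd_atlas_cover p.
have ncr : ~ critical g d p.
  by apply: (noncritical sm sg ad dp); rewrite gt_eqF.
(* In dimension 0 every function is critical. *)
have n0 : (0 < n)%N.
  rewrite lt0n; apply/negP => /eqP n0; apply: ncr => i.
  by have := ltn_ord i; rewrite [X in (_ < X)%N]n0.
have nn : (n.-1 < n)%N by rewrite prednK.
have [WNp [gp _]] := WNS _ (nbhs_singleton nW); have {}gp := gp Sp.
split.
- split; first by apply/WNp; rewrite gp.
  split=> //; have [c [mc cp cW cg]] := straight_chart (Ordinal n0) sg ad dp ncr nW.
  exists c; split=> // [q cq|i i0].
    have [-> _] := WNS _ (cW _ cq); rewrite -(cg _ cq); split.
      move=> g0; split=> [i ni|i i0]; first by have := ltn_ord i; rewrite ltnNge ni.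
      by rewrite (_ : i = Ordinal n0)//; exact: val_inj.
    by move=> [_ /(_ (Ordinal n0))]; apply.
  by rewrite (_ : i = Ordinal n0) ?cg//; exact: val_inj.
- split=> //; have [c [mc cp cW cg]] := straight_chart (Ordinal nn) sg ad dp ncr nW.
  exists c; split=> // q cq; have [_ ->] := WNS _ (cW _ cq); rewrite -(cg _ cq); split.
    move=> g0 i ni; rewrite (_ : i = Ordinal nn)//; apply: val_inj => /=.
    by apply/eqP; rewrite eqn_leq ni andbT -ltnS prednK.
  by move/(_ (Ordinal nn)); apply.
- apply: (level_no_boundary sg ad dp ncr _ Sp).
  by apply: filterS nW => q /WNS[].
Qed.

End Entering.

(** * A smooth block of a non-saddle set *)

Section Construct.
Variables (R : realType) (n : nat) (M : smooth_manifold R n).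
Let hM : hausdorff_space M := @mfd_hausdorff _ _ M.
Implicit Types (psi : M -> R -> M) (phi : R -> M -> R -> M) (K N U : set M).

(** Components of [N] are closed, and by [attract] a trapped orbit cannot stay in a closed set
    disjoint from [K]. So each component meets the connected set [K]. *)
Lemma block_connected psi N K : is_flow psi -> isolates psi N K -> connected K ->
  K !=set0 -> (forall x, N x -> fwd psi N x \/ fwd (rflow psi) N x) -> connected N.
Proof.
move=> fl iso Kc [k Kk] fb; have [cN KN _ _ _] := iso.
have clN := compact_closed hM cN.
have Nk : N k by exact: (interior_subset (KN _ Kk)).
have meet (ps : M -> R -> M) x : is_flow ps -> isolates ps N K -> N x -> fwd ps N x ->
    connected_component N k x.
  move=> flp isop Nx fx; have [_ f0 _] := flp.
  pose C := connected_component N x.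
  have [y [Cy Ky]] : C `&` K !=set0.
    apply/set0P/eqP => CK.
    have [||T T0 TP] := attract (O := ~` C) hM flp isop.
    - by apply: closed_openC; exact: component_closed.
    - by move=> y Ky Cy; have : (C `&` K) y by []; rewrite CK.
    have : (~` C) (ps x T) by exact: TP.
    apply; apply: (connected_component_max (B := ps x @` `[0, T])).
    - by exists 0; rewrite ?f0//= in_itv/= lexx.
    - by move=> _ [t +] <-; rewrite /= in_itv/= => /andP[t0 _]; exact: fx.
    - apply: connected_continuous_connected; first exact: segment_connected.
      apply: continuous_subspaceT; exact: (flow_continuous_time flp).
    - by exists T; rewrite //= in_itv/= lexx T0.
  apply: (connected_component_trans (y := y)); last exact: connected_component_sym.
  apply: (connected_component_max (B := K)) => //.
  by move=> z /KN/interior_subset.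
have -> : N = connected_component N k; last exact: component_connected.
apply/seteqP; split; last exact: connected_component_sub.
move=> x Nx; have [fx|bx] := fb x Nx; first exact: (meet psi).
by apply: (meet (rflow psi)) => //; [exact: rev_flow|exact: rev_isolates].
Qed.

Lemma compact_pos_lower (Q : set M) (H : M -> R) : compact Q -> continuous H ->
  (forall x, Q x -> 0 < H x) ->
  \forall c \near 0^'+, forall x, Q x -> c < H x.
Proof.
move=> cQ cH Hp.
have /compact_near_coveringP/(_ R (0^'+) (fun c x => c < H x) _) := cQ.
apply=> x /Hp Hx.
have h2 : 0 < H x / 2 by rewrite divr_gt0.
exists ([set y | H x / 2 < H y], [set c | c < H x / 2]) => /=.
  split; last exact: nbhs_right_lt.
  apply: (cvgr_gt _ (cH x)).
  by rewrite ltr_pdivrMr// ltr_pMr// ltr1n.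
by move=> [y c] /= [Hy cx]; exact: lt_trans Hy.
Qed.

(** A finite sum of bumps. The finite choice uses the filter of families containing all admissible
    functions above a given one; by nonnegativity a sum lies above both summands. *)
Lemma smooth_separation (B Q : set M) : closed B -> compact Q -> Q `&` B = set0 ->
  exists h : M -> R, [/\ msmooth h, forall x, 0 <= h x,
    forall x, B x -> h x = 0 & forall x, Q x -> 0 < h x].
Proof.
move=> clB cQ QB.
pose good (h : M -> R) := [/\ msmooth h, forall x, 0 <= h x & forall x, B x -> h x = 0].
pose F : set_system (M -> R) := [set P | exists2 h0, good h0 &
  forall h, good h -> (forall x, h0 x <= h x) -> P h].
have FF : Filter F.
  split.
  - exists (cst 0) => //; split=> // x c ac cx; exact: smooth_at_cst.
  - move=> P1 P2 [h1 [s1 p1 b1] H1] [h2 [s2 p2 b2] H2].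
    exists (fun x => h1 x + h2 x).
      split=> [x c ac cx|x|x Bx].
      + by apply: smooth_at_add; [exact: s1|exact: s2].
      + by rewrite addr_ge0.
      + by rewrite b1// b2// addr0.
    move=> h gh hh; split.
      by apply: H1 => // x; rewrite (le_trans _ (hh x))// lerDl.
    by apply: H2 => // x; rewrite (le_trans _ (hh x))// lerDr.
  - by move=> P1 P2 PP [h0 g0 H0]; exists h0 => // h gh hh; apply/PP/H0.
have /compact_near_coveringP/(_ (M -> R) F (fun h x => 0 < h x) FF) := cQ.
move=> cov; have : \forall h \near F, Q `<=` (fun x => 0 < h x).
  apply: cov => x Qx.
  have nB : nbhs x (~` B).
    apply: open_nbhs_nbhs; split; first exact: closed_openC.
    by move=> Bx; have : (Q `&` B) x by []; rewrite QB.
  have [h [sh h0 hx hB]] := smooth_bump nB.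
  exists ([set y | 0 < h y], [set h' | forall y, h y <= h' y]) => /=.
    have ch := msmooth_continuous sh; split; first exact: (cvgr_gt _ (ch x)).
    exists h => //; split=> // y By; apply: hB; exact.
  by move=> [y h'] /= [hy hh']; exact: lt_le_trans (hh' y).
move=> [h [sh h0 hB] H]; exists h; split=> //.
by apply: H.
Qed.

(** * The Lyapunov function on forward trapped orbits *)

Section Side.
Variables (phi : R -> M -> R -> M) (U K B W1 : set M) (h : M -> R) (T : R).
Hypothesis sm : smooth_flow_family phi.
Hypothesis sh : msmooth h.
Hypothesis h_ge0 : forall x, 0 <= h x.
Hypothesis hB : forall x, B x -> h x = 0.
Hypothesis KB : K `<=` B.
Hypothesis iK : Defs.invariant (phi 0) K.
Hypothesis hW1 : forall x, (U `\` W1) x -> 0 < h x.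
Hypothesis T_gt0 : 0 < T.
Hypothesis TP : forall x t, fwd (phi 0) U x -> T <= t -> B (phi 0 x t).

Let fam : flow_family phi. Proof. exact: smooth_flow_family_is. Qed.
Let fl : is_flow (phi 0). Proof. by apply: fam.1; rewrite lexx ler01. Qed.
Local Notation H := (lyapunov phi T h).

Lemma lyapunov_ge0 x : 0 <= H x.
Proof. by apply: exp_int_ge0 => t; exact: h_ge0. Qed.

Lemma lyapunov_invariant x : K x -> H x = 0.
Proof.
move=> Kx; rewrite /lyapunov (_ : (fun t => _) = (fun t => 0 * (0 : R))).
  by rewrite exp_intZ ?mul0r// => t; exact: cst_continuous.
by apply/funext => t; rewrite mul0r hB//; apply/KB/iK.
Qed.

Lemma lyapunov_gt0 x : fwd (phi 0) U x -> ~ W1 x -> 0 < H x.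
Proof.
move=> fx nW; have [_ f0 _] := fl; apply: exp_int_gt0 => //.
  by move=> t; exact: (Ck_continuous (orbit_smooth sm x 0 sh)).
by rewrite f0; apply: hW1; split=> //; have := fx 0; rewrite f0; apply.
Qed.

Lemma lyapunov_decr x t : fwd (phi 0) U x -> 0 <= t -> H (phi 0 x t) <= H x.
Proof.
move=> fx; rewrite le_eqVlt => /orP[/eqP<-|t0].
  by have [_ -> _] := fl.
have D (s : R) := is_derive_lyapunov sm x s T_gt0 sh.
have [_ f0 _] := fl.
rewrite -[X in _ <= H X]f0.
have dH (s : R) : derivable (fun t => H (phi 0 x t)) s 1 by have [] := D s.
apply: (@ler0_derive1_nincr _ (fun t => H (phi 0 x t)) 0 t).
- by move=> s _; exact: dH.
- move=> s; rewrite in_itv/= => /andP[s0 _]; rewrite derive1E.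
  have [_ ->] := D s.
  rewrite (hB (TP (t := s + T) fx _)) ?mulr0 ?sub0r; last by rewrite lerDr ltW.
  by rewrite -opprD oppr_le0 addr_ge0// lyapunov_ge0.
- by apply: derivable_within_continuous => s _; exact: dH.
- by [].
- exact: ltW.
- by [].
Qed.

(** After time [T] the orbit is where [h] vanishes, so the derivative is [h x + c]: the level itself
    bounds it from below. *)
Lemma lyapunov_derive (c : R) x : 0 < c -> fwd (phi 0) U x -> H x = c ->
  0 < 'D_1 (fun t => c - H (phi 0 x t)) 0.
Proof.
move=> c0 fx Hx; have [_ f0 _] := fl.
have D := is_derive_lyapunov sm x 0 T_gt0 sh.
have [dH E] := D.
rewrite (@deriveB _ _ _ (cst c) (fun t => H (phi 0 x t)))//.
rewrite derive_cst sub0r E add0r f0 Hx (hB (TP fx (lexx T))) mulr0 sub0r.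
by rewrite opprB opprK ltr_wpDr.
Qed.

End Side.
End Construct.

(** * Gluing the two sublevel sets *)

Section Exists.
Variables (R : realType) (n : nat) (M : smooth_manifold R n).
Let hM : hausdorff_space M := @mfd_hausdorff _ _ M.
Implicit Types (phi : R -> M -> R -> M) (K N U : set M).

Lemma exists_block phi U K : smooth_flow_family phi -> isolates (phi 0) U K ->
  connected K -> K !=set0 -> non_saddle (phi 0) K ->
  exists N Ni No, [/\ connected N, isolates (phi 0) N K,
    [/\ compact Ni, compact No, frontier N = Ni `|` No & Ni `&` No = set0],
    forall p, Ni p -> entering phi N Ni p
  & forall p, No p -> entering (fun l => rflow (phi l)) N No p].
Proof.
move=> sm iso Kc K0 nsK.
have fam := smooth_flow_family_is sm; have sm' := rev_smooth_family sm.
have z01 : 0 <= (0 : R) <= 1 by rewrite lexx ler01.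
have fl := fam.1 _ z01; have fl' := rev_flow fl.
have iso' := rev_isolates iso.
have [cU KU cK iK mK] := iso; have clU := compact_closed hM cU.
have [_ f0 fD] := fl.
have [V [oV KV VP]] := non_saddle_nbhs nsK KU.
(* The block is going to lie in [W1], so around each of its frontier points every orbit is trapped
   in [U] in some direction. *)
pose W1 := V `&` interior U.
have oW1 : open W1 by apply: openI => //; exact: open_interior.
(* [h] is to vanish on [B], where trapped orbits end up, and to be positive on the part of [U]
   outside [W1]; the gap between the two sets leaves room for a smooth function. *)
have [B [cB KB BW1]] : exists B, [/\ compact B, K `<=` interior B & B `<=` W1].
  apply: manifold_compact_neighborhoods => //.
  by move=> x Kx; split; [exact: KV|exact: KU].
have [h [sh h0 hB hW1]] : exists h : M -> R, [/\ msmooth h, forall x, 0 <= h x,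
    forall x, B x -> h x = 0 & forall x, (U `\` W1) x -> 0 < h x].
  apply: smooth_separation; first exact: compact_closed.
    by apply: compact_closedI => //; exact: open_closedC.
  by rewrite -subset0 => x [[_ nW] /BW1].
have oB := @open_interior _ B.
have [T1 T10 TP1] := attract hM fl iso oB KB.
have [T2 T20 TP2] := attract hM fl' iso' oB KB.
(* One length for both time directions; the 1 makes it positive, since the attraction times may be
   0. *)
pose T := Num.max T1 T2 + 1.
have T0 : 0 < T by rewrite ltr_wpDl// le_max T10.
have TP x t : fwd (phi 0) U x -> T <= t -> B (phi 0 x t).
  move=> fx Tt; suff T1t : T1 <= t by exact: (interior_subset (TP1 _ _ fx T1t)).
  by apply: (le_trans _ Tt); rewrite /T -[leLHS]addr0 lerD// le_max lexx.
have TP' x t : fwd (rflow (phi 0)) U x -> T <= t -> B (rflow (phi 0) x t).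
  move=> fx Tt; suff T2t : T2 <= t by exact: (interior_subset (TP2 _ _ fx T2t)).
  by apply: (le_trans _ Tt); rewrite /T -[leLHS]addr0 lerD// le_max lexx orbT.
have KB' : K `<=` B by move=> x /KB/interior_subset.
have iK' := rev_invariant iK.
pose Ap := fwd (phi 0) U; pose Am := fwd (rflow (phi 0)) U.
pose Hp := lyapunov phi T h; pose Hm := lyapunov (fun l => rflow (phi l)) T h.
have sHp : msmooth Hp by apply: lyapunov_smooth => //; exact: ltW.
have sHm : msmooth Hm by apply: lyapunov_smooth => //; exact: ltW.
have cHp := msmooth_continuous sHp; have cHm := msmooth_continuous sHm.
have HpK x : K x -> Hp x = 0 by exact: (lyapunov_invariant T hB KB' iK).
have HmK x : K x -> Hm x = 0.
  exact: (@lyapunov_invariant _ _ _ (fun l => rflow (phi l)) K B h T hB KB' iK').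
have clAp : closed Ap by exact: closed_fwd.
have clAm : closed Am by exact: closed_fwd.
have ApU : Ap `<=` U by move=> x fx; have := fx 0; rewrite f0; exact.
have AmU : Am `<=` U by move=> x fx; have := fx 0; rewrite /rflow oppr0 f0; exact.
have cAp : compact Ap by exact: subclosed_compact clAp cU ApU.
have cAm : compact Am by exact: subclosed_compact clAm cU AmU.
(* Trapped points outside [W1] form compact sets on which [Hp], respectively [Hm], is positive. A
   level below both confines the sublevel sets to [W1]. *)
have [c [c0 cp cm]] : exists c : R, [/\ 0 < c, forall x, Ap x -> ~ W1 x -> c < Hp x
    & forall x, Am x -> ~ W1 x -> c < Hm x].
  have n1 : \forall c \near 0^'+, forall x, (Ap `\` W1) x -> c < Hp x.
    apply: compact_pos_lower => //; first by apply: compact_closedI => //; exact: open_closedC.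
    by move=> x [fx nW]; exact: (lyapunov_gt0 sm sh h0 hW1 T0 fx nW).
  have n2 : \forall c \near 0^'+, forall x, (Am `\` W1) x -> c < Hm x.
    apply: compact_pos_lower => //; first by apply: compact_closedI => //; exact: open_closedC.
    by move=> x [fx nW]; exact: (lyapunov_gt0 sm' sh h0 hW1 T0 fx nW).
  have [c [[c0 H1] H2]] := filter_ex (filterI (filterI (nbhs_right_gt (0 : R)) n1) n2).
  by exists c; split=> // x fx nW; [exact: H1|exact: H2].
pose Np := Ap `&` [set x | Hp x <= c]; pose Nm := Am `&` [set x | Hm x <= c].
pose N := Np `|` Nm.
pose Ni := Ap `&` [set x | Hp x = c]; pose No := Am `&` [set x | Hm x = c].
have cl_le (g : M -> R) : continuous g -> closed [set x | g x <= c].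
  by move=> cg; exact: (closed_comp (fun x _ => cg x) (@closed_le R c)).
have cl_eq (g : M -> R) : continuous g -> closed [set x | g x = c].
  by move=> cg; exact: (closed_comp (fun x _ => cg x) (@closed_eq R c)).
have cN : compact N.
  by apply: compactU; apply: compact_closedI => //; exact: cl_le.
have clN := compact_closed hM cN.
have NpW1 x : Np x -> W1 x.
  move=> [fx Hx]; apply: contrapT => nW; have := cp _ fx nW.
  by rewrite ltNge (Hx : Hp x <= c).
have NmW1 x : Nm x -> W1 x.
  move=> [fx Hx]; apply: contrapT => nW; have := cm _ fx nW.
  by rewrite ltNge (Hx : Hm x <= c).
have NU : N `<=` U by move=> x [[/ApU]|[/AmU]].
have ApmK x : Ap x -> Am x -> K x by exact: invariant_isolated.
have KAp x : K x -> Ap x by move=> Kx t _; exact: (interior_subset (KU _ (iK _ _ Kx))).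
have KAm x : K x -> Am x by move=> Kx t _; exact: (interior_subset (KU _ (iK _ _ Kx))).
(* Near [K] both functions are below [c], and [V] puts each point in [Ap] or in [Am]. *)
have KN : K `<=` interior N.
  move=> x Kx.
  have n1 : \forall y \near x, Hp y < c by apply: (cvgr_lt _ (cHp x)); rewrite HpK.
  have n2 : \forall y \near x, Hm y < c by apply: (cvgr_lt _ (cHm x)); rewrite HmK.
  apply: filterS3 n1 n2 (open_nbhs_nbhs (conj oV (KV _ Kx))) => y y1 y2 /VP[fy|fy].
    by left; split=> //; exact: ltW.
  by right; split=> //; exact: ltW.
have isoN : isolates (phi 0) N K.
  by split=> // L iL LN; apply: mK => // x /LN/NU.
(* Off [Am] the neighborhood [V] of [K] lies in [Ap], so there [N] is a sublevel
   set of [Hp]; symmetrically off [Ap]. *)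
have locp x : Np x -> ~ K x -> exists W : set M, nbhs x W /\
    forall q, W q -> (N q <-> 0 <= c - Hp q) /\ (Ni q <-> c - Hp q = 0).
  move=> [fx Hx] nKx; exists (V `&` ~` Am); split.
    apply: open_nbhs_nbhs; split; first by apply: openI => //; exact: closed_openC.
    by split; [have [] := NpW1 x (conj fx Hx)|move=> /(ApmK _ fx)].
  move=> q [/VP Vq nAm]; have fq : Ap q by case: Vq.
  split; rewrite ?subr_ge0; split.
  - by move=> [[]|[/nAm]].
  - by move=> Hq; left.
  - by move=> [_ ->]; rewrite subrr.
  - by move/eqP; rewrite subr_eq0 => /eqP.
have locm x : Nm x -> ~ K x -> exists W : set M, nbhs x W /\
    forall q, W q -> (N q <-> 0 <= c - Hm q) /\ (No q <-> c - Hm q = 0).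
  move=> [fx Hx] nKx; exists (V `&` ~` Ap); split.
    apply: open_nbhs_nbhs; split; first by apply: openI => //; exact: closed_openC.
    by split; [have [] := NmW1 x (conj fx Hx)|move=> /ApmK/(_ fx)].
  move=> q [/VP Vq nAp]; have fq : Am q by case: Vq.
  split; rewrite ?subr_ge0; split.
  - by move=> [[/nAp]|[]].
  - by move=> Hq; right.
  - by move=> [_ ->]; rewrite subrr.
  - by move/eqP; rewrite subr_eq0 => /eqP.
have NiK x : Ni x -> ~ K x.
  by move=> [_ Hx] /HpK H; move: c0; rewrite -(Hx : Hp x = c) H ltxx.
have NoK x : No x -> ~ K x.
  by move=> [_ Hx] /HmK H; move: c0; rewrite -(Hx : Hm x = c) H ltxx.
have sm_sub (g : M -> R) : msmooth g -> msmooth (fun x => c - g x).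
  move=> sg x d ad dx; apply: smooth_at_add; first exact: smooth_at_cst.
  by apply: smooth_at_opp; exact: sg.
have eNi p : Ni p -> entering phi N Ni p.
  move=> Nip; have [fp Hpp] := Nip.
  have [|W [nW WP]] := locp p _ (NiK _ Nip).
    by split=> //=; rewrite (Hpp : Hp p = c).
  exists (fun q => c - Hp q), W; split=> //; first exact: sm_sub.
  exact: (lyapunov_derive sm sh h0 hB T0 TP c0 fp Hpp).
have eNo p : No p -> entering (fun l => rflow (phi l)) N No p.
  move=> Nop; have [fp Hmp] := Nop.
  have [|W [nW WP]] := locm p _ (NoK _ Nop).
    by split=> //=; rewrite (Hmp : Hm p = c).
  exists (fun q => c - Hm q), W; split=> //; first exact: sm_sub.
  exact: (lyapunov_derive sm' sh h0 hB T0 TP' c0 fp Hmp).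
(* Backward along [ph] the orbit of such a point is outside [N] at once. The family is kept general
   because [No] is entered under the reversed one. *)
have entering_frontier (ph : R -> M -> R -> M) S p : smooth_flow_family ph ->
    N p -> entering ph N S p -> S p -> frontier N p.
  move=> smp Np' ent Sp; split; first exact: subset_closure.
  move=> iN; have flp := (smooth_flow_family_is smp).1 _ z01.
  have [[A1 A2] /= [nA1 nA2] A12] := entering_near smp ent.
  have [e e0 eP] := A12 (p, 0) (conj (nbhs_singleton nA1) (nbhs_singleton nA2)) z01 Sp.
  have [_ fp0 _] := flp.
  have nN : nbhs (rflow (ph 0) p 0) N by rewrite /rflow oppr0 fp0; exact: iN.
  have [d /= d0 dP] : nbhs (0 : R) (fun t => N (rflow (ph 0) p t)).
    exact: (flow_continuous_time (rev_flow flp) nN).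
  have t0 : 0 < Num.min e (d / 2) by rewrite lt_min e0 divr_gt0.
  have [|+ _] := eP (Num.min e (d / 2)); first by rewrite t0 ge_min lexx.
  apply; apply: dP; rewrite /ball_/= sub0r normrN gtr0_norm//.
  by rewrite gt_min; apply/orP; right; rewrite ltr_pdivrMr// ltr_pMr// ltr1n.
have FE : frontier N = Ni `|` No.
  apply/seteqP; split.
    move=> x fx; have Nx := frontier_sub clN fx; have [_ nix] := fx.
    have nKx : ~ K x by move=> /KN.
    case: Nx => Nx.
      left; have [W [nW WP]] := locp x Nx nKx; have [fx' Hx] := Nx; split=> //.
      apply/eqP; rewrite eq_le (Hx : Hp x <= c) leNgt /=; apply/negP => lt.
      apply: nix; have n1 : \forall y \near x, Hp y < c by exact: (cvgr_lt _ (cHp x)).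
      by apply: filterS2 n1 nW => y Hy /WP[[_ H] _]; apply: H; rewrite subr_ge0 ltW.
    right; have [W [nW WP]] := locm x Nx nKx; have [fx' Hx] := Nx; split=> //.
    apply/eqP; rewrite eq_le (Hx : Hm x <= c) leNgt /=; apply/negP => lt.
    apply: nix; have n1 : \forall y \near x, Hm y < c by exact: (cvgr_lt _ (cHm x)).
    by apply: filterS2 n1 nW => y Hy /WP[[_ H] _]; apply: H; rewrite subr_ge0 ltW.
  move=> x [Nix|Nox].
    apply: (entering_frontier phi Ni) => //; last exact: eNi.
    by left; have [fx Hx] := Nix; split=> //=; rewrite (Hx : Hp x = c).
  apply: (entering_frontier (fun l => rflow (phi l)) No) => //; last exact: eNo.
  by right; have [fx Hx] := Nox; split=> //=; rewrite (Hx : Hm x = c).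
exists N, Ni, No; split=> //; last first.
  split=> //.
  - by apply: compact_closedI => //; exact: cl_eq.
  - by apply: compact_closedI => //; exact: cl_eq.
  - rewrite -subset0 => x [Nix [fx _]]; apply: (NiK _ Nix).
    by have [fx' _] := Nix; exact: ApmK.
(* A point of [Np] stays in [Np] forward, as [Hp] does not increase along trapped orbits; likewise
   for [Nm] backward. So every point of [N] is trapped in [N]. *)
apply: (block_connected fl isoN Kc K0) => x [[fx Hx]|[fx Hx]].
  left => t t0; left; split; first exact: fwd_shift.
  exact: (le_trans (lyapunov_decr sm sh h0 hB T0 TP fx t0) Hx).
right => t t0; right; split; first exact: (fwd_shift fl').
exact: (le_trans (lyapunov_decr sm' sh h0 hB T0 TP' fx t0) Hx).
Qed.
End Exists.

(** With [Ni] and [No] disjoint, the boundary condition on them says that neither has a boundary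
    point, which [entering_submanifold] excludes in every compatible chart. *)
Lemma entering_block_manifold (R : realType) (n : nat) (M : smooth_manifold R n)
    (phi : R -> M -> R -> M) (N K Ni No : set M) :
  smooth_flow_family phi -> isolates (phi 0) N K ->
  [/\ compact Ni, compact No, frontier N = Ni `|` No & Ni `&` No = set0] ->
  (forall p, Ni p -> entering phi N Ni p) ->
  (forall p, No p -> entering (fun l => rflow (phi l)) N No p) ->
  block_sets (phi 0) N Ni No -> isolating_block_manifold (phi 0) N K.
Proof.
move=> sm iso [cNi cNo FE dis] eNi eNo blk; have sm' := rev_smooth_family sm.
have [cN _ _ _ _] := iso.
have clN := compact_closed (@mfd_hausdorff _ _ M) cN.
have subNi p (Nip : Ni p) := entering_submanifold sm (eNi p Nip) Nip.
have subNo p (Nop : No p) := entering_submanifold sm' (eNo p Nop) Nop.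
split=> //; split.
  move=> p Np; have [iN|niN] := pselect (interior N p).
    by left; exact: interior_point_of_interior.
  right; have : frontier N p by split=> //; exact: subset_closure.
  by rewrite FE => -[/subNi[]|/subNo[]].
exists Ni, No; split=> //.
- by move=> p /subNi[]; left.
- by move=> p /subNo[]; left.
- rewrite dis -subset0 => p bp; have [Nip _] := bp.
  by have [_ _] := subNi p Nip.
- rewrite dis -subset0 => p bp; have [Nop _] := bp.
  by have [_ _] := subNo p Nop.
Qed.

(** * Non-saddle continuation and components of the complement *)

Unset Implicit Arguments.

Theorem proposition4p2 (R : realType) (n : nat) (M : smooth_manifold R n)
    (phi : R -> M -> R -> M) (delta : R) (K : R -> set M)
    (M_connected : connected [set: M])
    (phi_smooth : smooth_flow_family phi)
    (delta_bounds : 0 < delta <= 1)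
    (K_continuation : continuation phi [set l | 0 <= l <= delta] K)
    (K0_connected : connected (K 0))
    (K0_non_saddle : non_saddle (phi 0) (K 0)) :
  (\forall l \near 0^'+, non_saddle (phi l) (K l))
  <->
  (exists N : set M,
    [/\ connected N,
        isolating_block_manifold (phi 0) N (K 0)
      & \forall l \near 0^'+,
          isolates (phi l) N (K l) /\
          forall C, is_component (N `\` K l) C ->
            exists! D, is_component (frontier N) D /\ D `<=` C]).
Proof.
have hM := @mfd_hausdorff _ _ M.
have fam := smooth_flow_family_is phi_smooth.
have [d0 d1] := andP delta_bounds.
have [Kiso Kcont] := K_continuation.
have J0 : [set l | 0 <= l <= delta] 0 by rewrite /= lexx ltW.
have [K0_neq0 _ [U isoU]] := Kiso 0 J0.
have cont N1 : isolates (phi 0) N1 (K 0) ->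
    \forall l \near 0^'+, isolates (phi l) N1 (K l).
  move=> iso1; have [eta eta0 H] := Kcont 0 N1 J0 iso1.
  near=> l; have l0 : 0 < l by near: l; exact: nbhs_right_gt.
  have ld : l <= delta by near: l; exact: nbhs_right_le.
  have le : l < eta by near: l; exact: nbhs_right_lt.
  apply: H; last by rewrite /= (ltW l0).
  by rewrite sub0r add0r le andbT (lt_trans _ l0)// oppr_lt0.
split=> [Kns|[N [Nc [iso [_ [Ni [No [blk _ _ _ _]]]]] comp]]]; last first.
  apply: (non_saddle_of_components hM (@manifold_compact_neighborhoods _ _ M)
    fam iso blk Nc K0_neq0 K0_non_saddle cont).
  by apply: filterS comp => l [].
have [N [Ni [No [Nc iso NiNo eNi eNo]]]] :=
  exists_block phi_smooth isoU K0_connected K0_neq0 K0_non_saddle.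
have [cNi cNo FE _] := NiNo.
(* The sets were built for the parameter 0 and bound a block of every [phi l] with small [l], so
   [block_component] can be applied to [K l], which is non-saddle by assumption. *)
have blk := block_family phi_smooth cNi cNo FE eNi eNo.
have blk0 : block_sets (phi 0) N Ni No.
  by apply: (nbhs_singleton blk); rewrite lexx ler01.
exists N; split=> //; first exact: entering_block_manifold NiNo eNi eNo blk0.
have blkr := near_right_of_near0 blk.
have isor := cont N iso.
near=> l.
have l0 : 0 < l by near: l; exact: nbhs_right_gt.
have ld : l <= delta by near: l; exact: nbhs_right_le.
have isol : isolates (phi l) N (K l) by near: l; exact: isor.
have blkl : block_sets (phi l) N Ni No by near: l; exact: blkr.
have nsl : non_saddle (phi l) (K l) by near: l; exact: Kns.
split=> //; apply: (block_component hM _ isol blkl nsl Nc).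
  by apply: fam.1; rewrite (ltW l0) (le_trans ld).
by have [] := Kiso l; rewrite /= ?(ltW l0).
Unshelve. all: by end_near. Qed.
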